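(* Let $k\ge2$ and $n\ge2k$ be integers. (1) If $n\ge2k+1$, then every intersecting family $\mathcal F\subseteq\binom{[n]}{k}$ satisfies $\rho(\mathcal F)\le\rho_0$. If moreover $(n,k)\ne(5,2)$, then $\rho(\mathcal F)=\rho_0$ (for intersecting $\mathcal F$) if and only if $\mathcal F$ is a full star, up to permutation. If $(n,k)=(5,2)$, then $\rho(\mathcal F)=\rho_0$ (for intersecting $\mathcal F$) if and only if, up to permutation, $\mathcal F$ is the full star $K_{1,4}$ or the triangle $K_3$ together with two isolated vertices (that is, $\mathcal F=\binom{[3]}{2}$ as a family on $[5]$). (2) If $n=2k$, then every intersecting family $\mathcal F\subseteq\binom{[2k]}{k}$ satisfies $$\rho(\mathcal F)\le\binom{2k-2}{k-1}=\rho_{k-1},$$ with equality if and only if, up to permutation, $\mathcal F=\binom{[2k-1]}{k}$.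
   Context: Notation: $[n]=\{1,\dots,n\}$, and $\binom{X}{k}$ is the collection of $k$-element subsets of $X$. A family is intersecting if any two of its members have nonempty intersection. For $\mathcal F\subseteq\binom{[n]}{k}$ and $x\in\mathbb R_{\ge0}^n$ put $P_{\mathcal F}(x)=k\sum_{F\in\mathcal F}\prod_{i\in F}x_i$ and $\rho(\mathcal F)=\max\{P_{\mathcal F}(x):x\ge0,\ \sum_i x_i^k=1\}$ (the spectral radius). Here $t=1$: for $0\le r\le k-1$ the Frankl family is $\mathcal A_r=\{F\in\binom{[n]}{k}:|F\cap[1+2r]|\ge 1+r\}$, and $\rho_r=\rho(\mathcal A_r)$. In particular $\mathcal A_0=\{F\in\binom{[n]}{k}:1\in F\}$ is the full star and $\mathcal A_{k-1}=\binom{[2k-1]}{k}$. ''Up to permutation'' means up to applying a permutation of the ground set $[n]$. *)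

(* Defs.v *)
From mathcomp Require Import all_boot all_order all_fingroup all_algebra.

Set Implicit Arguments.
Unset Strict Implicit.
Unset Printing Implicit Defensive.

Section Families.
Variable n : nat.
Implicit Types (F G : {set {set 'I_n}}) (X : {set 'I_n}).

Definition ksubsets X (k : nat) : {set {set 'I_n}} :=
  [set A : {set 'I_n} | A \subset X & #|A| == k].

Definition intersecting F : Prop :=
  forall A B, A \in F -> B \in F -> A :&: B != set0.

(* The ground set {1, ..., n} is modelled by 'I_n = {0, ..., n - 1}, so that
   {1, ..., m} becomes the set of all i : 'I_n with i < m. *)
Definition initial (m : nat) : {set 'I_n} := [set i : 'I_n | i < m].

Definition frankl (k r : nat) : {set {set 'I_n}} :=
  [set A in ksubsets [set: 'I_n] k | 1 + r <= #|A :&: initial (1 + 2 * r)|].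

Definition perm_family (s : {perm 'I_n}) F : {set {set 'I_n}} :=
  [set s @: A | A : {set 'I_n} in F].

Definition eq_up_to_perm F G : Prop :=
  exists s : {perm 'I_n}, F = perm_family s G.

End Families.

Arguments initial n m : clear implicits.
Arguments frankl n k r : clear implicits.

Lemma frankl0_star n k :
  frankl n.+1 k 0 = [set A in ksubsets [set: 'I_n.+1] k | ord0 \in A].
Proof.
have -> : frankl n.+1 k 0 =
    [set A in ksubsets setT k | 0 < #|A :&: [set ord0]|].
  apply/setP=> A; rewrite !inE; congr (_ && (_ < #|_ :&: _|)).
  by apply/setP=> i; rewrite !inE muln0 addn0 ltnS leqn0 -(inj_eq val_inj).
apply/setP=> A; rewrite !inE card_gt0; congr (_ && _).
apply/set0Pn/idP => [[i] | A0]; first by rewrite in_setI in_set1 => /andP[Ai /eqP <-].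
by exists ord0; rewrite !inE A0 eqxx.
Qed.

Lemma frankl_max n k :
  0 < k -> frankl n k (k - 1) = ksubsets (initial n (2 * k - 1)) k.
Proof.
case: k => // k _; rewrite subn1 /=.
have -> : initial n (2 * k.+1 - 1) = initial n (1 + 2 * k) by rewrite mulnS subn1.
apply/setP=> A; rewrite !inE subsetT /=.
case: eqP => [Ak|]; rewrite ?andbF // andbT /=.
apply/idP/setIidPl => [le_k | ->]; last by rewrite Ak add1n.
by apply/eqP; rewrite eqEcard subsetIl Ak -add1n.
Qed.

From mathcomp Require Import all_classical all_reals all_analysis.
Import Order.TTheory GRing.Theory Num.Theory numFieldNormedType.Exports.
Local Open Scope ring_scope.

Section SpectralRadius.
Variables (R : realType) (n k : nat).
Implicit Types (F : {set {set 'I_n}}) (x : 'rV[R]_n).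

Definition family_poly F x : R :=
  k%:R * \sum_(A in F) \prod_(i in A) x ord0 i.

Definition nonneg_sphere : set 'rV[R]_n :=
  [set x : 'rV[R]_n | (forall i, 0 <= x ord0 i)
                      /\ \sum_(i < n) x ord0 i ^+ k = 1]%classic.

(* For n, k > 0 this supremum is attained: see spectral_radius_max. *)
Definition spectral_radius F : R := sup (family_poly F @` nonneg_sphere)%classic.

Let continuous_family_poly F : continuous (family_poly F).
Proof.
have cP : continuous
    (fun x : 'rV[R]_n => \sum_(A in F) \prod_(i in A) x ord0 i).
  apply: (@continuous_big R _ +%R) => [|A _]; first exact: add_continuous.
  apply: (@continuous_big R _ *%R) => [|i _]; first exact: mul_continuous.
  exact: coord_continuous.
by move=> x; apply: (@cvgMl_tmp _ _ _ (nbhs_filter x)); exact: cP.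
Qed.

Let compact_nonneg_sphere : (0 < k)%N -> compact nonneg_sphere.
Proof.
move=> k0.
pose C := [set v : 'rV[R]_n |
  forall i, (`[0, 1]%classic : set R) (v ord0 i)]%classic.
have cC : compact C.
  by apply: (@rV_compact R n (fun=> `[0, 1]%classic)) => i;
    apply: segment_compact.
pose N (x : 'rV[R]_n) : R := \sum_(i < n) x ord0 i ^+ k.
have cN : continuous N.
  apply: (@continuous_big R _ +%R) => [|i _]; first exact: add_continuous.
  move=> x; apply: (@continuous_comp _ _ _ (fun M : 'rV[R]_n => M ord0 i)
    (fun y : R => y ^+ k)).
    exact: coord_continuous.
  exact: exprn_continuous.
have -> : nonneg_sphere = (C `&` N @^-1` [set 1])%classic.
  apply/seteqP; split=> x /= [x0 xN]; split=> // i; last first.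
    by have /= := x0 i; rewrite in_itv /= => /andP[].
  rewrite /= in_itv /= x0 /= -(@expr_le1 _ k) //.
  by rewrite -xN (bigD1 i) //= lerDl sumr_ge0 // => j _; apply: exprn_ge0.
apply: compact_closedI => //; apply: closed_comp; last exact: closed_eq.
by move=> x _; apply: cN.
Qed.

Lemma spectral_radius_max F : (0 < n)%N -> (0 < k)%N ->
  exists2 x, nonneg_sphere x &
    family_poly F x = spectral_radius F
    /\ forall y, nonneg_sphere y -> family_poly F y <= spectral_radius F.
Proof.
move=> n0 k0; have S0 : (nonneg_sphere !=set0)%classic.
  pose i0 := Ordinal n0; exists (delta_mx ord0 i0); split=> [i|].
    by rewrite mxE ler0n.
  rewrite (bigD1 i0) //= mxE !eqxx expr1n big1 ?addr0 // => i /negPf ni.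
  by rewrite mxE ni andbF expr0n gtn_eqF.
have [|x + xmax] :=
    EVT_max_rV S0 (compact_nonneg_sphere k0) (f := family_poly F).
  exact/continuous_subspaceT/continuous_family_poly.
rewrite inE => Sx.
have ub y : nonneg_sphere y -> family_poly F y <= family_poly F x.
  by move=> Sy; apply: xmax; rewrite inE.
have eqx : family_poly F x = spectral_radius F.
  apply/eqP; rewrite eq_le; apply/andP; split.
    apply: ub_le_sup; last by exists x.
    by exists (family_poly F x) => _ [y Sy <-]; apply: ub.
  apply: ge_sup; first by exists (family_poly F x), x.
  by move=> _ [y Sy <-]; apply: ub.
by exists x => //; rewrite -eqx.
Qed.

End SpectralRadius.

(* Main.v *)
(** Write [x^A] for the product of the [x_i], [i] in [A].

    Case [n = 2k].  A member [A] of [F] excludes its complement [A^c].  Put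
    [r = (sum x_i^k) / (2k - 1)], let [g] be the product of all [x_i] and [E] the average of [x^A]
    over the [k]-sets.  Summing [(1 - g/r^2) (x^A - r) <= x^A + x^(A^c) - r - g/r] over one set of
    each complementary pair reduces the bound to [r^2 - 2 r E + g >= 0].  Let [x] be a point of the
    sphere which minimizes this form.  If all [x_i] are positive, first and second variations in two
    coordinates show that at most one [x_i] is below the maximum, and then the form is nonnegative;
    otherwise some [x_i] vanishes and AM-GM applies.

    Case [n > 2k], [k >= 3].  Let [F] be an intersecting family of maximal spectral radius with
    optimal vector [x], sorted decreasingly.  Shifting and enlarging [F] do not decrease the value at
    [x], so [F] may be taken shifted and maximal.  Let [m] be least such that [F] is invariant under
    exchanging coordinates [>= m]; then [x] has a constant value [b] there.  Suppose [m > 1], let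
    [e = m - 1] and [a = x_e].  Comparing the stationarity conditions at [e] and at a coordinate
    [l >= m] expresses [a^k - b^k] by the members of [F] which leave [F] when [e] is replaced by [l].
    By maximality their traces [B] on the first [e] points come in complementary pairs, and the
    contribution of each pair is shown to have the wrong sign.  This fails only if [b = 0] or
    [m = 2k - 1]; then [x] is concentrated on [2k - 1] points, and AM-GM on these points gives less
    than a suitable test vector gives for the star.  Hence [m = 1], and [F] is a star.

    Case [n > 2k], [k = 2].  An intersecting graph is contained in a star or in a triangle. *)

Require Import Defs.
From mathcomp Require Import all_boot all_order all_fingroup all_algebra reals.
From mathcomp Require Import zify ring lra.
From mathcomp Require all_classical all_analysis.
Set Implicit Arguments.
Unset Strict Implicit.
Unset Printing Implicit Defensive.
Import Order.TTheory GRing.Theory Num.Theory.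
Local Open Scope ring_scope.

(** [dominates] is the homogeneous form of a bound on the radius: without the constraint on
    [power_sum], single coordinates vary freely and no Lagrange multiplier is needed. Likewise
    [excess] carries a factor [M]: at the least [M] making it nonnegative, it vanishes at some
    nonzero vector, where all variations are unconstrained. A test vector gives [M >= 1], so it
    remains to exclude [M > 1].

    For [n > 2k] the wrong sign of a complementary pair comes from optimality itself ([pull]):
    exchanging the sets of one trace for sets of another gives a competing intersecting family,
    which bounds the ratio of the two trace weights. The two such bounds force the ratio of the
    coordinates [e] and [l] to be so large that its [k]-th power outweighs the other terms. This
    just fails for [n = 7], [k = 3], where one more member has to be counted.

    Shifting and enlarging may change an optimal family, so they do not give uniqueness directly.
    They are undone by strictness: at an optimal vector of a star all coordinates are positive and
    the centre is strictly largest. *)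

Ltac nat_lia :=
  repeat match goal with H : ?T |- _ =>
    lazymatch T with
    | is_true (leq _ _) => fail | is_true (_ && _) => fail | is_true (~~ _) => fail
    | @eq nat _ _ => fail | @eq bool _ _ => fail | _ => clear H
    end
  end; lia.

(** * Monomials and stationarity *)

Section PolynomialMinimum.
Variable R : realFieldType.
Implicit Types p : {poly R}.

Lemma poly_bounded p : exists K : R, forall t : R, `|t| <= 1 -> `|p.[t]| <= K.
Proof.
elim/poly_ind: p => [|p c [K IH]]; first by exists 0 => t _; rewrite horner0 normr0.
exists (K + `|c|) => t t1; rewrite hornerMXaddC.
apply: le_trans (ler_normD _ _) _; rewrite lerD2r normrM.
by rewrite (le_trans _ (IH _ t1)) // ler_piMr.
Qed.

Lemma poly_split0 p : exists q, p = q * 'X + p.[0]%:P.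
Proof.
elim/poly_ind: p => [|p c _]; first by exists 0; rewrite mul0r horner0 addr0.
by exists p; rewrite hornerMXaddC mulr0 add0r.
Qed.

(** An algebraic limit from the right: in [p = q * 'X + p.[0]] the factor [q] is bounded near 0, so
    a negative [p.[0]] would persist for small [t]. *)
Lemma horner0_ge0 p (d : R) : 0 < d -> (forall t, 0 < t <= d -> 0 <= p.[t]) ->
  0 <= p.[0].
Proof.
move=> d0 pge0; rewrite leNgt; apply/negP => p0.
have [q Eq] := poly_split0 p; have [K bK] := poly_bounded q.
have K0 : 0 <= K by apply: le_trans (bK 0 _); rewrite ?normr_ge0 ?normr0.
have KK0 : 0 < K + 1 by lra.
pose t := Num.min (Num.min d 1) (- p.[0] / (2 * (K + 1))).
have t0 : 0 < t by rewrite !lt_min d0 ltr01 /= divr_gt0 //; lra.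
have [td t1 tq] : [/\ t <= d, t <= 1 & t <= - p.[0] / (2 * (K + 1))].
  by rewrite /t !ge_min !lexx !orbT.
have := pge0 t; rewrite t0 td => /(_ isT).
rewrite {1}Eq hornerD hornerC hornerMX.
move: tq; rewrite ler_pdivlMr; last by lra.
have := bK t; rewrite gtr0_norm // => /(_ t1); rewrite ler_norml => /andP[_ qK].
have : q.[t] * t <= K * t by rewrite ler_pM2r.
nra.
Qed.

(** Dividing by ['X] leaves a cofactor that is nonnegative on the right of 0 and nonpositive on the
    left, hence zero at 0; a second division leaves a nonnegative value. *)
Lemma poly_min0 p (d : R) : 0 < d -> (forall t, `|t| <= d -> 0 <= p.[t]) ->
  p.[0] = 0 -> p^`().[0] = 0 /\ 0 <= p^`()^`().[0].
Proof.
move=> d0 pge0 p0.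
have [q Eq] := poly_split0 p; have [r Er] := poly_split0 q.
rewrite p0 addr0 in Eq.
have q0 : q.[0] = 0.
  apply/eqP; rewrite eq_le; apply/andP; split; last first.
    apply: (horner0_ge0 d0) => t /andP[t0 td].
    have := pge0 t; rewrite gtr0_norm // => /(_ td).
    by rewrite Eq hornerMX pmulr_lge0.
  pose q' := - (q \Po (- 'X)).
  have : 0 <= q'.[0].
    apply: (horner0_ge0 d0) => t /andP[t0 td].
    have := pge0 (- t); rewrite normrN gtr0_norm // => /(_ td).
    by rewrite Eq hornerMX /q' !hornerE horner_comp !hornerE mulrN -mulNr pmulr_lge0.
  by rewrite /q' !hornerE horner_comp !hornerE oppr0 oppr_ge0.
rewrite q0 addr0 in Er.
have r0 : 0 <= r.[0].
  apply: (horner0_ge0 d0) => t /andP[t0 td].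
  have := pge0 t; rewrite gtr0_norm // => /(_ td).
  by rewrite Eq Er !hornerMX !pmulr_lge0.
rewrite Eq Er !derivE !hornerE; split; first by ring.
by rewrite !addr_ge0.
Qed.

End PolynomialMinimum.

Section Monomials.
Variables (R : realFieldType) (T : finType).
Implicit Types (x y : T -> R) (A B : {set T}) (F G : {set {set T}}).

Definition mon x A := \prod_(i in A) x i.
Definition weight x F := \sum_(A in F) mon x A.
Definition power_sum k x := \sum_i x i ^+ k.
(** Homogeneous form of the bound [spectral_radius <= k * w]; [w] always stands for a radius divided
    by [k]. *)
Definition dominates k (w : R) F :=
  forall y, (forall i, 0 <= y i) -> weight y F <= w * power_sum k y.

Lemma mon_ge0 x A : (forall i, 0 <= x i) -> 0 <= mon x A.
Proof. by move=> x0; apply: prodr_ge0. Qed.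

Lemma mon_gt0 x A : (forall i, i \in A -> 0 < x i) -> 0 < mon x A.
Proof. by move=> x0; apply: prodr_gt0. Qed.

Lemma weight_ge0 x F : (forall i, 0 <= x i) -> 0 <= weight x F.
Proof. by move=> x0; apply: sumr_ge0 => A _; apply: mon_ge0. Qed.

Lemma mon_eq x y A : {in A, x =1 y} -> mon x A = mon y A.
Proof. by move=> xy; apply: eq_bigr. Qed.

Lemma monD1 x A i : i \in A -> mon x A = x i * mon x (A :\ i).
Proof. by move=> iA; rewrite /mon (big_setD1 i). Qed.

Lemma monU1 x A i : i \notin A -> mon x (i |: A) = x i * mon x A.
Proof. by move=> iA; rewrite /mon big_setU1. Qed.

Lemma monU x A B : [disjoint A & B] -> mon x (A :|: B) = mon x A * mon x B.
Proof.
move=> dAB; rewrite /mon -bigU //.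
by apply: eq_bigl => i; rewrite !inE.
Qed.

Lemma mon_const x A (c : R) : {in A, forall i, x i = c} -> mon x A = c ^+ #|A|.
Proof. by move=> xc; rewrite /mon (eq_bigr (fun=> c)) // prodr_const. Qed.

Lemma mon_eq0 x A i : i \in A -> x i = 0 -> mon x A = 0.
Proof. by move=> iA xi; rewrite (monD1 _ iA) xi mul0r. Qed.

Lemma weight_subset x F G : (forall i, 0 <= x i) -> F \subset G ->
  weight x F <= weight x G.
Proof.
move=> x0 /setIidPr FG; rewrite /weight [leRHS](big_setID F) /= FG lerDl.
exact: weight_ge0.
Qed.

Lemma AGM_mon k x A : (forall i, 0 <= x i) -> #|A| = k -> (0 < k)%N ->
  k%:R * mon x A <= \sum_(i in A) x i ^+ k.
Proof.
move=> x0 Ak k0.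
have k0R : 0 < k%:R :> R by rewrite ltr0n.
have := (leif_AGM (A := mem A) (E := fun i => x i ^+ k) (fun i _ => exprn_ge0 k (x0 i))).1.
have s0 : 0 <= \sum_(i in A) x i ^+ k by apply: sumr_ge0 => i _; rewrite exprn_ge0.
rewrite /= prodrXl Ak ler_pXn2r ?nnegrE ?mon_ge0 ?divr_ge0 ?ler0n //.
by rewrite ler_pdivlMr // mulrC.
Qed.

Lemma AGM_mon_eq k x A : (forall i, 0 <= x i) -> #|A| = k -> (0 < k)%N ->
  k%:R * mon x A = \sum_(i in A) x i ^+ k -> {in A &, forall i j, x i = x j}.
Proof.
move=> x0 Ak k0 E i j iA jA.
have k0R : 0 < k%:R :> R by rewrite ltr0n.
have := (leif_AGM (A := mem A) (E := fun i => x i ^+ k) (fun i _ => exprn_ge0 k (x0 i))).2.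
rewrite /= prodrXl Ak -E [_ * mon x A]mulrC mulfK ?(lt0r_neq0 k0R) // eqxx => /esym.
move=> /forall_inP /(_ i iA) /forall_inP /(_ j jA) /eqP /pexpIrn.
by apply; rewrite ?nnegrE.
Qed.

(* [weight] is affine in a single coordinate. *)
Lemma stationary k w F x i : (1 < k)%N -> (forall j, 0 <= x j) ->
  dominates k w F -> weight x F = w * power_sum k x ->
  \sum_(A in F | i \in A) mon x (A :\ i) = w * k%:R * x i ^+ k.-1.
Proof.
move=> k1 x0 dom Ex; set d := \sum_(A in F | _) _.
have d0 : 0 <= d by apply: sumr_ge0 => A _; apply: mon_ge0.
pose y t j := if j == i then x i + t else x j.
have yS t : power_sum k (y t) = power_sum k x + ((x i + t) ^+ k - x i ^+ k).
  rewrite /power_sum (bigD1 i) //= [in RHS](bigD1 i) //= {1}/y eqxx.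
  rewrite (eq_bigr (fun j => x j ^+ k)); first by ring.
  by move=> j /negPf ji; rewrite /y ji.
have yW t : weight (y t) F = weight x F + t * d.
  rewrite /weight /d mulr_sumr big_mkcondr -big_split /=; apply: eq_bigr => A _.
  have yA : {in A :\ i, y t =1 x} by move=> j; rewrite !inE /y => /andP[/negPf->].
  case: ifPn => iA; last first.
    rewrite addr0; apply: mon_eq => j jA; rewrite /y; case: eqP => // ji.
    by rewrite -ji jA in iA.
  rewrite (monD1 _ iA) (monD1 x iA) (mon_eq yA) /y eqxx; ring.
have H t : - x i <= t -> t * d <= w * ((x i + t) ^+ k - x i ^+ k).
  move=> tx; have := dom (y t); rewrite yS yW Ex => H.
  have : forall j, 0 <= y t j by move=> j; rewrite /y; case: eqP => // _; lra.
  by move/H; rewrite mulrDr; lra.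
(* At [x i = 0] only increases are admissible: divide [t * d <= w * t ^+ k] by [t] and let [t] tend
   to 0 to get [d <= 0]. *)
have [xi0|xi0] := eqVneq (x i) 0.
  rewrite xi0 expr0n gtn_eqF ?mulr0; last by lia.
  apply/eqP; rewrite eq_le d0 andbT.
  pose p : {poly R} := w *: 'X^(k.-1) - d%:P.
  have : 0 <= p.[0].
    apply: (horner0_ge0 ltr01) => t /andP[t0 _].
    have := H t; rewrite xi0 oppr0 add0r => /(_ (ltW t0)).
    rewrite !hornerE expr0n gtn_eqF; last by lia.
    case: k k1 {p H yS dom Ex} => // k _; rewrite subr0 exprS mulrCA ler_pM2l //= subr_ge0.
    by [].
  by rewrite !hornerE expr0n gtn_eqF ?mulr0 ?sub0r ?oppr_ge0 //; lia.
have xi : 0 < x i by rewrite lt_neqAle eq_sym xi0 x0.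
pose p : {poly R} := w *: (('X + (x i)%:P) ^+ k - (x i ^+ k)%:P) - d *: 'X.
have [|||] := @poly_min0 R p (x i) => //.
- move=> t; rewrite ler_norml => /andP[t1 _].
  by have := H t t1; rewrite /p !hornerE [t + _]addrC [t * d]mulrC; lra.
- by rewrite /p !hornerE; ring.
rewrite /p !derivE deriv_exp !derivE !hornerE => E _.
rewrite hornerMn !hornerE -mulr_natl in E; lra.
Qed.

Lemma sum_mon_mem x F i :
  \sum_(A in F | i \in A) mon x A = x i * \sum_(A in F | i \in A) mon x (A :\ i).
Proof. by rewrite mulr_sumr; apply: eq_bigr => A /andP[_ /monD1->]. Qed.

Lemma stationary_mem k w F x i : (1 < k)%N -> (forall j, 0 <= x j) ->
  dominates k w F -> weight x F = w * power_sum k x ->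
  \sum_(A in F | i \in A) mon x A = w * k%:R * x i ^+ k.
Proof.
move=> k1 x0 dom Ex; rewrite sum_mon_mem (stationary i k1 x0 dom Ex).
by rewrite mulrCA -exprS prednK //; lia.
Qed.

End Monomials.

Section Swap.
Variable T : finType.
Implicit Types (A : {set T}) (i j : T).

Lemma cards_swap A i j : i \in A -> j \notin A -> #|j |: (A :\ i)| = #|A|.
Proof.
move=> iA jA; rewrite cardsU1 !inE (negPf jA) andbF /=.
by rewrite [in RHS](cardsD1 i) iA.
Qed.

Lemma swapK A i j : i \in A -> j \notin A -> i |: ((j |: (A :\ i)) :\ j) = A.
Proof. by move=> iA jA; rewrite setU1K ?inE ?(negPf jA) ?andbF // setD1K. Qed.

End Swap.

(** * Extremality conditions in two coordinates *)

Section PairStationary.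
Variable R : realFieldType.
Implicit Types (u w c : R) (k : nat).

(** The power stays behind an abstract polynomial with known derivatives at 0, so later
    differentiations never expand it. *)
Lemma shift_pow_derivs k c : exists q : {poly R},
  [/\ forall t, q.[t] = (t + c) ^+ k, q^`().[0] = k%:R * c ^+ k.-1
    & q^`()^`().[0] = k%:R * k.-1%:R * c ^+ k.-2].
Proof.
have D m : ((('X + c%:P) ^+ m)^`() : {poly R}) = ('X + c%:P) ^+ m.-1 *+ m.
  by rewrite deriv_exp derivD derivX derivC addr0 mul1r.
exists (('X + c%:P) ^+ k); split=> [t||]; first by rewrite !hornerE.
  by rewrite D hornerMn !hornerE mulr_natl.
by rewrite D derivMn D !hornerMn !hornerE -mulrA !mulr_natl -!mulrnA mulnC.
Qed.

Lemma anti_shift_pow_derivs k c : exists q : {poly R},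
  [/\ forall t, q.[t] = (c - t) ^+ k, q^`().[0] = - (k%:R * c ^+ k.-1)
    & q^`()^`().[0] = k%:R * k.-1%:R * c ^+ k.-2].
Proof.
have D m : (((c%:P - 'X) ^+ m)^`() : {poly R}) = - ((c%:P - 'X) ^+ m.-1 *+ m).
  by rewrite deriv_exp derivD derivN derivX derivC add0r mulN1r mulNrn.
exists ((c%:P - 'X) ^+ k); split=> [t||]; first by rewrite !hornerE.
  by rewrite D hornerN hornerMn !hornerE subr0 mulr_natl.
rewrite D derivN derivMn D mulNrn opprK !hornerMn !hornerE subr0.
by rewrite -mulrA !mulr_natl -!mulrnA mulnC.
Qed.

(** Complete homogeneous polynomial of degree [k.-1], which extends [(u ^+ k - w ^+ k) / (u - w)] to
    [u = w]. *)
Definition hsum k u w := \sum_(i < k) u ^+ (k.-1 - i) * w ^+ i.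

Lemma hsum_mul k u w : u ^+ k - w ^+ k = (u - w) * hsum k u w.
Proof. exact: subrXX. Qed.

Lemma hsum_diag k c : hsum k c c = k%:R * c ^+ k.-1.
Proof.
rewrite /hsum (eq_bigr (fun=> c ^+ k.-1)); last first.
  by move=> i _; rewrite -exprD subnK // -ltnS prednK //; case: k i => [[]|].
by rewrite sumr_const card_ord mulr_natl.
Qed.

Lemma hsum_ltr k u w w' : (1 < k)%N -> 0 < u -> 0 <= w -> w < w' ->
  hsum k u w < hsum k u w'.
Proof.
case: k => [|[|k]] // _ u0 w0 ww'; rewrite /hsum big_ord_recr [ltRHS]big_ord_recr /=.
apply: ler_ltD.
  apply: ler_sum => i _; rewrite ler_pM2l ?exprn_gt0 //.
  by rewrite lerXn2r ?nnegrE // ltW // (le_lt_trans w0).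
by rewrite ltr_pM2l ?exprn_gt0 // ltrXn2r.
Qed.

Lemma hsumC k u w : hsum k u w = hsum k w u.
Proof.
rewrite /hsum (reindex_inj rev_ord_inj); apply: eq_bigr => i _ /=.
rewrite mulrC; congr (_ ^+ _ * _ ^+ _); case: k i => [[]|k i] //=; have := ltn_ord i; lia.
Qed.

Section Pair.
Variables (k : nat) (M s al be ga g u w : R).
(** The later [excess] as a function of two coordinates, the others frozen: [s] is the rest of the
    power sum, [al], [be], [ga] come from the elementary symmetric polynomial and [g] from the
    product. *)
Let phi y z := M * (s + y ^+ k + z ^+ k) ^+ 2
  - (al + be * (y + z) + ga * (y * z)) * (s + y ^+ k + z ^+ k) + g * (y * z).
Hypotheses (k1 : (1 < k)%N) (u0 : 0 < u) (w0 : 0 < w).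
Hypothesis phi_ge0 : forall y z, 0 <= y -> 0 <= z -> 0 <= phi y z.
Hypothesis phi0 : phi u w = 0.
Let S := s + u ^+ k + w ^+ k.
Let e := al + be * (u + w) + ga * (u * w).
Let Lam := k%:R * (2 * M * S - e).

Lemma pair_first_order : Lam * u ^+ k.-1 = S * (be + ga * w) - g * w.
Proof.
have [q [qE q1 _]] := shift_pow_derivs k u.
pose l : {poly R} := (be + ga * w) *: 'X + e%:P.
pose p' : {poly R} := M *: (q + (s + w ^+ k)%:P) ^+ 2 - l * (q + (s + w ^+ k)%:P)
   + (g * w) *: ('X + u%:P).
have pE t : p'.[t] = M * (q.[t] + (s + w ^+ k)) ^+ 2
    - ((be + ga * w) * t + e) * (q.[t] + (s + w ^+ k)) + g * w * (t + u).
  by rewrite /p' /l !(hornerD, hornerN, hornerM, hornerZ, hornerC, hornerX, horner_exp).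
have [||] := @poly_min0 R p' u u0.
- move=> t; rewrite ler_norml => /andP[t1 _].
  have tu : 0 <= t + u by lra.
  suff -> : p'.[t] = phi (t + u) w by exact: phi_ge0 (ltW w0).
  by rewrite pE qE /phi /e; ring.
- by rewrite -[RHS]phi0 pE qE /phi add0r /e; ring.
rewrite /p' /l !derivE !(hornerD, hornerN, hornerM, hornerZ, hornerC, hornerX, horner_exp).
rewrite !qE q1 add0r => E _.
apply/eqP; rewrite -subr_eq0 -E /Lam /S; apply/eqP; ring.
Qed.

(** Second variation along [(u + t, u - t)]: the sum is fixed, so the [be] term is constant, and the
    product only loses [t ^+ 2]. The first-order equation then eliminates [ga] and [g]. *)
Lemma pair_second_order : u = w -> S * be <= k%:R * (Lam * u ^+ k.-1).
Proof.
move=> uw; have [q [qE q1 q2]] := shift_pow_derivs k u.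
have [r [rE r1 r2]] := anti_shift_pow_derivs k u.
pose L : {poly R} := s%:P + q + r.
pose p : {poly R} := M *: L ^+ 2 - (e%:P - ga *: 'X ^+ 2) * L + g *: ((u ^+ 2)%:P - 'X ^+ 2).
have pE t : p.[t] = M * (s + q.[t] + r.[t]) ^+ 2
    - (e - ga * t ^+ 2) * (s + q.[t] + r.[t]) + g * (u ^+ 2 - t ^+ 2).
  by rewrite /p /L !(hornerD, hornerN, hornerM, hornerZ, hornerC, hornerX, horner_exp).
have [||] := @poly_min0 R p u u0.
- move=> t; rewrite ler_norml => /andP[t1 t2].
  have tu : 0 <= t + u by lra.
  have ut : 0 <= u - t by lra.
  suff -> : p.[t] = phi (t + u) (u - t) by exact: phi_ge0.
  by rewrite pE qE rE /phi /e -uw; ring.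
- by rewrite -[RHS]phi0 pE qE rE /phi add0r subr0 /e -uw; ring.
move=> _; rewrite /p /L !derivE.
rewrite !(hornerD, hornerN, hornerM, hornerZ, hornerC, hornerX, horner_exp, hornerMn).
rewrite !qE !rE q1 r1 q2 r2 !add0r !subr0 => E.
have := pair_first_order; rewrite -uw => F.
have k1S : k.-1 = k.-2.+1 by lia.
have kR : k%:R = k.-1%:R + 1 :> R by rewrite natr1; congr (_%:R); lia.
have : 0 <= (Lam * k.-1%:R * u ^+ k.-2 + (S * ga - g)) * 2.
  by move: E; congr (0 <= _); rewrite /Lam /S -uw; ring.
rewrite pmulr_lge0 // => {}E.
have : 0 <= (Lam * k.-1%:R * u ^+ k.-2 + (S * ga - g)) * u by rewrite pmulr_lge0.
have -> : (Lam * k.-1%:R * u ^+ k.-2 + (S * ga - g)) * u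
    = k.-1%:R * (Lam * u ^+ k.-1) + (S * ga - g) * u by rewrite k1S exprS; ring.
rewrite kR F; lra.
Qed.

End Pair.

(* For [u = w] the first-order conditions say nothing and the bound is the second-order one. *)
Lemma pair_extremal k M s al be ga g u w
    (phi := fun y z => M * (s + y ^+ k + z ^+ k) ^+ 2
      - (al + be * (y + z) + ga * (y * z)) * (s + y ^+ k + z ^+ k) + g * (y * z))
    (S := s + u ^+ k + w ^+ k)
    (Lam := k%:R * (2 * M * S - (al + be * (u + w) + ga * (u * w)))) :
  (1 < k)%N -> 0 < u -> 0 < w -> (forall y z, 0 <= y -> 0 <= z -> 0 <= phi y z) ->
  phi u w = 0 ->
  S * be <= Lam * hsum k u w /\ (u != w -> Lam * hsum k u w = S * be).
Proof.
move=> k1 u0 w0 phi_ge0 phi0.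
have [uw|uw] := eqVneq u w.
  split=> //; have H := pair_second_order k1 u0 w0 phi_ge0 phi0 uw.
  by rewrite /Lam /S -uw hsum_diag [leRHS]mulrCA; move: H; rewrite -uw.
suff E : Lam * hsum k u w = S * be by split=> //; rewrite E.
have kS : k = k.-1.+1 by lia.
have Fu := pair_first_order u0 w0 phi_ge0 phi0.
have phiC y z : phi y z = phi z y by rewrite /phi; ring.
have phi_ge0' y z : 0 <= z -> 0 <= y -> 0 <= phi z y by move=> *; rewrite phi_ge0.
have Fw := pair_first_order w0 u0 phi_ge0 (etrans (phiC w u) phi0).
(* Multiplied by [u] and [w] and subtracted, the two first-order equations lose their terms in [ga]
   and [g], which become symmetric. *)
apply: (@mulfI _ (u - w)); first by rewrite subr_eq0.
rewrite mulrCA -hsum_mul {1 2}kS !exprS.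
have -> : Lam * (u * u ^+ k.-1 - w * w ^+ k.-1)
   = u * (Lam * u ^+ k.-1) - w * (Lam * w ^+ k.-1) by ring.
rewrite /Lam /S Fu.
have -> : s + u ^+ k + w ^+ k = s + w ^+ k + u ^+ k by ring.
have -> : al + be * (u + w) + ga * (u * w) = al + be * (w + u) + ga * (w * u) by ring.
rewrite Fw; ring.
Qed.

End PairStationary.

(** * Elementary symmetric polynomials and power sums *)

Section ElementarySymmetric.
Variables (R : realFieldType) (T : finType).
Implicit Types (x y : T -> R) (A D : {set T}) (k : nat).

Definition elsym k D x := \sum_(A : {set T} | (A \subset D) && (#|A| == k)) mon x A.

Lemma elsym_split k D x i : i \in D ->
  elsym k.+1 D x = elsym k.+1 (D :\ i) x + x i * elsym k (D :\ i) x.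
Proof.
move=> iD; rewrite /elsym (bigID (fun A : {set T} => i \in A)) /= addrC; congr (_ + _).
  by apply: eq_bigl => A; rewrite subsetD1 -andbA [(_ == _) && _]andbC andbA.
rewrite mulr_sumr (reindex_onto (fun A : {set T} => i |: A) (fun A => A :\ i)) /=; last first.
  by move=> A /andP[_ iA]; rewrite setD1K.
apply: eq_big => [A|A].
  rewrite setU11 andbT subsetD1.
  have [iA|iA] := boolP (i \in A).
    rewrite andbF /=; apply/negbTE; rewrite negb_and orbC; apply/orP; left.
    by apply/eqP => /setP /(_ i); rewrite !inE eqxx iA.
  by rewrite setU1K // eqxx !andbT cardsU1 iA add1n eqSS subUset sub1set iD.
move=> /andP[_ /eqP E]; rewrite monU1 //.
by rewrite -E !inE eqxx.
Qed.

Lemma elsym_ge0 k D x : (forall i, 0 <= x i) -> 0 <= elsym k D x.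
Proof. by move=> x0; apply: sumr_ge0 => A _; apply: mon_ge0. Qed.

Lemma elsym_eq k D x y : {in D, x =1 y} -> elsym k D x = elsym k D y.
Proof.
move=> xy; apply: eq_bigr => A /andP[/subsetP AD _]; apply: mon_eq => i iA.
by rewrite xy // AD.
Qed.

Lemma elsym_const k D x c : {in D, forall i, x i = c} -> elsym k D x = 'C(#|D|, k)%:R * c ^+ k.
Proof.
move=> xc; rewrite /elsym (eq_bigr (fun=> c ^+ k)); last first.
  by move=> A /andP[/subsetP AD /eqP <-]; apply: mon_const => i /AD /xc.
rewrite sumr_const mulr_natl -cards_draws; congr (_ *+ _).
by apply: eq_card => A; rewrite inE.
Qed.

(* Every point of [D] lies in ['C(#|D|.-1, k.-1)] of the sets counted by [elsym k D]. *)
Lemma sum_draws k D (f : T -> R) : (0 < k)%N ->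
  \sum_(A : {set T} | (A \subset D) && (#|A| == k)) \sum_(i in A) f i
    = 'C(#|D|.-1, k.-1)%:R * \sum_(i in D) f i.
Proof.
move=> k0; pose P A := (A \subset D) && (#|A| == k).
rewrite (exchange_big_dep (mem D)) /=; last first.
  by move=> A i /andP[/subsetP AD _] /AD.
rewrite mulr_sumr; apply: eq_bigr => i iD; rewrite sumr_const mulr_natl; congr (_ *+ _).
have cD : #|D :\ i| = #|D|.-1 by rewrite (cardsD1 i D) iD.
rewrite -cD -cards_draws; set X := [set A | _].
have <- : #|[set i |: A | A : {set T} in X]| = #|X|.
  rewrite card_in_imset // => A B; rewrite !inE !subsetD1 => /andP[/andP[_ iA] _] /andP[/andP[_ iB] _] E.
  by rewrite -(setU1K iA) E setU1K.
apply: eq_card => A; rewrite unfold_in; apply/idP/imsetP.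
  move=> /andP[/andP[AD /eqP Ak] iA]; exists (A :\ i); last by rewrite setD1K.
  rewrite inE setSD //=; have := cardsD1 i A; rewrite iA Ak add1n => ->.
  by rewrite eqxx.
move=> [B]; rewrite inE subsetD1 => /andP[/andP[BD iB] /eqP Bk] ->.
rewrite setU11 andbT cardsU1 iB Bk add1n prednK // eqxx andbT.
by rewrite subUset sub1set iD.
Qed.

Lemma elsym_le_power_sum k D x : (forall i, 0 <= x i) -> (0 < k)%N ->
  k%:R * elsym k D x <= 'C(#|D|.-1, k.-1)%:R * \sum_(i in D) x i ^+ k.
Proof.
move=> x0 k0; rewrite -sum_draws // mulr_sumr; apply: ler_sum => A /andP[_ /eqP Ak].
exact: AGM_mon.
Qed.

(** Equality must hold in AM-GM for every [k]-subset, and since [2 <= k <= #|D|] any two points of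
    [D] share one. *)
Lemma elsym_eq_power_sum k D x : (forall i, 0 <= x i) -> (1 < k)%N -> (k <= #|D|)%N ->
  k%:R * elsym k D x = 'C(#|D|.-1, k.-1)%:R * \sum_(i in D) x i ^+ k ->
  {in D &, forall i j, x i = x j}.
Proof.
move=> x0 k1 kD E i j iD jD; have [->//|ij] := eqVneq i j.
have k0 : (0 < k)%N by lia.
have [A [AD Ak iA jA]] : exists A : {set T}, [/\ A \subset D, #|A| = k, i \in A & j \in A].
  have : (0 < #|[set A : {set T} | A \subset D :\ i :\ j & #|A| == k.-2]|)%N.
    rewrite cards_draws bin_gt0; have := cardsD1 i D; have := cardsD1 j (D :\ i).
    by rewrite !inE eq_sym ij iD jD /=; lia.
  rewrite card_gt0 => /set0Pn[A]; rewrite inE !subsetD1 -andbA => /and3P[/andP[AD iA] jA /eqP Ak].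
  exists (i |: (j |: A)); rewrite !inE !eqxx orbT; split=> //.
    by rewrite !subUset !sub1set iD jD.
  rewrite !cardsU1 !inE negb_or iA jA ij Ak; lia.
apply: (AGM_mon_eq x0 Ak k0) => //.
move: E; rewrite -sum_draws // mulr_sumr => /eqP; rewrite eq_le => /andP[_].
rewrite (bigD1 A) ?AD ?Ak ?eqxx //= [leRHS](bigD1 A) ?AD ?Ak ?eqxx //= => H.
apply/eqP; rewrite eq_le AGM_mon //=.
have : \sum_(B : {set T} | (B \subset D) && (#|B| == k) && (B != A)) k%:R * mon x B
   <= \sum_(B : {set T} | (B \subset D) && (#|B| == k) && (B != A)) \sum_(i in B) x i ^+ k.
  by apply: ler_sum => B /andP[/andP[_ /eqP Bk] _]; apply: AGM_mon.
lra.
Qed.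

End ElementarySymmetric.

(** * Intersecting families of half-sets *)

(** ['C((2 * k).-1, k)] counts the complementary pairs of [k]-sets and ['C((2 * k).-2, k.-1)] is the
    claimed bound; this converts one into the other. *)
Lemma central_bin k : (k * 'C((2 * k).-1, k) = (2 * k).-1 * 'C((2 * k).-2, k.-1))%N.
Proof.
by case: k => [|k] //; rewrite mul_bin_diag.
Qed.

Section Excess.
Variables (R : realFieldType) (T : finType) (k : nat).
Hypotheses (k1 : (1 < k)%N) (cardT : #|T| = (2 * k)%N).
Implicit Types (x y : T -> R) (M : R).

Let n1 : R := (2 * k).-1%:R.
(** Scaled so that [kappa * elsym k setT x] is [2 * n1] times the average monomial. *)
Let kappa : R := n1 / 'C((2 * k).-1, k)%:R.

(* With [r = power_sum k x / (2k - 1)], [e] the average of [mon x] over the [k]-sets and [g]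
   the product of all coordinates, this is [(2k - 1)^2 (M r^2 - 2 e r + g)]. *)
Definition excess M x :=
  M * power_sum k x ^+ 2 - kappa * elsym k setT x * power_sum k x + n1 ^+ 2 * mon x setT.

Let n1_gt0 : 0 < n1. Proof. by rewrite ltr0n; lia. Qed.
Let P_gt0 : 0 < 'C((2 * k).-1, k)%:R :> R. Proof. by rewrite ltr0n bin_gt0; lia. Qed.
Let kappa_gt0 : 0 < kappa. Proof. exact: divr_gt0. Qed.

Let kappaE : kappa * 'C((2 * k).-2, k.-1)%:R = k%:R.
Proof.
rewrite /kappa mulrAC; apply: (canLR (mulfK (lt0r_neq0 P_gt0))).
by rewrite -!natrM -central_bin.
Qed.

Lemma bin_pred_half : 'C((2 * k).-1, k.-1) = 'C((2 * k).-1, k).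
Proof. by rewrite -bin_sub; [congr ('C(_, _)) |]; lia. Qed.

Lemma elsym_split2 m (D : {set T}) x i j : i != j -> i \in D -> j \in D ->
  elsym m.+2 D x = elsym m.+2 (D :\ i :\ j) x + elsym m.+1 (D :\ i :\ j) x * (x i + x j)
    + elsym m (D :\ i :\ j) x * (x i * x j).
Proof.
move=> ij iD jD; have jDi : j \in D :\ i by rewrite !inE eq_sym ij.
by rewrite (elsym_split _ _ iD) !(elsym_split _ _ jDi); ring.
Qed.

Lemma power_sum_split2 x i j : i != j ->
  power_sum k x = \sum_(l in [set: T] :\ i :\ j) x l ^+ k + x i ^+ k + x j ^+ k.
Proof.
move=> ij; rewrite /power_sum (bigD1 i) //= (bigD1 j) 1?eq_sym //=.
rewrite [X in _ = X + _ + _](eq_bigl (fun l => (l != i) && (l != j))); first by ring.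
by move=> l; rewrite !inE andbT andbC.
Qed.

Lemma mon_split2 x i j : i != j ->
  mon x setT = mon x ([set: T] :\ i :\ j) * (x i * x j).
Proof.
move=> ij; have jD : j \in [set: T] :\ i by rewrite !inE eq_sym ij.
by rewrite (monD1 _ (in_setT i)) (monD1 _ jD); ring.
Qed.

(** [k] times the derivative of [excess] with respect to [power_sum]. *)
Let Lam M x := k%:R * (2 * M * power_sum k x - kappa * elsym k setT x).

(** [pair_extremal] for the coordinates [i] and [j]; its [be] is [kappa] times [elsym k.-1] over the
    remaining points. *)
Lemma excess_pair M x i j : (forall y, (forall l, 0 <= y l) -> 0 <= excess M y) ->
  (forall l, 0 < x l) -> excess M x = 0 -> i != j ->
  power_sum k x * (kappa * elsym k.-1 ([set: T] :\ i :\ j) x) <= Lam M x * hsum k (x i) (x j)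
  /\ (x i != x j ->
     Lam M x * hsum k (x i) (x j) = power_sum k x * (kappa * elsym k.-1 ([set: T] :\ i :\ j) x)).
Proof.
move=> exc_ge0 x0 exc0 ij; set D := _ :\ i :\ j.
have kS : k = k.-2.+2 by lia.
pose s := \sum_(l in D) x l ^+ k.
pose z u w l := if l == i then u else if l == j then w else x l.
have zi u w : z u w i = u by rewrite /z eqxx.
have zj u w : z u w j = w by rewrite /z eq_sym (negPf ij) eqxx.
have zD u w : {in D, z u w =1 x}.
  by move=> l; rewrite !inE /z andbT => /andP[/negPf -> /negPf ->].
have eE y : elsym k setT y = elsym k D y + elsym k.-1 D y * (y i + y j)
    + elsym k.-2 D y * (y i * y j).
  rewrite {1}kS (elsym_split2 _ _ ij (in_setT i) (in_setT j)) -/D -kS.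
  by have -> : k.-2.+1 = k.-1 by lia.
have excE u w : excess M (z u w) = M * (s + u ^+ k + w ^+ k) ^+ 2
    - (kappa * elsym k D x + kappa * elsym k.-1 D x * (u + w) + kappa * elsym k.-2 D x * (u * w))
      * (s + u ^+ k + w ^+ k) + n1 ^+ 2 * mon x D * (u * w).
  rewrite /excess eE (power_sum_split2 _ ij) (mon_split2 _ ij) -/D zi zj.
  rewrite !(elsym_eq _ (zD u w)) (mon_eq (zD u w)).
  rewrite (eq_bigr (fun l => x l ^+ k)); last by move=> l lD; rewrite zD.
  by rewrite -/s; ring.
have xE : excess M x = excess M (z (x i) (x j)).
  have xz : x =1 z (x i) (x j).
    by move=> l; rewrite /z; case: eqP => [->|_] //; case: eqP => [->|].
  rewrite /excess /power_sum (eq_bigr (fun l => z (x i) (x j) l ^+ k)); last first.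
    by move=> l _; rewrite xz.
  by rewrite (@elsym_eq _ _ k setT x _ (fun l _ => xz l)) (@mon_eq _ _ x _ setT (fun l _ => xz l)).
have [||H1 H2] := @pair_extremal R k M s (kappa * elsym k D x) (kappa * elsym k.-1 D x)
  (kappa * elsym k.-2 D x) (n1 ^+ 2 * mon x D) (x i) (x j) k1 (x0 i) (x0 j).
- move=> u w u0 w0; rewrite -excE; apply: exc_ge0 => l.
  by rewrite /z; case: ifP => // _; case: ifP => // _; apply: ltW.
- by rewrite -excE -xE.
rewrite /Lam eE (power_sum_split2 _ ij) -/s.
have -> : kappa * (elsym k D x + elsym k.-1 D x * (x i + x j) + elsym k.-2 D x * (x i * x j))
  = kappa * elsym k D x + kappa * elsym k.-1 D x * (x i + x j)
      + kappa * elsym k.-2 D x * (x i * x j) by ring.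
by split.
Qed.

(** The exponent is [k] while there are [2k] points, so AM-GM is applied to two complementary halves
    with power sums [a] and [b], followed by [4ab <= (a + b)^2]. Replacing [2k] by [2k - 1] makes
    the bound strict in [mon_lt]. *)
Let mon_power_sum x : (forall l, 0 <= x l) -> (2 * k)%:R ^+ 2 * mon x setT <= power_sum k x ^+ 2.
Proof.
move=> x0.
have k0 : 0 < (2 * k)%:R :> R by rewrite ltr0n; lia.
have [A [cA cA']] : exists A : {set T}, #|A| = k /\ #|~: A| = k.
  have : (0 < #|[set A : {set T} | A \subset setT & #|A| == k]|)%N.
    by rewrite cards_draws bin_gt0 cardsT cardT; lia.
  rewrite card_gt0 => /set0Pn[A]; rewrite inE => /andP[_ /eqP cA].
  by exists A; split=> //; have := cardsC A; rewrite cA cardT; lia.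
have GA := AGM_mon x0 cA (ltnW k1); have GA' := AGM_mon x0 cA' (ltnW k1).
have -> : mon x setT = mon x A * mon x (~: A).
  by rewrite -monU ?setUCr // -subsets_disjoint.
have -> : power_sum k x = \sum_(i in A) x i ^+ k + \sum_(i in ~: A) x i ^+ k.
  rewrite /power_sum (bigID (mem A)) /=; congr (_ + _).
  by apply: eq_bigl => i; rewrite inE.
have := mon_ge0 A x0; have := mon_ge0 (~: A) x0.
move: GA GA'; set p := mon x A; set q := mon x (~: A); set a := \sum_(i in A) _.
set b := \sum_(i in ~: A) _ => pa qb q0 p0.
have kk : 0 < k%:R :> R by rewrite ltr0n; lia.
have -> : (2 * k)%:R = 2 * k%:R :> R by rewrite natrM.
have : k%:R * p * (k%:R * q) <= a * b by apply: ler_pM => //; rewrite mulr_ge0 // ltW.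
have : 0 <= (a - b) ^+ 2 by rewrite sqr_ge0.
nra.
Qed.

Let mon_lt x : (forall l, 0 <= x l) -> 0 < power_sum k x ->
  n1 ^+ 2 * mon x setT < power_sum k x ^+ 2.
Proof.
move=> x0 S0; have [-> |G0] := eqVneq (mon x setT) 0; first by rewrite mulr0 exprn_gt0.
apply: lt_le_trans (mon_power_sum x0); rewrite ltr_pM2r; last first.
  by rewrite lt_neqAle eq_sym G0 mon_ge0.
by rewrite ltrXn2r ?nnegrE ?ler0n // ltr_nat; lia.
Qed.

(** As [excess M x = 0], [Lam M x * power_sum k x] is [k] times [M * power_sum k x ^+ 2 - n1 ^+ 2 *
    mon x setT], which is positive by [mon_lt]. *)
Lemma Lam_gt0 M x : 1 <= M -> (forall l, 0 <= x l) -> 0 < power_sum k x ->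
  excess M x = 0 -> 0 < Lam M x.
Proof.
move=> M1 x0 S0 exc0.
have kk : 0 < k%:R :> R by rewrite ltr0n; lia.
rewrite /Lam pmulr_rgt0 // -(pmulr_lgt0 _ S0).
have := mon_lt x0 S0.
have : power_sum k x ^+ 2 <= M * power_sum k x ^+ 2 by rewrite ler_peMl // exprn_ge0 // ltW.
move: exc0; rewrite /excess; lra.
Qed.

(** Compare the equality for the pair [i], [j] with the inequality for [j], [m]. Passing from the
    first to the second lowers [hsum] strictly, but cannot lower [elsym], since the larger [x i]
    replaces [x m] among the remaining coordinates. *)
Lemma excess_two_below M x i j m : 1 <= M ->
  (forall y, (forall l, 0 <= y l) -> 0 <= excess M y) ->
  (forall l, 0 < x l) -> excess M x = 0 -> j != m -> x j < x i -> x m < x i -> False.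
Proof.
move=> M1 exc_ge0 x0 exc0 jm ji mi.
have ij : i != j by apply: contraTneq ji => ->; rewrite ltxx.
have im : i != m by apply: contraTneq mi => ->; rewrite ltxx.
have S0 : 0 < power_sum k x.
  by rewrite /power_sum (bigD1 i) //= ltr_pwDl ?exprn_gt0 // sumr_ge0 // => l _; rewrite exprn_ge0 // ltW.
have [_ /(_ _)] := excess_pair exc_ge0 x0 exc0 ij; rewrite gt_eqF // => /(_ isT) Eij.
have [Hjm _] := excess_pair exc_ge0 x0 exc0 jm.
have L0 : 0 < Lam M x by apply: Lam_gt0 => // l; apply: ltW.
have hlt : hsum k (x j) (x m) < hsum k (x i) (x j).
  by rewrite [ltRHS]hsumC hsum_ltr // ltW.
have : Lam M x * hsum k (x j) (x m) < Lam M x * hsum k (x i) (x j) by rewrite ltr_pM2l.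
rewrite Eij; apply/negP; rewrite -leNgt; apply: le_trans Hjm.
rewrite !ler_pM2l //.
have kS : k.-1 = k.-2.+1 by nat_lia.
pose D := [set: T] :\ i :\ j :\ m.
have mD : m \in [set: T] :\ i :\ j by rewrite !inE eq_sym jm eq_sym im.
have iD : i \in [set: T] :\ j :\ m by rewrite !inE ij im.
rewrite kS (elsym_split _ _ mD) (elsym_split _ _ iD) -/D.
have -> : [set: T] :\ j :\ m :\ i = D by apply/setP => l; rewrite !inE; do 3 case: eqP.
rewrite lerD2l; apply: ler_wpM2r; last exact: ltW.
by apply: elsym_ge0 => l; apply: ltW.
Qed.

(** If some [x m = 0], the product vanishes and AM-GM on the other [2k - 1] points gives [M <= 1]
    together with its equality case. If all coordinates are positive, at most one is below the
    maximum and the form is strictly positive. *)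
Lemma excess_extremal M x : 1 <= M ->
  (forall y, (forall l, 0 <= y l) -> 0 <= excess M y) ->
  (forall l, 0 <= x l) -> 0 < power_sum k x -> excess M x = 0 ->
  M = 1 /\ exists2 m, x m = 0 & forall i j, i != m -> j != m -> x i = x j.
Proof.
move=> M1 exc_ge0 x0 S0 exc0.
have [/existsP[m /eqP xm]|/existsPn xn0] := boolP [exists m, x m == 0].
  have cm : #|[set~ m]| = (2 * k).-1 by rewrite cardsC1 cardT.
  have eE : elsym k setT x = elsym k [set~ m] x.
    have -> : k = k.-1.+1 by lia.
    rewrite (elsym_split _ _ (in_setT m)) xm mul0r addr0.
    by congr (elsym _ _ _); apply/setP => l; rewrite !inE andbT.
  have SE : power_sum k x = \sum_(i in [set~ m]) x i ^+ k.
    rewrite /power_sum (bigD1 m) //= xm expr0n gtn_eqF ?add0r; last by lia.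
    by apply: eq_bigl => l; rewrite !inE.
  have := exc0; rewrite /excess (mon_eq0 (in_setT m) xm) mulr0 addr0.
  move/eqP; rewrite subr_eq0 expr2 mulrA => /eqP /(mulIf (lt0r_neq0 S0)) E.
  have H := elsym_le_power_sum [set~ m] x0 (ltnW k1).
  have kk : 0 < k%:R :> R by rewrite ltr0n; lia.
  have C0 : 0 < 'C((2 * k).-2, k.-1)%:R :> R by rewrite ltr0n bin_gt0; lia.
  have kE : k%:R * elsym k [set~ m] x = M * ('C((2 * k).-2, k.-1)%:R * power_sum k x).
    by rewrite -eE mulrCA E -{1}kappaE; ring.
  have M1' : M = 1.
    apply/eqP; rewrite eq_le M1 andbT.
    by move: H; rewrite cm kE -SE -[leRHS]mul1r ler_pM2r // mulr_gt0.
  split=> //; exists m => // i j im jm.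
  apply: (elsym_eq_power_sum (k := k) (D := [set~ m]) x0) => //; rewrite ?inE ?cm //; first by nat_lia.
  by rewrite kE M1' mul1r SE.
have xp l : 0 < x l by rewrite lt_neqAle eq_sym xn0 x0.
exfalso.
have [i0 _] : exists i : T, true.
  have : (0 < #|T|)%N by rewrite cardT; lia.
  by move/card_gt0P => [i _]; exists i.
have [m _ xm] := @arg_minP _ R T i0 xpredT x isT.
have [i _ xi] := @arg_maxP _ R T i0 xpredT x isT.
have xE l : l != m -> x l = x i.
  move=> lm; apply/eqP; rewrite eq_le; apply/andP; split; first exact: xi.
  rewrite leNgt; apply/negP => li.
  by apply: (excess_two_below M1 exc_ge0 xp exc0 lm li); apply: le_lt_trans li; apply: xm.
set a := x i in xE; set c := x m in xm.
have ca : c <= a by apply: xm.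
have c0 : 0 < c by apply: xp.
have kS : k = k.-1.+1 by lia.
have cm : #|[set~ m]| = (2 * k).-1 by rewrite cardsC1 cardT.
have Dm : [set: T] :\ m = [set~ m] by apply/setP => l; rewrite !inE andbT.
have xD : {in [set~ m], forall l, x l = a} by move=> l; rewrite !inE => /xE.
have a0 : 0 < a by apply: lt_le_trans ca.
have SE : power_sum k x = n1 * a ^+ k + c ^+ k.
  rewrite /power_sum (bigD1 m) //= addrC; congr (_ + _).
  rewrite (eq_bigr (fun=> a ^+ k)); last by move=> l /xE ->.
  rewrite sumr_const mulr_natl -cm; congr (_ *+ _).
  by apply: eq_card => l; rewrite !inE.
have eE : kappa * elsym k setT x = n1 * (a ^+ k + a ^+ k.-1 * c).
  rewrite {1}kS (elsym_split _ _ (in_setT m)) Dm -kS !(elsym_const _ xD) cm -/c.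
  by rewrite bin_pred_half /kappa; field; rewrite lt0r_neq0.
have GE : mon x setT = a ^+ k * a ^+ k.-1 * c.
  rewrite (monD1 _ (in_setT m)) Dm (mon_const xD) cm -/c mulrC -exprD.
  by congr (_ ^+ _ * _); nat_lia.
have : power_sum k x ^+ 2 <= M * power_sum k x ^+ 2 by rewrite ler_peMl // exprn_ge0 // ltW.
move: exc0; rewrite /excess eE GE SE.
have ac : a ^+ k.-1 * c <= a ^+ k by rewrite {2}kS exprSr ler_pM2l // exprn_gt0.
have ck : 0 < c ^+ k by rewrite exprn_gt0.
move: ac; set p := a ^+ k; set q := _ * c; set r := c ^+ k in ck * => ac.
rewrite -!mulrA -/q => E1 E2.
have : (n1 * p + r) ^+ 2 - n1 * ((p + q) * (n1 * p + r)) + n1 ^+ 2 * (p * q) <= 0 by lra.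
(* With all coordinates but one equal to [a], the form at [M = 1] factors; [q <= p] and [0 < r] make
   it positive. *)
have -> : (n1 * p + r) ^+ 2 - n1 * ((p + q) * (n1 * p + r)) + n1 ^+ 2 * (p * q)
  = r * (n1 * (p - q) + r) by ring.
rewrite pmulr_rle0 // leNgt => /negP; apply.
by apply: ltr_wpDl => //; apply: mulr_ge0; [apply: ltW | rewrite subr_ge0].
Qed.

Section IntersectingHalf.
Hypothesis excess_ge0 : forall y, (forall l, 0 <= y l) -> 0 <= excess 1 y.
Variable F : {set {set T}}.
Hypotheses (Fk : forall A, A \in F -> #|A| = k)
  (Fint : forall A B, A \in F -> B \in F -> A :&: B != set0).

Let cardC (A : {set T}) : (#|~: A| == k) = (#|A| == k).
Proof. by have := cardsC A; rewrite cardT; lia. Qed.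

Let Fnot A : A \in F -> ~: A \notin F.
Proof. by move=> FA; apply/negP => /(Fint FA); rewrite setICr eqxx. Qed.

(** Breaks the tie in [Fhat] when [F] contains neither of two complementary sets. *)
Let t0 : T.
Proof. by apply: (enum_val (A := T) (Ordinal (n := #|T|) (m := 0) _)); rewrite cardT; lia. Qed.

(* [F], completed so as to contain one member of each complementary pair of [k]-sets. *)
Let Fhat := [set A : {set T} | (#|A| == k) && ((A \in F) || ((t0 \in A) && (~: A \notin F)))].

Let FhatC (A : {set T}) : #|A| == k -> (~: A \in Fhat) = (A \notin Fhat).
Proof.
move=> Ak; rewrite !inE cardC Ak setCK /= negb_or negb_and negbK.
have [FA|FA] := boolP (A \in F); first by rewrite (negPf (Fnot FA)) /= andbF.
by have [FA'|FA'] := boolP (~: A \in F); rewrite ?orbT //= orbF andbT.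
Qed.

Let sum_Fhat (f : {set T} -> R) :
  \sum_(A in Fhat) (f A + f (~: A)) = \sum_(A : {set T} | (A \subset setT) && (#|A| == k)) f A.
Proof.
rewrite big_split /= [RHS](bigID (mem Fhat)) /=; congr (_ + _).
  by apply: eq_bigl => A; rewrite subsetT !inE /=; case: (#|A| == k).
rewrite (reindex_inj (inv_inj (@setCK T))); apply: eq_big => A; last by rewrite setCK.
rewrite subsetT /=; have [Ak|Ak] := boolP (#|A| == k); first exact: FhatC.
by rewrite !inE cardC (negPf Ak).
Qed.

Let card_Fhat : #|Fhat| = 'C((2 * k).-1, k).
Proof.
have := sum_Fhat (fun=> 1); rewrite !sumr_const.
have -> : #|(fun A : {set T} => (A \subset setT) && (#|A| == k))| = 'C(2 * k, k).
  by rewrite -cardT -cardsT -cards_draws; apply: eq_card => A; rewrite inE.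
have -> : 'C(2 * k, k) = (2 * 'C((2 * k).-1, k))%N.
  have := binS (2 * k).-1 k.-1; rewrite bin_pred_half.
  have -> : k.-1.+1 = k by lia.
  have -> : (2 * k).-1.+1 = (2 * k)%N by lia.
  by move=> ->; rewrite [RHS]mul2n -addnn.
rewrite -mulr2n -mulrnA => /eqP; rewrite eqr_nat => /eqP; lia.
Qed.

(* The difference of the two sides is [mon x (~: A) * (r - mon x A) ^+ 2]. *)
Let pair_bound r x A : (forall l, 0 <= x l) ->
  (r ^+ 2 - mon x setT) * (mon x A - r)
    <= r ^+ 2 * (mon x A + mon x (~: A)) - r * (r ^+ 2 + mon x setT).
Proof.
move=> x0; have -> : mon x setT = mon x A * mon x (~: A).
  by rewrite -monU ?setUCr // -subsets_disjoint.
rewrite -subr_ge0; set t := mon x A; set s := mon x (~: A).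
have -> : r ^+ 2 * (t + s) - r * (r ^+ 2 + t * s) - (r ^+ 2 - t * s) * (t - r)
  = s * (r - t) ^+ 2 by ring.
by rewrite mulr_ge0 ?mon_ge0 // sqr_ge0.
Qed.

(** [pair_bound] at [r = power_sum k x / (2k - 1)], summed over [Fhat]: the sets [A] and [~: A]
    together run through all [k]-sets, and what remains is a negative multiple of [excess 1 x]. *)
Let Fhat_bound x : (forall l, 0 <= x l) -> 0 < power_sum k x ->
  (power_sum k x ^+ 2 - n1 ^+ 2 * mon x setT)
    * (k%:R * weight x Fhat - 'C((2 * k).-2, k.-1)%:R * power_sum k x)
  <= - ('C((2 * k).-2, k.-1)%:R * power_sum k x * excess 1 x).
Proof.
move=> x0 S0; set S := power_sum k x; set C := 'C(_, _)%:R.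
have kk : 0 < k%:R :> R by rewrite ltr0n; lia.
pose r := S / n1; have rE : S = n1 * r by rewrite /r mulrCA divff ?mulr1 // lt0r_neq0.
have PC : k%:R * 'C((2 * k).-1, k)%:R = n1 * C :> R by rewrite -!natrM central_bin.
have kap : kappa * C = k%:R := kappaE.
have C0 : 0 < C by rewrite ltr0n bin_gt0; lia.
have H : (r ^+ 2 - mon x setT) * (weight x Fhat - 'C((2 * k).-1, k)%:R * r)
    <= r ^+ 2 * elsym k setT x - 'C((2 * k).-1, k)%:R * (r * (r ^+ 2 + mon x setT)).
  have : \sum_(A in Fhat) (r ^+ 2 - mon x setT) * (mon x A - r) <= \sum_(A in Fhat)
      (r ^+ 2 * (mon x A + mon x (~: A)) - r * (r ^+ 2 + mon x setT)).
    by apply: ler_sum => A _; apply: pair_bound.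
  rewrite -mulr_sumr sumrB [in leRHS]sumrB /elsym -(sum_Fhat (mon x)) mulr_sumr.
  by rewrite !sumr_const card_Fhat !mulr_natl.
have -> : S ^+ 2 - n1 ^+ 2 * mon x setT = n1 ^+ 2 * (r ^+ 2 - mon x setT).
  by rewrite rE; ring.
have -> : k%:R * weight x Fhat - C * S = k%:R * (weight x Fhat - 'C((2 * k).-1, k)%:R * r).
  by rewrite mulrBr mulrA PC rE; ring.
rewrite mulrACA [n1 ^+ 2 * _]mulrC.
have -> : - (C * S * excess 1 x) = k%:R * n1 ^+ 2 * (r ^+ 2 * elsym k setT x
     - 'C((2 * k).-1, k)%:R * (r * (r ^+ 2 + mon x setT))).
  rewrite /excess -/S mul1r.
  have -> : k%:R * n1 ^+ 2 * (r ^+ 2 * elsym k setT x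
      - 'C((2 * k).-1, k)%:R * (r * (r ^+ 2 + mon x setT)))
    = n1 ^+ 2 * (k%:R * r ^+ 2 * elsym k setT x
      - (k%:R * 'C((2 * k).-1, k)%:R) * (r * (r ^+ 2 + mon x setT))) by ring.
  by rewrite PC -{1}kap rE; ring.
by rewrite ler_pM2l // mulr_gt0 // exprn_gt0.
Qed.

Let weight_Fhat x : (forall l, 0 <= x l) -> weight x F <= weight x Fhat.
Proof.
by move=> x0; apply: weight_subset => //; apply/subsetP => A FA; rewrite !inE FA Fk // eqxx.
Qed.

Lemma half_bound x : (forall l, 0 <= x l) -> 0 < power_sum k x ->
  k%:R * weight x F <= 'C((2 * k).-2, k.-1)%:R * power_sum k x.
Proof.
move=> x0 S0.
have : k%:R * weight x F <= k%:R * weight x Fhat by rewrite ler_wpM2l // weight_Fhat.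
move=> /le_trans; apply; rewrite -subr_le0 -(pmulr_rle0 _ (x := power_sum k x ^+ 2 - n1 ^+ 2 * mon x setT)).
  apply: le_trans (Fhat_bound x0 S0) _; rewrite oppr_le0.
  by rewrite !mulr_ge0 // ?excess_ge0 // ltW.
by rewrite subr_gt0 mon_lt.
Qed.

(** Equality forces [excess 1 x = 0], so [x] vanishes at one point [m] and is constant elsewhere.
    Then [weight x F] merely counts the members avoiding [m], and [F] must contain all [k]-sets that
    do. *)
Lemma half_bound_eq x : (forall l, 0 <= x l) -> 0 < power_sum k x ->
  k%:R * weight x F = 'C((2 * k).-2, k.-1)%:R * power_sum k x ->
  exists m, F = [set A : {set T} | (#|A| == k) && (m \notin A)].
Proof.
move=> x0 S0 E.
have kk : 0 < k%:R :> R by rewrite ltr0n; lia.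
have C0 : 0 < 'C((2 * k).-2, k.-1)%:R :> R by rewrite ltr0n bin_gt0; lia.
have exc0 : excess 1 x = 0.
  apply/eqP; rewrite eq_le excess_ge0 // andbT.
  have := Fhat_bound x0 S0.
  have : 0 <= (power_sum k x ^+ 2 - n1 ^+ 2 * mon x setT)
    * (k%:R * weight x Fhat - 'C((2 * k).-2, k.-1)%:R * power_sum k x).
    apply: mulr_ge0; rewrite subr_ge0; first exact/ltW/mon_lt.
    by rewrite -E ler_wpM2l // weight_Fhat.
  move=> H1 H2; have := le_trans H1 H2.
  by rewrite oppr_ge0 pmulr_rle0 // mulr_gt0.
have [_ [m xm xE]] := excess_extremal (lexx 1) excess_ge0 x0 S0 exc0.
exists m.
have [a [a0 xa]] : exists a, 0 < a /\ forall l, l != m -> x l = a.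
  have [l lm xl] : exists2 l, l != m & x l != 0.
    apply/exists_inP; apply: contraTT S0; rewrite negb_exists_in => /forall_inP H.
    rewrite -leNgt le_eqVlt; apply/orP; left; apply/eqP; apply: big1 => l _.
    have [->|/H] := eqVneq l m; last rewrite negbK => /eqP ->; rewrite ?xm;
    by rewrite expr0n gtn_eqF //; lia.
  exists (x l); split; first by rewrite lt_neqAle eq_sym xl x0.
  by move=> l' lm'; apply: xE.
pose Fm := [set A : {set T} | (#|A| == k) && (m \notin A)].
have cm : #|[set~ m]| = (2 * k).-1 by rewrite cardsC1 cardT.
have cFm : #|Fm| = 'C((2 * k).-1, k).
  rewrite -cm -cards_draws; apply: eq_card => A; rewrite !inE andbC; congr (_ && _).
  by rewrite -disjoints1 disjoint_sym disjoints_subset.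
have wE : weight x F = #|F :&: Fm|%:R * a ^+ k.
  rewrite /weight (big_setID Fm) /= [X in _ + X]big1 => [|A].
    rewrite addr0 (eq_bigr (fun=> a ^+ k)) ?sumr_const ?mulr_natl // => A.
    rewrite !inE => /and3P[FA /eqP Ak mA]; rewrite -Ak; apply: mon_const => l lA.
    by rewrite xa //; apply: contraNneq mA => <-.
  rewrite !inE => /andP[nFm FA]; move: nFm; rewrite Fk // eqxx /= negbK => mA.
  exact: mon_eq0 mA xm.
have SE : power_sum k x = n1 * a ^+ k.
  rewrite /power_sum (bigD1 m) //= xm expr0n gtn_eqF ?add0r; last by lia.
  rewrite (eq_bigr (fun=> a ^+ k)); last by move=> l /xa ->.
  rewrite sumr_const mulr_natl -cm; congr (_ *+ _).
  by apply: eq_card => l; rewrite !inE.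
have : (k * #|F :&: Fm|)%N = (k * 'C((2 * k).-1, k))%N.
  apply/eqP; rewrite -(eqr_nat R) central_bin !natrM; apply/eqP.
  apply: (@mulIf _ (a ^+ k)); first by rewrite lt0r_neq0 // exprn_gt0.
  by rewrite -mulrA -wE E SE; ring.
move/eqP; rewrite eqn_pmul2l; last by lia.
rewrite -cFm => /eqP cE.
have FmF : Fm \subset F.
  apply/setIidPr/eqP; rewrite eqEcard subsetIr cE leqnn //.
apply/eqP; rewrite eq_sym eqEsubset FmF; apply/subsetP => A FA.
rewrite inE Fk // eqxx /=; apply/negP => mA.
(* A member through [m] would be disjoint from its complement, which avoids [m] and so lies in
   [F]. *)
have : ~: A \in Fm by rewrite !inE cardC Fk // eqxx /= negbK.
by move/(subsetP FmF); apply/negP; apply: Fnot.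
Qed.

End IntersectingHalf.

End Excess.

(** * Shifted maximal families *)

Section Traces.
Variables (n k : nat).
Implicit Types (A B C : {set 'I_n}) (F : {set {set 'I_n}}) (i j : 'I_n) (m : nat).

Definition uniform F := forall A, A \in F -> #|A| = k.
Definition shifted F := forall A i j, A \in F -> (i < j)%N -> j \in A -> i \notin A ->
  i |: (A :\ j) \in F.
Definition maximal F := forall A, #|A| = k -> (forall B, B \in F -> A :&: B != set0) -> A \in F.
(** By [trace_mem], membership of a set of given size then depends only on its trace on
    [initial n m]. *)
Definition symmetric_from m F := forall A i j, (m <= i)%N -> (m <= j)%N -> A \in F ->
  i \in A -> j \notin A -> j |: (A :\ i) \in F.

Lemma in_initial m i : (i \in initial n m) = (i < m)%N.
Proof. by rewrite inE. Qed.

Lemma card_initial m : (m <= n)%N -> #|initial n m| = m.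
Proof.
move=> mn; rewrite cardE -(size_map val) /=.
have -> : [seq val i | i <- enum (initial n m)] = [seq i <- iota 0 n | (i < m)%N].
  rewrite -val_enum_ord filter_map; congr map.
  by rewrite enumT /enum_mem; apply: eq_filter => i; rewrite /= inE.
rewrite size_filter -(subnKC mn) iotaD count_cat /= add0n.
rewrite (eq_in_count (a2 := predT)); last by move=> i; rewrite mem_iota.
rewrite count_predT size_iota (eq_in_count (a2 := pred0)); last first.
  by move=> i; rewrite mem_iota /= => /andP[]; rewrite leqNgt => /negPf.
by rewrite count_pred0 addn0.
Qed.

(** Exchange a point of [A :\: B] for one of [B :\: A], both [>= m] because the traces agree, and
    induct on [#|A :\: B|]. *)
Lemma trace_mem m F A B : symmetric_from m F -> A \in F -> #|B| = #|A| ->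
  B :&: initial n m = A :&: initial n m -> B \in F.
Proof.
move=> sym; move: {2}#|A :\: B|.+1 (ltnSn #|A :\: B|) => d.
elim: d A => // d IH A dA FA cBA tBA.
have tr i : (i < m)%N -> (i \in B) = (i \in A).
  by move=> im; move/setP/(_ i): tBA; rewrite !inE im !andbT.
have [/eqP|[i]] := set_0Vmem (A :\: B).
  rewrite setD_eq0 => AB; suff -> : B = A by [].
  by apply/esym/eqP; rewrite eqEcard AB cBA leqnn.
rewrite inE => /andP[iB iA].
have [j] : exists j, j \in B :\: A.
  apply/set0Pn; rewrite -card_gt0 cardsD setIC cBA -cardsD card_gt0.
  by apply/set0Pn; exists i; rewrite inE iB.
rewrite inE => /andP[jA jB].
have mi : (m <= i)%N by rewrite leqNgt; apply: contra iB => /tr ->.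
have mj : (m <= j)%N by rewrite leqNgt; apply: contra jA => /tr <-.
apply: (IH (j |: (A :\ i))).
- rewrite -ltnS; apply: leq_trans dA; rewrite ltnS; apply: proper_card.
  apply/properP; split; last first.
    exists i; rewrite !inE iB //= eqxx /= orbF.
    by apply: contraNneq jA => <-.
  apply/subsetP => l; rewrite !inE => /andP[lB /orP[/eqP lj|/andP[_ ->]]]; last by rewrite lB.
  by rewrite lj jB in lB.
- exact: sym.
- by rewrite cards_swap.
apply/setP => l; rewrite !inE; have [lm|lm] := ltnP l m; last by rewrite !andbF.
rewrite !andbT tr //; have -> : (l == j) = false by apply/eqP => lj; rewrite lj ltnNge mj in lm.
by have -> : (l == i) = false by apply/eqP => lj; rewrite lj ltnNge mi in lm.
Qed.

Section Intersecting.
Variables (m : nat) (F : {set {set 'I_n}}).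
Hypotheses (k0 : (0 < k)%N) (n2k : (2 * k <= n)%N).
Hypotheses (unif : uniform F) (int : intersecting F) (shift : shifted F) (sym : symmetric_from m F).

Lemma exists_outside A B : #|A| = k -> #|B| = k -> A :&: B != set0 ->
  exists i, i \notin A :|: B.
Proof.
move=> Ak Bk; rewrite -card_gt0 => AB.
have : (0 < #|~: (A :|: B)|)%N.
  have := cardsC (A :|: B); rewrite cardsU card_ord Ak Bk; lia.
by rewrite card_gt0 => /set0Pn[i]; rewrite inE => iAB; exists i.
Qed.

(** If all common points are [>= m], replace one of them in [B] by a point outside [A :|: B],
    available as [2k <= n]. This is an exchange or a shift, and it shrinks [A :&: B] without
    creating a common point below [m]. *)
Lemma trace_intersecting A B : A \in F -> B \in F -> A :&: B :&: initial n m != set0.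
Proof.
move=> FA; move: {2}#|A :&: B|.+1 (ltnSn #|A :&: B|) => d.
elim: d B => // d IH B dAB FB; apply/eqP => ABm.
have [j jAB] := set0Pn _ (int FA FB).
have mj : (m <= j)%N.
  by rewrite leqNgt -in_initial; apply/negP => jm; move/setP/(_ j): ABm; rewrite inE jAB jm inE.
have [i] := exists_outside (unif FA) (unif FB) (int FA FB).
rewrite inE negb_or => /andP[iA iB]; move: (jAB); rewrite inE => /andP[jA jB].
have ij : i != j by apply: contraNneq iA => ->.
pose B' := i |: (B :\ j).
have FB' : B' \in F.
  have [mi|im] := leqP m i; first exact: sym.
  by apply: shift => //; apply: leq_trans mj.
have sub : A :&: B' = (A :&: B) :\ j.
  apply/setP => l; rewrite !inE; have [->|li] := eqVneq l i; last by case: (l == j); rewrite ?andbF.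
  by rewrite (negPf iA) andbF.
suff : A :&: B' :&: initial n m = set0.
  move/eqP; apply/negP; apply: IH => //; rewrite sub; move: dAB.
  by rewrite (cardsD1 j) jAB; nat_lia.
apply/setP => l; rewrite sub; move/setP/(_ l): ABm; rewrite !inE.
by move/negbT; rewrite -!andbA => H; apply/negbTE; apply: contra H => /and4P[_ -> -> ->].
Qed.

Lemma maximal_nonempty : maximal F -> exists A, A \in F.
Proof.
move=> maxF; apply/set0Pn; apply/eqP => F0.
have : (0 < #|[set A : {set 'I_n} | A \subset setT & #|A| == k]|)%N.
  by rewrite cards_draws bin_gt0 cardsT card_ord; lia.
rewrite card_gt0 => /set0Pn[A]; rewrite inE => /andP[_ /eqP Ak].
have : A \in F by apply: maxF => // B; rewrite F0 inE.
by rewrite F0 inE.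
Qed.

(** For [m = 0] every [k]-set would be a member, including two disjoint ones. *)
Lemma symmetric_from_gt0 : maximal F -> (0 < m)%N.
Proof.
move=> maxF; rewrite lt0n; apply/eqP => m0.
have [A FA] := maximal_nonempty maxF.
have Ak := unif FA.
have : (0 < #|[set B : {set 'I_n} | B \subset ~: A & #|B| == k]|)%N.
  by rewrite cards_draws bin_gt0; have := cardsC A; rewrite card_ord Ak; lia.
rewrite card_gt0 => /set0Pn[B]; rewrite inE => /andP[BA /eqP Bk].
have FB : B \in F.
  apply: (trace_mem sym FA); first by rewrite Ak.
  by apply/setP => i; rewrite m0 !inE !andbF.
have := int FB FA; rewrite setI_eq0 => /negP; apply.
by rewrite disjoints_subset.
Qed.

Section Asymmetric.
Variables (e l : 'I_n).
Hypotheses (em : e.+1 = m) (ml : (m <= l)%N) (maxF : maximal F).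

Let init_e := initial n e.
Let init_m := initial n m.

Lemma initialS A : A :&: init_m = if e \in A then e |: (A :&: init_e) else A :&: init_e.
Proof.
apply/setP => i; rewrite !inE -em ltnS leq_eqVlt.
case: ifP => eA; rewrite !inE; have [/val_inj ->|ie] := eqVneq (i : nat) e; rewrite /= ?eA ?eqxx //=.
- by have -> : (i == e) = false by apply: contraNF ie => /eqP ->.
Qed.

(* With [e.+1 = m <= l], the obstruction to [symmetric_from e F] when [symmetric_from m F]. *)
Definition asym_sets := [set A in F | [&& e \in A, l \notin A & l |: (A :\ e) \notin F]].
Definition asym_traces := [set A :&: init_e | A in asym_sets].

Let el : e != l.
Proof. by apply: contraTneq ml => <-; rewrite -em ltnn. Qed.

Lemma asym_tracesP B : B \in asym_traces -> exists A,
  [/\ A \in F, e \in A, l \notin A, l |: (A :\ e) \notin F & A :&: init_e = B].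
Proof. by case/imsetP => A; rewrite inE => /and4P[*]; exists A. Qed.

(** Some member has trace [e |: B] on [initial n m], and [C] must meet it there, hence in [e]. If a
    point [j < e] were outside both [B] and [C], the shift of [C] from [e] to [j] would miss that
    member below [m]. *)
Lemma trace_complement B C : B \in asym_traces -> C \in F -> [disjoint C & B] ->
  e \in C /\ C :&: init_e = init_e :\: B.
Proof.
move=> /asym_tracesP[A [FA eA lA _ AB]] FC CB.
have tA : A :&: init_m = e |: B by rewrite initialS eA AB.
have eC : e \in C.
  have := trace_intersecting FC FA; rewrite -setIA tA => /set0Pn[i].
  rewrite !inE => /andP[iC /orP[/eqP <-//|iB]].
  by have := disjointFr CB iC; rewrite iB.
split=> //; apply/setP => j; rewrite !inE.
have [jB|jB] := boolP (j \in B); first by rewrite (disjointFl CB jB).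
rewrite /=; have [je|] := boolP (j < e)%N; last by rewrite andbF.
rewrite andbT; apply/negPn/negP => jC.
have := trace_intersecting (shift FC je eC jC) FA; rewrite -setIA tA => /set0Pn[i].
rewrite !inE => /andP[/orP[/eqP ->|/andP[ie iC]]].
  by rewrite (negPf jB) orbF => /eqP jeq; rewrite jeq ltnn in je.
by rewrite (negPf ie) /= (disjointFr CB iC).
Qed.

(** By maximality [l |: (A :\ e)] is not a member because some [C] in [F] misses it. This [C] has
    the complementary trace and is itself asymmetric, since its exchange would miss [A] below
    [m]. *)
Lemma asym_trace_compl B : B \in asym_traces -> init_e :\: B \in asym_traces.
Proof.
move=> BB; have [A [FA eA lA nF AB]] := asym_tracesP BB.
have tA : A :&: init_m = e |: B by rewrite initialS eA AB.
have cA' : #|l |: (A :\ e)| = k by rewrite cards_swap // unif.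
have /exists_inP[C FC /eqP dC] : [exists C in F, (l |: (A :\ e)) :&: C == set0].
  apply: contraNT nF; rewrite negb_exists_in => /forall_inP H.
  by apply: maxF => // C FC; apply: H.
have CB : [disjoint C & B].
  rewrite disjoint_sym -setI_eq0 -subset0 -dC; apply: setSI; rewrite -AB.
  apply/subsetP => i; rewrite !inE => /andP[-> ie]; rewrite andbT orbC; apply/orP; left.
  by apply: contraTneq ie => ->; rewrite ltnn.
have [eC tC] := trace_complement BB FC CB.
have lC : l \notin C.
  by apply/negP => lC; move/setP/(_ l): dC; rewrite !inE eqxx lC.
apply/imsetP; exists C => //; rewrite inE FC eC lC /=; apply/negP => FC'.
have := trace_intersecting FC' FA; rewrite -setIA tA => /set0Pn[i]; rewrite !inE.
case/andP => /orP[/eqP ->|/andP[ie iC]].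
  rewrite eq_sym (negPf el) /= -AB !inE => /andP[_].
  by move: ml; rewrite -em; nat_lia.
by rewrite (negPf ie) /= (disjointFr CB iC).
Qed.

(** Otherwise [e] is the only point of [A] below [m], and the shift of [A] from [e] to 0 would not
    meet [A] there. *)
Lemma asym_trace_neq0 B : (0 < e)%N -> B \in asym_traces -> B != set0.
Proof.
move=> e0 /asym_tracesP[A [FA eA lA nF AB]]; apply/eqP => B0.
have n0 : (0 < n)%N by apply: leq_ltn_trans (ltn_ord e).
pose z := Ordinal n0.
have zA : z \notin A.
  by apply/negP => zA; move/setP/(_ z): AB; rewrite B0 !inE zA e0.
have := trace_intersecting (shift (i := z) FA e0 eA zA) FA.
rewrite -setIA initialS eA AB B0 setU0 => /set0Pn[i]; rewrite !inE.
case/andP => /orP[/eqP ->|/andP[/negPf ->]//] /eqP ze.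
by move: e0; rewrite -ze.
Qed.

Lemma asym_trace_sub B : B \in asym_traces -> B \subset init_e.
Proof. by case/imsetP => A _ ->; apply: subsetIr. Qed.

Lemma asym_trace_card B : B \in asym_traces -> (#|B| < k)%N.
Proof.
case/asym_tracesP => A [FA eA _ _ <-]; rewrite -(unif FA) (cardsD1 e A) eA ltnS.
apply: subset_leq_card; apply/subsetP => i; rewrite !inE => /andP[-> ie].
by rewrite andbT; apply: contraTneq ie => ->; rewrite ltnn.
Qed.

(** With the next lemma: asymmetry is a property of the trace alone, by [trace_mem]. *)
Lemma asym_trace_in B A : B \in asym_traces -> #|A| = k -> A :&: init_m = e |: B -> A \in F.
Proof.
case/asym_tracesP => A0 [FA eA _ _ AB] Ak tA; apply: (trace_mem sym FA).
  by rewrite Ak unif.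
by rewrite tA -/init_m initialS eA AB.
Qed.

Lemma asym_trace_notin B A : B \in asym_traces -> #|A| = k -> A :&: init_m = B -> A \notin F.
Proof.
case/asym_tracesP => A0 [FA eA lA nF AB] Ak tA; apply: contra nF => FA'.
apply: (trace_mem sym FA'); first by rewrite cards_swap // !unif.
rewrite -/init_m tA -AB; apply/setP => i; rewrite !inE.
have [->|il] := eqVneq i l.
  by rewrite (negPf lA) leqNgt ltnS ml /=.
rewrite /=; have [->|ie] := eqVneq i e; first by rewrite ltnn andbF.
by rewrite -em ltnS leq_eqVlt (_ : (i == e :> nat) = false) //; apply/negbTE.
Qed.

Lemma asym_traces_sizes B : (0 < e)%N -> B \in asym_traces ->
  [/\ (0 < #|B| < k)%N, (0 < #|init_e :\: B| < k)%N & (#|B| + #|init_e :\: B| = e)%N].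
Proof.
move=> e0 BB; have BB' := asym_trace_compl BB.
rewrite !card_gt0 !asym_trace_neq0 ?asym_trace_card //; split=> //.
have := cardsID B init_e; rewrite (setIidPr (asym_trace_sub BB)) => ->.
by rewrite card_initial // ltnW.
Qed.

End Asymmetric.
End Intersecting.
End Traces.

(** * Weights of asymmetric sets *)

Section Exchange.
Variables (R : realFieldType) (T : finType).
Implicit Types (F : {set {set T}}) (A D Z : {set T}) (x : T -> R).

Lemma exchange_sum F i j (f : {set T} -> R) :
  \sum_(A in F | [&& i \in A, j \notin A & j |: (A :\ i) \in F]) f (A :\ i)
    = \sum_(A in F | [&& j \in A, i \notin A & i |: (A :\ j) \in F]) f (A :\ j).
Proof.
rewrite (reindex_onto (fun A => i |: (A :\ j)) (fun A => j |: (A :\ i))) /=; last first.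
  by move=> A /and4P[_ iA jA _]; rewrite swapK.
apply: eq_big => [A|A /andP[/and4P[_ _ jA _] /eqP AE]]; last first.
  have jA' : j \in A by rewrite -AE setU11.
  have iA : i \notin A.
    rewrite -AE !inE eqxx orbF; apply/eqP => ij.
    by move: jA; rewrite -ij setU11.
  by rewrite setU1K // !inE (negPf iA) andbF.
have [->|ij] := eqVneq i j.
  by rewrite setU11 /= !andbF /=; case: (j \in A); rewrite ?andbF.
have [jA|jA] := boolP (j \in A); last first.
  rewrite andbF; apply/negbTE; rewrite negb_and; apply/orP; right.
  by apply: contraNneq jA => <-; rewrite setU11.
have [iA|iA] := boolP (i \in A).
  rewrite /= andbF; apply/negbTE; rewrite negb_and; apply/orP; right; apply/eqP => E.
  by move/setP/(_ i): E; rewrite !inE eqxx (negPf ij) iA.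
have -> : j |: ((i |: (A :\ j)) :\ i) = A by rewrite swapK.
have -> : (j \in i |: (A :\ j)) = false by rewrite !inE eqxx eq_sym (negPf ij).
by rewrite eqxx andbT setU11 /= andbC.
Qed.

(** For [D] below [m] and [Z] the points from [m] on, these are the [k]-sets with trace [D]. *)
Definition extensions k D Z : {set {set T}} :=
  [set A : {set T} | [&& #|A| == k, D \subset A & A \subset D :|: Z]].

Lemma weight_extensions k D Z x b : [disjoint D & Z] -> {in Z, forall i, x i = b} ->
  (#|D| <= k)%N ->
  weight x (extensions k D Z) = mon x D * b ^+ (k - #|D|) * 'C(#|Z|, k - #|D|)%:R.
Proof.
move=> DZ xb Dk; pose X := [set A : {set T} | A \subset Z & #|A| == (k - #|D|)%N].
have disj A : A \in X -> [disjoint D & A].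
  by rewrite inE => /andP[AZ _]; apply: disjointWr DZ.
have -> : extensions k D Z = [set D :|: A | A in X].
  apply/setP => A; apply/idP/imsetP => [|[C CX ->]].
    rewrite inE => /and3P[/eqP Ak DA AD]; exists (A :\: D).
      rewrite inE subDset AD /=; apply/eqP.
      by have := cardsID D A; rewrite (setIidPr DA) Ak => <-; rewrite addKn.
    by rewrite -[LHS](setID A D) (setIidPr DA).
  have := disj _ CX; move: CX; rewrite !inE => /andP[CZ /eqP Ck] DC.
  rewrite subsetUl setUS // andbT cardsU disjoint_setI0 // cards0 subn0 Ck.
  by rewrite subnKC // eqxx.
rewrite /weight big_imset /=; last first.
  move=> A B AX BX E; have [dA dB] := (disj _ AX, disj _ BX).
  have H (C : {set T}) : [disjoint D & C] -> C = (D :|: C) :\: D.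
    by move=> dC; rewrite setDUl setDv set0U; apply/esym/setDidPl; rewrite disjoint_sym.
  by rewrite (H _ dA) (H _ dB) E.
rewrite (eq_bigr (fun=> mon x D * b ^+ (k - #|D|))).
  by rewrite sumr_const cards_draws mulr_natr.
move=> A AX; rewrite monU ?disj //; move: AX; rewrite inE => /andP[/subsetP AZ /eqP <-].
by congr (_ * _); apply: mon_const => i /AZ /xb.
Qed.

End Exchange.

Section Balance.
Variables (R : realFieldType) (n k m : nat) (F : {set {set 'I_n}}) (x : 'I_n -> R) (w : R).
Implicit Types (A B C : {set 'I_n}).
Hypotheses (k1 : (1 < k)%N) (n2k : (2 * k <= n)%N).
Hypotheses (unif : uniform k F) (int : intersecting F) (shift : shifted F)
  (maxF : maximal k F) (sym : symmetric_from m F).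
Hypotheses (x0 : forall i, 0 <= x i) (w0 : 0 < w)
  (opt : forall G : {set {set 'I_n}}, uniform k G -> intersecting G -> dominates k w G)
  (xF : weight x F = w * power_sum k x).

Let k0 : (0 < k)%N. Proof. exact: ltnW. Qed.
Let domF : dominates k w F. Proof. exact: opt. Qed.

(** As [F] is symmetric in [i] and [j], the derivatives there are [x j * Q + X] and [x i * Q + X]
    with common [Q] and [X]. They are also proportional to [x i ^+ k.-1] and [x j ^+ k.-1], so
    [x j < x i] would order them both ways. *)
Lemma tail_le (i j : 'I_n) : (m <= i)%N -> (m <= j)%N -> x i <= x j.
Proof.
move=> mi mj; rewrite leNgt; apply/negP => ji.
have ij : i != j by apply: contraTneq ji => ->; rewrite ltxx.
have Si := stationary i k1 x0 domF xF; have Sj := stationary j k1 x0 domF xF.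
pose Q a b := \sum_(A in F | (a \in A) && (b \in A)) mon x (A :\ a :\ b).
pose X a b := \sum_(A in F | [&& a \in A, b \notin A & b |: (A :\ a) \in F]) mon x (A :\ a).
have split (a b : 'I_n) : a != b -> (m <= a)%N -> (m <= b)%N ->
    \sum_(A in F | a \in A) mon x (A :\ a) = x b * Q a b + X a b.
  move=> ab ma mb; rewrite (bigID (fun A : {set 'I_n} => b \in A)) /=; congr (_ + _).
    rewrite /Q mulr_sumr; apply: eq_big => [A|A]; first by rewrite andbA.
    case/andP => _ bA; have bA' : b \in A :\ a by rewrite !inE eq_sym ab.
    exact: monD1.
  apply: eq_bigl => A; rewrite -andbA; apply: andb_id2l => FA; apply: andb_id2l => aA.
  by have [bA|bA] := boolP (b \in A) => //=; rewrite sym.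
have QC : Q i j = Q j i.
  apply: eq_big => [A|A _]; first by rewrite [(i \in A) && _]andbC.
  by congr (mon x _); apply/setP => a; rewrite !inE andbCA.
have XC : X i j = X j i by apply: exchange_sum.
have Q0 : 0 <= Q j i by apply: sumr_ge0 => A _; apply: mon_ge0.
have wk : 0 < w * k%:R by rewrite mulr_gt0 // ltr0n.
have : w * k%:R * x j ^+ k.-1 < w * k%:R * x i ^+ k.-1.
  by rewrite ltr_pM2l // ltrXn2r ?nnegrE //; nat_lia.
have ji' : j != i by rewrite eq_sym.
rewrite -Si -Sj (split _ _ ij mi mj) (split _ _ ji' mj mi) QC XC ltrD2r.
by apply/negP; rewrite -leNgt ler_wpM2r // ltW.
Qed.

Variables (e l : 'I_n).
Hypotheses (em : e.+1 = m) (ml : (m <= l)%N) (e0 : (0 < e)%N).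

Let asets := asym_sets F e l.
Let traces := asym_traces F e l.
Let init_e := initial n e.
Let init_m := initial n m.
Let tail := ~: init_m.
Let N := #|tail|.
Let a := x e.
Let b := x l.

Let el : e != l. Proof. by apply: contraTneq ml => <-; rewrite -em ltnn. Qed.
Let ltail : l \in tail. Proof. by rewrite !inE -leqNgt. Qed.
Let mn : (m <= n)%N. Proof. by rewrite -em. Qed.

Let tail_const : {in tail, forall i, x i = b}.
Proof. by move=> i; rewrite !inE -leqNgt => mi; apply/eqP; rewrite eq_le !tail_le. Qed.

Let sub_em B : B \subset init_e -> e \notin B /\ (e |: B) \subset init_m.
Proof.
move=> /subsetP Be; split; first by apply/negP => /Be; rewrite in_initial ltnn.
apply/subsetP => i; rewrite !inE -em => /orP[/eqP ->//|/Be].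
by rewrite in_initial ltnS => /ltnW.
Qed.

Let disj_tail B : B \subset init_m -> [disjoint B & tail].
Proof. by rewrite disjoints_subset setCK. Qed.

Definition both_weight := \sum_(A in F | (e \in A) && (l \in A)) mon x A.
Definition only_tail := \sum_(A in F | (l \in A) && (e \notin A)) mon x (A :\ l).

(** Stationarity at [e] and [l], multiplied by [b ^+ k] and [a ^+ k] to eliminate [w]. Members with
    [e] but not [l] are either exchanges of those counted by [only_tail] or belong to [asets]. *)
Lemma balance : (a ^+ k - b ^+ k) * both_weight + (a ^+ k * b - a * b ^+ k) * only_tail
  = b ^+ k * weight x asets.
Proof.
have Se := stationary_mem e k1 x0 domF xF; have Sl := stationary_mem l k1 x0 domF xF.
have El : w * k%:R * b ^+ k = both_weight + b * only_tail.
  rewrite -Sl (bigID (fun A : {set 'I_n} => e \in A)) /=; congr (_ + _).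
    by apply: eq_bigl => A; rewrite -andbA [(l \in A) && _]andbC.
  rewrite /only_tail mulr_sumr; apply: eq_big => [A|A]; first by rewrite andbA.
  by case/andP => /andP[_ lA] _; apply: monD1.
have Ee : w * k%:R * a ^+ k = both_weight + a * only_tail + weight x asets.
  rewrite -Se (bigID (fun A : {set 'I_n} => l \in A)) /= -addrA; congr (_ + _).
    by apply: eq_bigl => A; rewrite -andbA.
  rewrite (bigID (fun A : {set 'I_n} => l |: (A :\ e) \in F)) /=; congr (_ + _).
    have -> : only_tail
        = \sum_(A in F | [&& l \in A, e \notin A & e |: (A :\ l) \in F]) mon x (A :\ l).
      apply: eq_bigl => A; apply: andb_id2l => FA.
      have [lA|] := boolP (l \in A) => //=; have [|eA] := boolP (e \in A) => //=.
      by rewrite shift // -ltnS em ltnS.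
    rewrite -exchange_sum mulr_sumr; apply: eq_big => [A|A]; first by rewrite -!andbA.
    by case/andP => /andP[/andP[_ eA] _] _; apply: monD1.
  by apply: eq_bigl => A; rewrite inE -!andbA.
have := congr2 (fun y z => y * z) (erefl (a ^+ k)) El.
have := congr2 (fun y z => y * z) (erefl (b ^+ k)) Ee.
move=> /= E1 E2.
have : a ^+ k * (both_weight + b * only_tail)
  = b ^+ k * (both_weight + a * only_tail + weight x asets).
  by rewrite -E1 -E2; ring.
by move=> H; apply/eqP; rewrite -subr_eq0; move/eqP: H; rewrite -subr_eq0; congr (_ == _); ring.
Qed.

(* Up to the factor [a], the weight of the members of [F] with trace [e |: B]. *)
Definition trace_weight B := mon x B * b ^+ (k - #|B|).-1 * 'C(N, (k - #|B|).-1)%:R.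

Let trace_size B : B \in traces -> [/\ (0 < #|B| < k)%N, (0 < #|init_e :\: B| < k)%N
  & (#|B| + #|init_e :\: B| = e)%N].
Proof. exact: (asym_traces_sizes k0 n2k unif int shift sym em ml maxF e0). Qed.

Let trace_sub B : B \in traces -> B \subset init_e.
Proof. exact: asym_trace_sub. Qed.

Let trace_extensions B A : B \subset init_e -> #|A| = k ->
  (A :&: init_m == e |: B) = (A \in extensions k (e |: B) tail).
Proof.
move=> Be Ak; have [_ Bm] := sub_em Be; rewrite inE Ak eqxx /=; apply/eqP/andP => [<-|[BA AB]].
  by split; [apply: subsetIl | apply/subsetP => i; rewrite !inE => ->; case: (_ < _)%N].
apply/eqP; rewrite eqEsubset subsetI BA Bm !andbT.
apply/subsetP => i; rewrite inE => /andP[iA im]; move/subsetP: AB => /(_ i iA).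
by rewrite in_setU in_setC im orbF.
Qed.

Let trace_of A B : B \subset init_e -> A :&: init_m = e |: B -> e \in A /\ A :&: init_e = B.
Proof.
move=> Be tA; have [eB _] := sub_em Be.
have eA : e \in A by move/setP/(_ e): tA; rewrite !inE eqxx => /andP[].
split=> //; move: tA; rewrite (initialS em) eA => /setP tA.
apply/setP => i; move: (tA i); rewrite !in_setU1.
have [->|//] := eqVneq i e; rewrite (negPf eB) !inE ltnn andbF //.
Qed.

Let trace_in A B : B \in traces -> #|A| = k -> A :&: init_m = e |: B -> A \in F.
Proof. exact: (asym_trace_in unif sym em). Qed.

Let trace_notin A B : B \in traces -> #|A| = k -> A :&: init_m = B -> A \notin F.
Proof. exact: (asym_trace_notin unif sym em ml). Qed.

Let asets_trace B : B \in traces ->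
  [set A in asets | A :&: init_e == B] = extensions k (e |: B) (tail :\ l).
Proof.
move=> BB; have Be := trace_sub BB; have [eB Bm] := sub_em Be.
apply/setP => A; rewrite !inE; apply/andP/and3P => [[/and4P[FA eA lA nF] /eqP AB]|[Ak BA AB]].
  have Ak := unif FA; rewrite Ak eqxx -AB; split=> //.
    by rewrite subUset sub1set eA subsetIl.
  apply/subsetP => i iA; rewrite in_setU; have [im|im] := boolP (i \in init_m).
    have : i \in A :&: init_m by rewrite inE iA.
    by rewrite (initialS em) eA => ->.
  by rewrite in_setD1 in_setC im andbT orbC; apply/orP; left; apply: contraNneq lA => <-.
have lB : l \notin e |: B by apply: contraL ltail => /(subsetP Bm); rewrite in_setC negbK.
have lA : l \notin A.
  by apply/negP => /(subsetP AB); rewrite in_setU (negPf lB) !inE eqxx.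
have tA : A :&: init_m = e |: B.
  apply/eqP; rewrite trace_extensions ?(eqP Ak) // inE Ak BA /=.
  by apply: subset_trans AB _; apply: setUS; apply: subD1set.
have [eA AB'] := trace_of Be tA.
have FA := trace_in BB (eqP Ak) tA.
split; last exact/eqP; rewrite FA eA lA /=.
apply: (trace_notin BB); first by rewrite cards_swap // (eqP Ak).
have lm : l \notin init_m by move: ltail; rewrite inE.
rewrite setIUl; have -> : [set l] :&: init_m = set0.
  by apply/setP => i; rewrite !inE; apply/negbTE; apply: contra lm => /andP[/eqP <-]; rewrite inE.
rewrite set0U setIDAC tA; apply: setU1K; exact: eB.
Qed.

(** The factor [N] turns the number ['C(N.-1, j)] of choices avoiding [l] into [(N - j) * 'C(N, j)],
    so that every sum is expressed by the same [trace_weight]. *)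
Lemma asym_weight : N%:R * weight x asets
  = \sum_(B in traces) a * trace_weight B * (N - (k - #|B|).-1)%:R.
Proof.
rewrite /weight (partition_big_imset (fun A => A :&: init_e)) /= mulr_sumr.
apply: eq_bigr => B BB; have Be := trace_sub BB; have [eB Bm] := sub_em Be.
have [/andP[_ Bk] _ _] := trace_size BB.
have -> : \sum_(A in asets | A :&: init_e == B) mon x A
    = weight x (extensions k (e |: B) (tail :\ l)).
  by rewrite -asets_trace //; apply: eq_bigl => A; rewrite [RHS]in_set.
rewrite (@weight_extensions R _ k _ _ x b).
- rewrite cardsU1 eB add1n subnS monU1 // -/a.
  have -> : #|tail :\ l| = N.-1 by rewrite /N (cardsD1 l tail) ltail.
  have H : N%:R * 'C(N.-1, (k - #|B|).-1)%:R
      = (N - (k - #|B|).-1)%:R * 'C(N, (k - #|B|).-1)%:R :> R.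
    by rewrite -!natrM mul_bin_down.
  by rewrite /trace_weight mulrCA H; ring.
- by apply: disjointWr (disj_tail Bm); apply: subD1set.
- by move=> i; rewrite !inE => /andP[_ it]; apply: tail_const; rewrite !inE.
- by rewrite cardsU1 eB.
Qed.

(** Only members through [l] with an asymmetric trace are kept; here the factor [N] gives
    [N * 'C(N.-1, j.-1) = j * 'C(N, j)] with [j = (k - #|B|).-1]. *)
Lemma both_weight_ge :
  \sum_(B in traces) a * trace_weight B * (k - #|B|).-1%:R <= N%:R * both_weight.
Proof.
pose X := [set A in F | [&& e \in A, l \in A & A :&: init_e \in traces]].
have : weight x X <= both_weight.
  rewrite /both_weight [leRHS](bigID (fun A => A :&: init_e \in traces)) /=.
  have -> : weight x X = \sum_(A : {set 'I_n} | (A \in F) && ((e \in A) && (l \in A))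
      && (A :&: init_e \in traces)) mon x A.
    by apply: eq_bigl => A; rewrite in_set -!andbA.
  by rewrite lerDl sumr_ge0 // => A _; apply: mon_ge0.
have N0 : 0 <= N%:R :> R by apply: ler0n.
move/(ler_wpM2l N0); apply: le_trans.
have Xtr A : A \in X -> A :&: init_e \in traces by rewrite in_set => /and4P[].
rewrite /weight (partition_big (fun A => A :&: init_e) (mem traces) Xtr) /=.
rewrite mulr_sumr; apply: ler_sum => B BB; have Be := trace_sub BB; have [eB Bm] := sub_em Be.
have [/andP[_ Bk] _ _] := trace_size BB.
(* If [#|B| = k.-1], there is no room for [l] beside [e |: B], and the coefficient is 0. *)
have [kB|kB] := leqP k #|B|.+1.
  have -> : (k - #|B|).-1 = 0%N by nat_lia.
  by rewrite mulr0 mulr_ge0 // sumr_ge0 // => A _; apply: mon_ge0.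
have lB : l \notin e |: B by apply: contraL ltail => /(subsetP Bm); rewrite in_setC negbK.
have sub : extensions k (l |: (e |: B)) (tail :\ l) \subset [set A in X | A :&: init_e == B].
  apply/subsetP => A; rewrite inE => /and3P[/eqP Ak BA AB].
  have tA : A :&: init_m = e |: B.
    apply/eqP; rewrite trace_extensions // inE Ak eqxx /=.
    rewrite (subset_trans _ BA) ?subsetUr //=; apply: subset_trans AB _.
    apply/subsetP => i; rewrite !inE => /orP[/orP[/eqP ->|->//]|/andP[_ ->]]; rewrite ?orbT //.
    by move: ltail; rewrite !inE => ->; rewrite orbT.
  have [eA AB'] := trace_of Be tA.
  rewrite in_set [A \in X]in_set (trace_in BB Ak tA) eA AB' BB eqxx !andbT /=.
  by apply: (subsetP BA); rewrite setU11.
have := weight_subset x0 sub.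
rewrite (@weight_extensions R _ k _ _ x b); first last.
- by rewrite cardsU1 lB cardsU1 eB.
- by move=> i; rewrite !inE => /andP[_ it]; apply: tail_const; rewrite !inE.
- rewrite disjoints_subset; apply/subsetP => i.
  rewrite in_setU1 in_setC in_setD1 in_setC => /orP[/eqP ->|/(subsetP Bm) ->]; first by rewrite eqxx.
  by rewrite andbF.
rewrite cardsU1 lB cardsU1 eB !add1n !monU1 // -/a -/b.
have -> : #|tail :\ l| = N.-1 by rewrite /N (cardsD1 l tail) ltail.
move/(ler_wpM2l N0) => H.
have -> : \sum_(A in X | A :&: init_e == B) mon x A = weight x [set A in X | A :&: init_e == B].
  by apply: eq_bigl => A; rewrite [RHS]in_set.
apply: le_trans H; rewrite /trace_weight.
have -> : (k - #|B|).-1 = (k - #|B|.+2).+1 by nat_lia.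
have H : N%:R * 'C(N.-1, k - #|B|.+2)%:R = (k - #|B|.+2).+1%:R * 'C(N, (k - #|B|.+2).+1)%:R :> R.
  by rewrite -!natrM mul_bin_diag.
rewrite le_eqVlt; apply/orP; left; apply/eqP.
rewrite [RHS]mulrCA H exprS; ring.
Qed.

(** Compare [F] with the family [G] in which the sets of trace [e |: B'], [B'] the complement of
    [B], give way to all [k]-sets of trace [B]. By [trace_complement] the removed sets include all
    members disjoint from [B], so [G] is intersecting; by optimality the new sets weigh no more than
    the removed ones. *)
Lemma pull B : B \in traces -> b * (N - (k - #|B|).-1)%:R * trace_weight B
  <= a * (k - #|B|)%:R * trace_weight (init_e :\: B).
Proof.
move=> BB; have Be := trace_sub BB; have [eB Bm] := sub_em Be.
have BB' : init_e :\: B \in traces.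
  exact: (asym_trace_compl k0 n2k unif int shift sym em ml maxF BB).
have Be' := trace_sub BB'; have [eB' Bm'] := sub_em Be'.
have Bm0 : B \subset init_m by apply: subset_trans Bm; apply: subsetUr.
have [/andP[B0 Bk] /andP[_ Bk'] _] := trace_size BB.
set B' := init_e :\: B in BB' Be' eB' Bm' Bk' *.
pose G := (F :\: extensions k (e |: B') tail) :|: extensions k B tail.
have extF : extensions k (e |: B') tail \subset F.
  apply/subsetP => A Aext; have Ak : #|A| = k by move: Aext; rewrite inE => /and3P[/eqP].
  by apply: (trace_in BB' Ak); apply/eqP; rewrite trace_extensions.
have extB A : A \in extensions k B tail -> A :&: init_m = B.
  rewrite inE => /and3P[_ BA AB]; apply/eqP; rewrite eqEsubset subsetI BA Bm0 !andbT.
  apply/subsetP => i; rewrite inE => /andP[iA im]; move/subsetP: AB => /(_ i iA).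
  by rewrite in_setU in_setC im orbF.
have disF : [disjoint F & extensions k B tail].
  rewrite -setI_eq0; apply/eqP/setP => A; rewrite !in_setI in_set0; apply/negP => /andP[FA Aext].
  have := trace_notin BB (unif FA) (extB _ Aext); by rewrite FA.
have uG : uniform k G.
  by move=> A; rewrite !inE => /orP[/andP[_ /unif]|/and3P[/eqP]].
have cross A C : A \in extensions k B tail -> C \in F :\: extensions k (e |: B') tail ->
    A :&: C != set0.
  move=> Aext; rewrite in_setD => /andP[nC FC]; apply/eqP => AC.
  have CB : [disjoint C & B].
    rewrite disjoint_sym -setI_eq0 -subset0 -AC; apply: setSI.
    by move: Aext; rewrite inE => /and3P[].
  have [eC tC] := trace_complement k0 n2k unif int shift sym em BB FC CB.
  by move/negP: nC; apply; rewrite -trace_extensions ?unif // (initialS em) eC tC.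
have iG : intersecting G.
  move=> A C; rewrite !in_setU => /orP[AF|Ax] /orP[CF|Cx].
  - by apply: int; [move: AF | move: CF]; rewrite in_setD => /andP[].
  - by rewrite setIC; apply: cross.
  - exact: cross.
  - move: B0; rewrite card_gt0 => /set0Pn[i iB]; apply/set0Pn; exists i.
    move: Ax Cx; rewrite !inE => /and3P[_ /subsetP BA _] /and3P[_ /subsetP BC _].
    by rewrite BA // BC.
have := opt uG iG x0; rewrite -xF /G.
have -> : weight x (F :\: extensions k (e |: B') tail :|: extensions k B tail)
    = weight x (F :\: extensions k (e |: B') tail) + weight x (extensions k B tail).
  rewrite /weight -bigU /=; last by apply: disjointWl disF; apply: subsetDl.
  by apply: eq_bigl => A; rewrite !inE.
have -> : weight x F = weight x (F :\: extensions k (e |: B') tail)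
    + weight x (extensions k (e |: B') tail).
  by rewrite {1}/weight (big_setID (extensions k (e |: B') tail)) /= (setIidPr extF) addrC.
rewrite lerD2l !(@weight_extensions R _ k _ _ x b) ?cardsU1 ?eB' ?disj_tail //; last exact: ltnW.
rewrite add1n monU1 // -/a -/N => H.
have kB : (k - #|B|)%N = (k - #|B|).-1.+1 by nat_lia.
have E : (k - #|B|)%:R * 'C(N, k - #|B|)%:R = (N - (k - #|B|).-1)%:R * 'C(N, (k - #|B|).-1)%:R :> R.
  by rewrite -!natrM kB mul_bin_left.
have -> : b * (N - (k - #|B|).-1)%:R * trace_weight B
    = (k - #|B|)%:R * (mon x B * b ^+ (k - #|B|) * 'C(N, k - #|B|)%:R).
  have bE : b ^+ (k - #|B|) = b * b ^+ (k - #|B|).-1 by rewrite {1}kB exprS.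
  by rewrite [RHS]mulrCA E bE /trace_weight; ring.
have -> : a * (k - #|B|)%:R * trace_weight B'
    = (k - #|B|)%:R * (a * mon x B' * b ^+ (k - #|B'|.+1) * 'C(N, k - #|B'|.+1)%:R).
  by rewrite /trace_weight subnS; ring.
by rewrite ler_wpM2l.
Qed.

End Balance.

(** * Numerical inequalities *)

Section PairInequality.
Variable R : realFieldType.
Implicit Types (a b th s A : R) (u v d k : nat).

(** Polynomial inequality for [scaled_pair_ge3], where the cubic estimate of a power produces the
    factors [6 * u ^ 2] and [10 * u - 1]. *)
Lemma bin_ineq u v : (3 <= u)%N -> (1 <= v <= u)%N ->
  (6 * u ^ 2 * (2 * u * v + u + v) < (u + 1) * (10 * u - 1) * (u * (u - 1) + v * (v - 1)))%N.
Proof.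
move=> u3 /andP[v1 vu].
have [u5|u5] := leqP 5 u; last first.
  have : u = 3%N \/ u = 4%N by lia.
  by case=> ->; move: v1; do 5 (case: v vu => [|v] //= vu); lia.
have [t ut] : exists t, u = (v + t)%N by exists (u - v)%N; lia.
have E1 : (10 * u ^ 2 <= (u + 1) * (10 * u - 1))%N by nia.
have E2 : (6 * (2 * u * v + u + v) < 10 * (u * (u - 1) + v * (v - 1)))%N by nia.
apply: (@leq_trans (10 * u ^ 2 * (u * (u - 1) + v * (v - 1)))); last by rewrite leq_mul2r E1 orbT.
by rewrite -!(mulnA _ (u ^ 2)%N) !(mulnCA _ (u ^ 2)%N) ltn_mul2l E2 andbT expn_gt0; lia.
Qed.

Lemma exp_ge_cubic u s : 0 <= s ->
  1 + (u.+1)%:R * s + 'C(u.+1, 2)%:R * s ^+ 2 + 'C(u.+1, 3)%:R * s ^+ 3 <= (1 + s) ^+ u.+1.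
Proof.
move=> s0; elim: u => [|u IH]; first by rewrite !bin_small //; lra.
rewrite exprS; apply: le_trans (ler_wpM2l _ IH); last lra.
have c3 : 0 <= 'C(u.+1, 3)%:R * s ^+ 4 by rewrite mulr_ge0 // exprn_ge0.
have -> : 'C(u.+2, 2)%:R = 'C(u.+1, 2)%:R + u.+1%:R :> R by rewrite binS bin1 natrD.
have -> : 'C(u.+2, 3)%:R = 'C(u.+1, 3)%:R + 'C(u.+1, 2)%:R :> R by rewrite binS natrD.
have -> : u.+2%:R = u.+1%:R + 1 :> R by rewrite natr1.
rewrite -subr_ge0; move: c3; congr (0 <= _); ring.
Qed.

(** The product of the last two hypotheses gives [th = 1 + s / u] with [s >= d]. Since [k >= u + 1],
    the first terms of the binomial expansion make [th ^+ k - 1] large enough. *)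
Lemma scaled_pair_ge3 th A A' u v d k : 1 <= th -> 0 < A -> 0 < A' ->
  (0 < v <= u)%N -> (2 < u)%N -> (0 < d)%N -> (u < k)%N ->
  (v + d)%:R * A <= th * u%:R * A' -> (u + d)%:R * A' <= th * v%:R * A ->
  A * ((v + d)%:R - (th ^+ k - 1) * u.-1%:R) + A' * ((u + d)%:R - (th ^+ k - 1) * v.-1%:R) < 0.
Proof.
move=> th1 A0 A'0 /andP[v0 vu] u3 d0 uk I1 I2.
have u0R : 0 < u%:R :> R by rewrite ltr0n ltnW // ltnW.
have v0R : 1 <= v%:R :> R by rewrite ler1n.
have d0R : 1 <= d%:R :> R by rewrite ler1n.
have vuR : v%:R <= u%:R :> R by rewrite ler_nat.
have u3R : 3 <= u%:R :> R by rewrite (ler_nat _ 3).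
have u1 : u.-1%:R = u%:R - 1 :> R by rewrite -subn1 natrB // ltnW // ltnW.
have v1 : v.-1%:R = v%:R - 1 :> R by rewrite -subn1 natrB.
have bin : 6 * u%:R ^+ 2 * (2 * u%:R * v%:R + u%:R + v%:R)
    < (u%:R + 1) * (10 * u%:R - 1) * (u%:R * (u%:R - 1) + v%:R * (v%:R - 1)) :> R.
  have u0 : (0 < u)%N := ltnW (ltnW u3).
  have := bin_ineq u3 (introT andP (conj v0 vu)); rewrite -(ltr_nat R).
  by rewrite !(natrM, natrD, natrX) !natrB ?muln_gt0 // natrM.
rewrite u1 v1; rewrite !natrD in I1 I2 *.
set U : R := u%:R in I1 I2 u0R vuR u3R bin *; set V : R := v%:R in I1 I2 v0R vuR bin *.
set D : R := d%:R in I1 I2 d0R *.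
have th0 : 0 < th by lra.
have P : (U + D) * (V + D) <= th ^+ 2 * U * V.
  have : (V + D) * A * ((U + D) * A') <= th * U * A' * (th * V * A).
    by apply: ler_pM => //; rewrite mulr_ge0 //; lra.
  have -> : (V + D) * A * ((U + D) * A') = (U + D) * (V + D) * (A * A') by ring.
  have -> : th * U * A' * (th * V * A) = th ^+ 2 * U * V * (A * A') by ring.
  by rewrite ler_pM2r // mulr_gt0.
have thU : U + D <= th * U.
  rewrite -(@ler_pXn2r _ 2) ?nnegrE //; [|lra|rewrite mulr_ge0 //; lra].
  rewrite -(@ler_pM2r _ V); last by lra.
  have : (U + D) * (V + D) * U <= th ^+ 2 * U * V * U by rewrite ler_pM2r.
  have H : (U + D) * V <= (V + D) * U by nra.
  have UD : 0 < U + D by lra.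
  by have := ler_wpM2l (ltW UD) H; rewrite !expr2; lra.
have [s [s1 thE]] : exists s, D <= s /\ th = 1 + s / U.
  exists (th * U - U); split; first by lra.
  by field; rewrite lt0r_neq0.
(* Cubic truncation of [(1 + s / U) ^+ u.+1]; with [s >= 1] the terms add up to at least
   [6 U + 3 U + (U - 1) = 10 U - 1]. *)
have TH : s * ((U + 1) * (10 * U - 1)) <= 6 * U ^+ 2 * (th ^+ k - 1).
  have ss : 0 <= s / U by rewrite divr_ge0 //; lra.
  have := exp_ge_cubic u ss; rewrite -thE.
  have : th ^+ u.+1 <= th ^+ k by rewrite ler_weXn2l.
  have -> : 'C(u.+1, 2)%:R = (U + 1) * U / 2 :> R.
    apply: (canRL (mulfK _)); first by rewrite pnatr_eq0.
    by rewrite -natrM mulnC -(mul_bin_diag u.+1 1) bin1 natrM -natr1.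
  have -> : 'C(u.+1, 3)%:R = (U + 1) * U * (U - 1) / 6 :> R.
    apply: (canRL (mulfK _)); first by rewrite pnatr_eq0.
    have E : ('C(u.+1, 3) * 6 = u.+1 * u * u.-1)%N.
      by rewrite mulnC -[6%N]/(2 * 3)%N -mulnA -(mul_bin_diag u.+1 2) mulnCA -(mul_bin_diag u 1) bin1 mulnA.
    by rewrite -natrM E !natrM -natr1 u1.
  rewrite -natr1 -/U => H1 H2.
  have : 6 * U ^+ 2 * ((U + 1) * (s / U) + (U + 1) * U / 2 * (s / U) ^+ 2
     + (U + 1) * U * (U - 1) / 6 * (s / U) ^+ 3) <= 6 * U ^+ 2 * (th ^+ k - 1).
    rewrite ler_pM2l; last by rewrite mulr_gt0 // exprn_gt0.
    lra.
  apply: le_trans.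
  have -> : 6 * U ^+ 2 * ((U + 1) * (s / U) + (U + 1) * U / 2 * (s / U) ^+ 2
     + (U + 1) * U * (U - 1) / 6 * (s / U) ^+ 3)
     = s * ((U + 1) * (6 * U + 3 * U * s + (U - 1) * s ^+ 2)).
    by field; rewrite lt0r_neq0.
  rewrite ler_pM2l; last by lra.
  rewrite ler_pM2l; last by lra.
  have s1' : 1 <= s by lra.
  have s2 : 1 <= s ^+ 2 by rewrite exprn_ege1.
  have : 0 <= U * (s - 1) by rewrite mulr_ge0 //; lra.
  have : 0 <= (U - 1) * (s ^+ 2 - 1) by rewrite mulr_ge0 //; lra.
  lra.
set T := th ^+ k - 1 in TH *.
have T0 : 0 <= T by rewrite subr_ge0 exprn_ege1.
have star : U * (V + D + th * V) < T * (U * (U - 1) + V * (V - 1)).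
  rewrite -(ltr_pM2l (x := 6 * U ^+ 2)); last by rewrite mulr_gt0 // exprn_gt0.
  have W0 : 0 < U * (U - 1) + V * (V - 1) 
    by apply: ltr_wpDr; [rewrite mulr_ge0 //; lra | rewrite mulr_gt0 //; lra].
  have H : s * ((U + 1) * (10 * U - 1)) * (U * (U - 1) + V * (V - 1))
    <= 6 * U ^+ 2 * T * (U * (U - 1) + V * (V - 1)) by rewrite ler_pM2r.
  rewrite [ltRHS]mulrA; apply: lt_le_trans H.
  have -> : U * (V + D + th * V) = U * (2 * V + D) + s * V.
    by rewrite thE; field; rewrite lt0r_neq0.
  have s0 : 0 < s by lra.
  have : 0 <= U * V * (s - 1) by rewrite !mulr_ge0 //; lra.
  have : 0 <= U * (s - D) by rewrite mulr_ge0 //; lra.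
  move=> G1 G2; have : U * (2 * V + D) + s * V <= s * (2 * U * V + U + V) by lra.
  have U2 : 0 < 6 * U ^+ 2 by rewrite mulr_gt0 // exprn_gt0.
  move/(ler_wpM2l (ltW U2)) => /le_lt_trans; apply.
  by rewrite mulrCA -[ltRHS]mulrA (ltr_pM2l s0).
(* If the coefficient of [A'] is negative, so is that of [A], as [V <= U]. Otherwise [I2] bounds
   [A'] by a multiple of [A] and [star] applies. *)
have [neg|pos] := ltP (U + D - T * (V - 1)) 0.
  have : V + D - T * (U - 1) < 0 by nra.
  nra.
have UD : 0 < U + D by lra.
rewrite -(pmulr_rlt0 _ UD).
have H : (U + D) * A' * (U + D - T * (V - 1)) <= th * V * A * (U + D - T * (V - 1)).
  by rewrite ler_wpM2r.
have H' : A * ((U + D) * (V + D - T * (U - 1)) + th * V * (U + D - T * (V - 1))) < 0.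
  rewrite pmulr_rlt0 // -(pmulr_rlt0 _ u0R).
  have : 0 <= (th * U - (U + D)) * (V * (T * (V - 1))).
    by rewrite !mulr_ge0 //; lra.
  have : (U + D) * (U * (V + D + th * V)) < (U + D) * (T * (U * (U - 1) + V * (V - 1))).
    by rewrite ltr_pM2l.
  lra.
lra.
Qed.

(* For complementary asymmetric traces [B] and [B'] this is used with [u = k - #|B|],
   [v = k - #|B'|], [d = n - 2k] and [th] the ratio of the coordinates [e] and [l]. *)
Lemma scaled_pair th A A' u v d k : 1 <= th -> 0 < A -> 0 < A' ->
  (0 < v <= u)%N -> (1 < u)%N -> (0 < d)%N -> (u < k)%N ->
  ~~ [&& u == 2, v == 2, d == 1 & k == 3] ->
  (v + d)%:R * A <= th * u%:R * A' -> (u + d)%:R * A' <= th * v%:R * A ->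
  A * ((v + d)%:R - (th ^+ k - 1) * u.-1%:R) + A' * ((u + d)%:R - (th ^+ k - 1) * v.-1%:R) < 0.
Proof.
move=> th1 A0 A'0 vu u1 d0 uk exc I1 I2.
have [u3|] := ltnP 2 u; first exact: scaled_pair_ge3.
move=> u2; have {u1 u2} u2 : u = 2%N by apply/eqP; rewrite eqn_leq u2.
subst u; have th0 : 0 < th by lra.
have d1 : 1 <= d%:R :> R by rewrite ler1n.
have P : (2 + d)%:R * (v + d)%:R <= th ^+ 2 * 2 * v%:R.
  have : (v + d)%:R * A * ((2 + d)%:R * A') <= th * 2 * A' * (th * v%:R * A).
    by apply: ler_pM => //; rewrite mulr_ge0 ?ler0n // ltW.
  have -> : (v + d)%:R * A * ((2 + d)%:R * A') = (2 + d)%:R * (v + d)%:R * (A * A') by ring.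
  have -> : th * 2 * A' * (th * v%:R * A) = th ^+ 2 * 2 * v%:R * (A * A') by ring.
  by rewrite ler_pM2r // mulr_gt0.
have k3 : th ^+ 3 <= th ^+ k by rewrite ler_weXn2l.
have [v1|v2] : v = 1%N \/ v = 2%N.
  by case/andP: vu; case: v {exc I1 I2 P} => [|[|[|v]]] // _ _; [left | right].
- subst v; rewrite !natrD /= in P I1 I2 *; set D : R := d%:R in d1 P I1 I2 *.
  have thD : 3 * D + D ^+ 2 <= 2 * (th ^+ 2 - 1) by lra.
  (* A rational bound below the square root of 3; [th ^+ 2 >= 3] because [D >= 1]. *)
  have th17 : 17 / 10 <= th.
    rewrite -(@ler_pXn2r _ 2) ?nnegrE //; [|lra|lra].
    have : 1 <= D ^+ 2 by rewrite exprn_ege1.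
    lra.
  have D2 : D <= D ^+ 2 by rewrite expr2 ler_peMr //; lra.
  have : 17 / 10 * (2 * D) <= th * (th ^+ 2 - 1).
    by apply: ler_pM => //; lra.
  have -> : th * (th ^+ 2 - 1) = th ^+ 3 - th by ring.
  move=> H; have : (2 + D) * A' <= th * A by lra.
  have : A * (2 + D + th - th ^+ k) < 0 by rewrite pmulr_rlt0 //; lra.
  lra.
subst v; rewrite !natrD /= in P I1 I2 *; set D : R := d%:R in d1 P I1 I2 *.
have thD : 1 + D / 2 <= th.
  rewrite -(@ler_pXn2r _ 2) ?nnegrE //; [|lra|lra].
  have -> : (1 + D / 2) ^+ 2 = (2 + D) * (2 + D) / 4 by field.
  lra.
suff T : 2 + D < th ^+ k - 1.
  have -> : A * (2 + D - (th ^+ k - 1) * 1) + A' * (2 + D - (th ^+ k - 1) * 1)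
    = (A + A') * (2 + D - (th ^+ k - 1)) by ring.
  by rewrite pmulr_rlt0 ?addr_gt0 //; lra.
have [d2|d2] := ltnP 1 d.
  have D2 : 2 <= D by rewrite (ler_nat _ 2).
  have : (1 + D / 2) ^+ 3 <= th ^+ 3 by rewrite lerXn2r ?nnegrE //; lra.
  have -> : (1 + D / 2) ^+ 3 = 1 + 3 / 2 * D + 3 / 4 * D ^+ 2 + D ^+ 3 / 8 by field.
  have : 2 * 2 <= D ^+ 2 by rewrite expr2 ler_pM.
  have : 0 <= D ^+ 3 by rewrite exprn_ge0 //; lra.
  lra.
(* For [d = 1] the goal amounts to [4 < th ^+ k] with [th >= 3 / 2]. The cube [27 / 8] is too small,
   which is why [k = 3] is excluded. *)
have {d2} dE : d = 1%N by apply/eqP; rewrite eqn_leq d2.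
have k4 : (3 < k)%N by rewrite ltn_neqAle uk andbT eq_sym; move: exc; rewrite dE.
have : th ^+ 4 <= th ^+ k by rewrite ler_weXn2l.
have : (3 / 2) ^+ 4 <= th ^+ 4.
  by rewrite lerXn2r ?nnegrE //; [lra|lra|]; move: thD; rewrite /D dE; lra.
have -> : (3 / 2) ^+ 4 = 81 / 16 :> R by field.
rewrite /D dE; lra.
Qed.

(** [scaled_pair] with [a = b * th], made symmetric in [u] and [v]. The negative expression is the
    joint contribution of two complementary traces in [contra_generic]. *)
Lemma pair_neg a b A A' u v d k : 0 < b -> b <= a -> 0 < A -> 0 < A' ->
  (0 < u < k)%N -> (0 < v < k)%N -> (2 < u + v)%N -> (0 < d)%N ->
  ~~ [&& u == 2, v == 2, d == 1 & k == 3] ->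
  b * (v + d)%:R * A <= a * u%:R * A' -> b * (u + d)%:R * A' <= a * v%:R * A ->
  A * ((v + d)%:R * b ^+ k - (a ^+ k - b ^+ k) * u.-1%:R)
    + A' * ((u + d)%:R * b ^+ k - (a ^+ k - b ^+ k) * v.-1%:R) < 0.
Proof.
move=> b0 ba A0 A'0 /andP[u0 uk] /andP[v0 vk] uv d0 exc I1 I2.
have [th th1 aE] : exists2 th, 1 <= th & a = b * th.
  by exists (a / b); rewrite ?ler_pdivlMr ?mul1r // mulrC divfK // lt0r_neq0.
have J1 : (v + d)%:R * A <= th * u%:R * A' by rewrite -(ler_pM2l b0) !mulrA -aE.
have J2 : (u + d)%:R * A' <= th * v%:R * A by rewrite -(ler_pM2l b0) !mulrA -aE.
rewrite aE exprMn.
have -> : A * ((v + d)%:R * b ^+ k - (b ^+ k * th ^+ k - b ^+ k) * u.-1%:R)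
    + A' * ((u + d)%:R * b ^+ k - (b ^+ k * th ^+ k - b ^+ k) * v.-1%:R)
  = b ^+ k * (A * ((v + d)%:R - (th ^+ k - 1) * u.-1%:R)
    + A' * ((u + d)%:R - (th ^+ k - 1) * v.-1%:R)) by ring.
rewrite pmulr_rlt0 ?exprn_gt0 //.
have [vu|/ltnW uv'] := leqP v u; first by apply: scaled_pair; rewrite ?v0 //; lia.
rewrite addrC; apply: scaled_pair; rewrite ?u0 //; first by lia.
by move: exc; rewrite andbCA.
Qed.

(* The case [n = 7], [k = 3] where the members of [F] not containing [e] have to be used. *)
Lemma pair_neg_7_3 a b X Y Q P : 0 < b -> 0 < X -> 0 < Y -> a <= X -> a <= Y ->
  b * 3 * (4 * X) <= a * 2 * (4 * Y) -> b * 3 * (4 * Y) <= a * 2 * (4 * X) ->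
  a * b * (X + Y) <= Q -> X * Y <= P ->
  (a ^+ 3 - b ^+ 3) * Q + (a ^+ 3 * b - a * b ^+ 3) * P = b ^+ 3 * (3 * a * b * (X + Y)) -> False.
Proof.
move=> b0 X0 Y0 aX aY I1 I2 HQ HP E.
have ab : 3 / 2 * b <= a by nra.
have a0 : 0 < a by lra.
(* [X] and [Y] are at least [a], so the bound on [P] becomes a multiple of [X + Y], which cancels
   later. *)
have XY : a * (X + Y) <= 2 * P by nra.
have a3 : (3 / 2 * b) ^+ 2 <= a ^+ 2 by rewrite lerXn2r ?nnegrE //; lra.
have a33 : (3 / 2 * b) ^+ 3 <= a ^+ 3 by rewrite lerXn2r ?nnegrE //; lra.
have b3 : 0 < b ^+ 3 by rewrite exprn_gt0.
have c1 : 0 <= a ^+ 3 - b ^+ 3.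
  have E3 : (3 / 2 * b) ^+ 3 = 27 / 8 * b ^+ 3 by field.
  by rewrite E3 in a33; lra.
have c2 : 0 <= a ^+ 3 * b - a * b ^+ 3.
  have -> : a ^+ 3 * b - a * b ^+ 3 = a * b * (a ^+ 2 - b ^+ 2) by ring.
  have E2 : (3 / 2 * b) ^+ 2 = 9 / 4 * b ^+ 2 by field.
  rewrite E2 in a3; apply: mulr_ge0; first by rewrite mulr_ge0 ?ltW.
  by have := sqr_ge0 b; lra.
have H1 := ler_wpM2l c1 HQ; have H2 := ler_wpM2l c2 XY.
have W0 : 0 < a * b * (X + Y) by rewrite !mulr_gt0 // addr_gt0.
have : (a * b * (X + Y)) * (2 * (a ^+ 3 - b ^+ 3) + a * (a ^+ 2 - b ^+ 2))
   <= (a * b * (X + Y)) * (6 * b ^+ 3) by lra.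
rewrite ler_pM2l //.
have -> : 2 * (a ^+ 3 - b ^+ 3) + a * (a ^+ 2 - b ^+ 2) = 3 * a ^+ 3 - 2 * b ^+ 3 - a * b ^+ 2 by ring.
(* Already at [a = 3 / 2 * b] the left-hand side is [53 / 8 * b ^+ 3], above [6 * b ^+ 3], and it
   grows with [a]. *)
have H3 : 0 <= (a - 3 / 2 * b) * (a ^+ 2 + 3 / 2 * a * b + 2 * b ^+ 2).
  rewrite mulr_ge0 ?subr_ge0 // !addr_ge0 ?exprn_ge0 // ?mulr_ge0 ?exprn_ge0 // ?ltW //; lra.
have b30 : 0 < b ^+ 3 by [].
nra.
Qed.

End PairInequality.

(** * Estimates against vectors concentrated on 2k - 1 points *)

Section Concentrated.

(** The constant vector gives the star a radius of at least [k * 'C(n.-1, k.-1) / n], which does not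
    decrease with [n]; the worst case [n = 2k + 1] leaves a factor [6 / 5] over the value on
    [2k - 1] points. For [k = 3], [n = 7] the inequality fails. *)
Lemma bin_star_lower n k : (3 < k)%N -> (2 * k < n)%N ->
  (6 * n * 'C((2 * k).-2, k.-1) <= 5 * k * 'C(n.-1, k.-1))%N.
Proof.
move=> k4 kn; have [d ->] : exists d, n = ((2 * k).+1 + d)%N by exists (n - (2 * k).+1)%N; lia.
elim: d {kn} => [|d IH].
  rewrite addn0 /=.
  have E1 := mul_bin_diag (2 * k).-1 k.-1.
  have E2 := mul_bin_left (2 * k) k.-1.
  have E3 := binS (2 * k).-1 k.-1.
  have E4 : 'C((2 * k).-1, k.-1) = 'C((2 * k).-1, k).
    by rewrite -bin_sub; [congr ('C(_, _)) |]; lia.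
  have k1 : k.-1.+1 = k by lia.
  have k2 : (2 * k).-1.+1 = (2 * k)%N by lia.
  have k3 : (2 * k - k.-1 = k.+1)%N by lia.
  rewrite k1 ?k2 ?k3 E4 in E1 E2 E3.
  have {E2 E3}E : (k.+1 * 'C(2 * k, k.-1) = 2 * ((2 * k).-1 * 'C((2 * k).-2, k.-1)))%N.
    by rewrite -E2 E3 E1; lia.
  move: E; set C0 := 'C(_.-2, _); set C1 := 'C(_, _) => E.
  rewrite -(leq_pmul2l (ltn0Sn k)).
  have -> : (k.+1 * (5 * k * C1) = 5 * k * (2 * ((2 * k).-1 * C0)))%N by rewrite mulnCA E.
  rewrite -[in leqRHS]mulnA !mulnA leq_mul2r; apply/orP; right.
  by clear -k4; nia.
have -> : ((2 * k).+1 + d.+1).-1 = ((2 * k).+1 + d)%N by rewrite addnS.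
set N := ((2 * k).+1 + d)%N in IH *.
have -> : ((2 * k).+1 + d.+1)%N = N.+1 by rewrite addnS.
have E := mul_bin_down N k.-1.
have Nk : (0 < N - k.-1)%N by lia.
rewrite -(leq_pmul2l Nk).
have -> : ((N - k.-1) * (5 * k * 'C(N, k.-1)) = N * (5 * k * 'C(N.-1, k.-1)))%N.
  by rewrite mulnCA -E mulnCA.
have H : ((N - k.-1) * N.+1 <= N * N)%N by clear -k4; nia.
apply: (@leq_trans (N * (6 * N * 'C((2 * k).-2, k.-1)))); last by rewrite leq_mul2l IH orbT.
have := leq_mul H (leqnn (6 * 'C((2 * k).-2, k.-1))).
by congr (_ <= _)%N; rewrite !mulnA; congr (_ * _)%N; lia.
Qed.

(** An equality at [k = 4]. It yields [k * be <= 1 / 14] below, and [6 / 5 * 13 / 14 > 1]. *)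
Lemma pow_lower k : (3 < k)%N -> (14 * k <= (2 * k).-1 * 2 ^ k.-1)%N.
Proof.
move=> k4; have [d ->] : exists d, k = (4 + d)%N by exists (k - 4)%N; lia.
elim: d {k4} => [//|d IH]; have -> : (4 + d.+1).-1 = (4 + d).-1.+1 by lia.
rewrite expnS; move: IH; set p := (2 ^ _)%N => IH; nia.
Qed.

Variable R : realFieldType.

(** [rho] is the radius and [be] the share of the power sum outside the first [2k - 1] points. The
    hypotheses say that [be] is small, bound [rho] from above by AM-GM inside, and from below by
    test vectors on the star. *)
Lemma concentrated_contra n k (rho be : R) : (2 < k)%N -> (2 * k < n)%N -> 0 <= be ->
  ((2 * k).-1%:R * (n - (2 * k).-1)%:R ^+ k.-1 + 1) * be <= 1 ->
  rho * (1 - k%:R * be) <= 'C((2 * k).-2, k.-1)%:R * (1 - be) ->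
  k%:R * 'C(n.-1, k.-1)%:R <= rho * n%:R ->
  (k = 3%N -> 9 / 2 * 'C(n.-1, 2)%:R <= rho * (n.-1%:R + 27 / 8)) -> False.
Proof.
move=> k3 kn be0 Hbe H L1 L2.
have N2 : 2 <= (n - (2 * k).-1)%:R :> R by rewrite (ler_nat _ 2); lia.
have Hpow : 2 ^+ k.-1 <= (n - (2 * k).-1)%:R ^+ k.-1 :> R by rewrite lerXn2r ?nnegrE ?ler0n.
have Hbe' : ((2 * k).-1%:R * 2 ^+ k.-1 + 1) * be <= 1.
  apply: le_trans Hbe; rewrite ler_wpM2r // lerD2r ler_wpM2l ?ler0n //.
have [kE|k4] : k = 3%N \/ (3 < k)%N by lia.
  subst k; have := L2 erefl; move: Hbe' H => /=.
  have -> : 'C(4, 2)%:R = 6 :> R by [].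
  have C2 : 'C(n.-1, 2)%:R = n.-1%:R * (n.-1%:R - 1) / 2 :> R.
    apply: (canRL (mulfK _)); first by rewrite pnatr_eq0.
    rewrite -natrM mulnC -(mul_bin_diag n.-1 1) bin1 natrM.
    by congr (_ * _); rewrite -subn1 natrB //; lia.
  rewrite C2; have : 6 <= n.-1%:R :> R by rewrite (ler_nat _ 6); lia.
  set x := n.-1%:R => x6 Hb H1 H2.
  have be1 : 21 * be <= 1 by move: Hb; rewrite !exprS expr0; lra.
  (* [36 / 5] is what the test vector gives at [n = 7], that is [x = 6]. *)
  have rho72 : 36 / 5 <= rho.
    rewrite -(@ler_pM2r _ (x + 27 / 8)); last by lra.
    by apply: le_trans H2; nra.
  have : 36 / 5 * (1 - 3 * be) <= rho * (1 - 3 * be) by rewrite ler_wpM2r //; lra.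
  lra.
have C0 : 0 < 'C((2 * k).-2, k.-1)%:R :> R by rewrite ltr0n bin_gt0; lia.
have n0 : 0 < n%:R :> R by rewrite ltr0n; lia.
have rho65 : 6 / 5 * 'C((2 * k).-2, k.-1)%:R <= rho.
  rewrite -(ler_pM2r n0); apply: le_trans L1.
  have := bin_star_lower k4 kn; rewrite -(ler_nat R) !natrM; lra.
have kbe : 14 * (k%:R * be) <= 1.
  apply: le_trans Hbe'; rewrite mulrA ler_wpM2r //.
  have := pow_lower k4; rewrite -(ler_nat R) !natrM natrX; lra.
have rho0 : 0 <= rho by lra.
have : rho * (13 / 14) <= rho * (1 - k%:R * be) by rewrite ler_wpM2l //; lra.
have : 'C((2 * k).-2, k.-1)%:R * (1 - be) <= 'C((2 * k).-2, k.-1)%:R * 1.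
  by rewrite ler_wpM2l ?(ltW C0) //; lra.
lra.
Qed.

End Concentrated.

(** * Optimal shifted families are stars *)

Section Core.
Variables (R : realFieldType) (n k : nat) (F : {set {set 'I_n}}) (x : 'I_n -> R) (w : R).
Implicit Types (A B C G : {set 'I_n}) (i j : 'I_n).

Definition star i : {set {set 'I_n}} := [set A : {set 'I_n} | (#|A| == k) && (i \in A)].

Lemma star_uniform i : uniform k (star i).
Proof. by move=> A; rewrite inE => /andP[/eqP]. Qed.

Lemma star_intersecting i : intersecting (star i).
Proof.
move=> A B; rewrite !inE => /andP[_ iA] /andP[_ iB].
by apply/set0Pn; exists i; rewrite inE iA.
Qed.

Lemma weight_star i (y : 'I_n -> R) b : (0 < k)%N -> (forall j, j != i -> y j = b) ->
  weight y (star i) = y i * b ^+ k.-1 * 'C(n.-1, k.-1)%:R.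
Proof.
move=> k0 yb; have -> : star i = extensions k [set i] [set~ i].
  by apply/setP => A; rewrite !inE sub1set setUCr subsetT andbT.
rewrite (@weight_extensions R _ k _ _ y b) ?cards1 ?subn1 //.
- by rewrite cardsC1 card_ord /mon big_set1.
- by rewrite disjoints_subset setCK.
- by move=> j; rewrite !inE => /yb.
Qed.

(** For the least [m], a failing exchange at [m - 1] must remove [e = m - 1] and insert some
    [l >= m]: an exchange within the points [>= m] is harmless by symmetry, one towards a smaller
    point by shiftedness. *)
Lemma symmetric_threshold : shifted F -> exists2 m, symmetric_from m F &
  (0 < m)%N -> exists e l : 'I_n, [/\ e.+1 = m, (m <= l)%N & asym_sets F e l != set0].
Proof.
move=> shift.
pose P m := [forall A in F, forall i : 'I_n, forall j : 'I_n,
  [&& (m <= i)%N, (m <= j)%N, i \in A & j \notin A] ==> (j |: (A :\ i) \in F)].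
have PP m : reflect (symmetric_from m F) (P m).
  apply: (iffP forall_inP) => [H A i j mi mj FA iA jA|H A FA].
    by move/forallP: (H A FA) => /(_ i) /forallP /(_ j); rewrite mi mj iA jA.
  apply/forallP => i; apply/forallP => j; apply/implyP => /and4P[mi mj iA jA].
  exact: H.
have exP : exists m, P m.
  by exists n; apply/PP => A i j; rewrite leqNgt ltn_ord.
case: (ex_minnP exP) => m /PP symm minm; exists m => // m0.
have : ~~ P m.-1 by apply/negP => /minm; nat_lia.
move=> /forall_inPn[A FA] /forallPn[i] /forallPn[j].
rewrite negb_imply => /andP[/and4P[mi mj iA jA] nF].
have ij : i != j by apply: contraNneq jA => <-.
have im : i.+1 = m.
  apply/eqP; rewrite eqn_leq; apply/andP; split; last by nat_lia.
  rewrite ltnNge; apply: contra nF => mi'.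
  have [mj'|jm] := leqP m j; first exact: symm.
  by apply: shift => //; apply: leq_trans mi'.
have jm : (m <= j)%N.
  rewrite leqNgt; apply/negP => jm; move/negP: ij; apply.
  by apply/eqP/val_inj => /=; nat_lia.
exists i, j; split=> //; apply/set0Pn; exists A.
by rewrite !inE FA iA jA nF.
Qed.

Hypotheses (k2 : (2 < k)%N) (kn : (2 * k < n)%N).
Hypotheses (unif : uniform k F) (int : intersecting F) (shift : shifted F) (maxF : maximal k F).
Hypotheses (x0 : forall i, 0 <= x i) (x_sorted : forall i j, (i <= j)%N -> x j <= x i)
  (opt : forall G : {set {set 'I_n}}, uniform k G -> intersecting G -> dominates k w G)
  (x1 : power_sum k x = 1) (xF : weight x F = w).

Let k1 : (1 < k)%N. Proof. exact: ltnW. Qed.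
Let k0 : (0 < k)%N. Proof. exact: ltnW. Qed.
Let n2k : (2 * k <= n)%N. Proof. exact: ltnW. Qed.
Let n0 : (0 < n)%N. Proof. exact: leq_ltn_trans kn. Qed.
Let domF : dominates k w F. Proof. exact: opt. Qed.
Let xF' : weight x F = w * power_sum k x. Proof. by rewrite x1 mulr1. Qed.
Let i0 := Ordinal n0.

Lemma star_bound (c : R) : 0 <= c -> c * 'C(n.-1, k.-1)%:R <= w * (c ^+ k + n.-1%:R).
Proof.
move=> c0; pose y j : R := if j == i0 then c else 1.
have y0 j : 0 <= y j by rewrite /y; case: ifP.
have := opt (@star_uniform i0) (@star_intersecting i0) y0.
rewrite (@weight_star _ _ 1) //; last by move=> j /negPf ji; rewrite /y ji.
rewrite expr1n mulr1 /power_sum (bigD1 i0) //= {1 2}/y eqxx.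
rewrite (eq_bigr (fun=> 1)); last by move=> j /negPf ji; rewrite /y ji expr1n.
rewrite sumr_const; suff -> : #|[pred j : 'I_n | j != i0]| = n.-1 by [].
have <- : #|[set~ i0]| = n.-1 by rewrite cardsC1 card_ord.
by apply: eq_card => j; rewrite !inE.
Qed.

Let w0 : 0 < w.
Proof.
have := star_bound ler01; rewrite expr1n mul1r addrC natr1 prednK // => H.
have C0 : 0 < 'C(n.-1, k.-1)%:R :> R by rewrite ltr0n bin_gt0; nat_lia.
by have := lt_le_trans C0 H; rewrite pmulr_lgt0 // ltr0n.
Qed.

(** Members inside the first [2k - 1] points are bounded by AM-GM. Each other member contains an
    outside point, so stationarity at these points bounds their weight by [k * w * be]. For small
    [be] the star does better. *)
Lemma not_concentrated b : 0 <= b -> (forall i, ((2 * k).-1 <= i)%N -> x i = b) ->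
  (forall i, (i < (2 * k).-1)%N -> (n - (2 * k).-1)%:R * b <= x i) -> False.
Proof.
move=> b0 xb xNb; pose D := initial n (2 * k).-1; pose N := (n - (2 * k).-1)%N.
pose be := N%:R * b ^+ k; pose C0 : R := 'C((2 * k).-2, k.-1)%:R.
have cD : #|D| = (2 * k).-1 by rewrite card_initial //; nat_lia.
have cD' : #|~: D| = N by have := cardsC D; rewrite cD card_ord /N; nat_lia.
have xD' i : i \in ~: D -> x i ^+ k = b ^+ k by rewrite !inE -leqNgt => /xb ->.
have sD : \sum_(i in D) x i ^+ k = 1 - be.
  apply: (canRL (addrK _)); rewrite -[RHS]x1 /power_sum [RHS](bigID (mem D)) /=; congr (_ + _).
  rewrite (eq_bigl (mem (~: D))); last by move=> i; rewrite /= in_setC.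
  by rewrite (eq_bigr _ xD') sumr_const cD' /be mulr_natl.
pose in_D := \sum_(A in F | A \subset D) mon x A.
pose out_D := \sum_(A in F | ~~ (A \subset D)) mon x A.
have wE : w = in_D + out_D by rewrite -xF /weight (bigID (fun A => A \subset D)).
have inD : k%:R * in_D <= C0 * (1 - be).
  have -> : C0 * (1 - be) = \sum_(A : {set 'I_n} | (A \subset D) && (#|A| == k)) \sum_(i in A) x i ^+ k.
    by rewrite sum_draws // cD sD.
  rewrite [leRHS](bigID (mem F)) /= /in_D mulr_sumr.
  have -> : \sum_(A in F | A \subset D) k%:R * mon x A
      = \sum_(A : {set 'I_n} | (A \subset D) && (#|A| == k) && (A \in F)) k%:R * mon x A.
    apply: eq_bigl => A.
    by have [/unif ->|_] := boolP (A \in F); rewrite ?eqxx ?andbF ?andbT.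
  rewrite -[leLHS]addr0; apply: lerD.
    by apply: ler_sum => A /andP[/andP[_ /eqP Ak] _]; apply: AGM_mon.
  by apply: sumr_ge0 => A _; apply: sumr_ge0 => i _; rewrite exprn_ge0.
have outD : out_D <= k%:R * w * be.
  have -> : k%:R * w * be = \sum_(i in ~: D) \sum_(A in F | i \in A) mon x A.
    rewrite (eq_bigr (fun=> w * k%:R * b ^+ k)); last first.
      by move=> i iD; rewrite (stationary_mem i k1 x0 domF xF') xD'.
    by rewrite sumr_const cD' /be -mulr_natl; ring.
  rewrite /out_D (exchange_big_dep (mem F)) /=; last by move=> i A _ /andP[].
  rewrite [leRHS](bigID (fun A => A \subset D)) /= -[leLHS]add0r; apply: lerD.
    by apply: sumr_ge0 => A _; apply: sumr_ge0 => i _; apply: mon_ge0.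
  apply: ler_sum => A /andP[FA /subsetPn[i iA iD]].
  rewrite (bigD1 i) /=; last by rewrite in_setC iD FA iA.
  by rewrite lerDl sumr_ge0 // => j _; apply: mon_ge0.
have be0 : 0 <= be by rewrite mulr_ge0 ?ler0n // exprn_ge0.
apply: (@concentrated_contra R n k (k%:R * w) be k2 kn be0).
(* Each of the [2k - 1] inner coordinates has [k]-th power at least [(N * b) ^+ k], which keeps [be]
   small. *)
- rewrite mulrDl mul1r -lerBrDr -sD -/N.
  have -> : (2 * k).-1%:R * N%:R ^+ k.-1 * be = \sum_(i in D) (N%:R * b) ^+ k.
    have Nk : N%:R ^+ k = N%:R ^+ k.-1 * N%:R :> R by rewrite -exprSr prednK.
    by rewrite sumr_const cD -mulr_natl exprMn /be Nk; ring.
  apply: ler_sum => i; rewrite in_initial => /xNb H.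
  by rewrite lerXn2r ?nnegrE ?mulr_ge0 ?ler0n //.
- rewrite mulrBr mulr1; have : k%:R * out_D <= k%:R * (k%:R * w * be) by rewrite ler_wpM2l.
  have kw : k%:R * w = k%:R * in_D + k%:R * out_D by rewrite {1}wE mulrDr.
  by move: inD; rewrite -/C0; lra.
- have := star_bound ler01; rewrite expr1n mul1r addrC natr1 prednK // => H.
  by rewrite -mulrA ler_wpM2l.
(* For [k = 3] the constant vector is not a good enough test vector on the star. *)
- move=> k3; have c0 : 0 <= 3 / 2 :> R by lra.
  have := star_bound c0; rewrite k3 /=.
  have -> : (3 / 2) ^+ 3 = 27 / 8 :> R by field.
  lra.
Qed.

Section Asymmetric.
Variables (m : nat) (e l : 'I_n).
Hypotheses (sym : symmetric_from m F) (em : e.+1 = m) (ml : (m <= l)%N) (e0 : (0 < e)%N).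
Hypothesis asym : asym_sets F e l != set0.

Let traces := asym_traces F e l.
Let init_e := initial n e.
Let N := #|~: initial n m|.
Let a := x e.
Let b := x l.
Let d := (n - 2 * k)%N.
Let tw := trace_weight k m x l.

Let mn : (m <= n)%N. Proof. by rewrite -em. Qed.
Let NE : N = (n - m)%N. Proof. by rewrite /N cardsCs setCK card_ord card_initial. Qed.
Let el : (e <= l)%N. Proof. by apply: leq_trans ml; rewrite -em. Qed.
Let ba : b <= a. Proof. exact: x_sorted. Qed.
Let b_ge0 : 0 <= b. Proof. exact: x0. Qed.

Let sizes B : B \in traces -> [/\ (0 < #|B| < k)%N, (0 < #|init_e :\: B| < k)%N
  & (#|B| + #|init_e :\: B| = e)%N].
Proof. exact: (asym_traces_sizes k0 n2k unif int shift sym em ml maxF e0). Qed.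

Let compl B : B \in traces -> init_e :\: B \in traces.
Proof. exact: (asym_trace_compl k0 n2k unif int shift sym em ml maxF). Qed.

Let complK B : B \in traces -> init_e :\: (init_e :\: B) = B.
Proof.
by move=> /asym_trace_sub Be; rewrite setDDr setDv set0U; apply/setIidPr.
Qed.

Let tail_const i : (m <= i)%N -> x i = b.
Proof.
have H := tail_le k1 n2k unif int sym x0 w0 opt xF'.
by move=> mi; apply/eqP; rewrite eq_le !H.
Qed.

Let trace0 : exists B, B \in traces.
Proof. by have [A AA] := set0Pn _ asym; exists (A :&: init_e); apply: imset_f. Qed.

Let e_le : (e <= (2 * k).-2)%N.
Proof. by have [B /sizes[]] := trace0; nat_lia. Qed.

Let tw_gt0 B : 0 < b -> B \in traces -> 0 < tw B.
Proof.
move=> b0 BB; have [B1 B2 B3] := sizes BB.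
rewrite /tw /trace_weight !mulr_gt0 ?exprn_gt0 //; last first.
  rewrite ltr0n bin_gt0 -/N NE -em; nat_lia.
apply: mon_gt0 => i /(subsetP (asym_trace_sub BB)); rewrite in_initial => ie.
by apply: lt_le_trans b0 _; apply: x_sorted; apply: leq_trans (ltnW ie) el.
Qed.

Let pullB B : B \in traces ->
  b * ((k - #|init_e :\: B|) + d)%:R * tw B <= a * (k - #|B|)%:R * tw (init_e :\: B).
Proof.
move=> BB; have := pull k1 n2k unif int shift maxF sym x0 w0 opt xF' em ml e0 BB.
have [B1 B2 B3] := sizes BB.
have -> : (#|~: initial n m| - (k - #|B|).-1 = k - #|init_e :\: B| + d)%N.
  by rewrite -/N NE -em /d; nat_lia.
by [].
Qed.

(** Up to the factor [a], the share of [B] in [N] times the right side of [balance] minus its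
    [both_weight] term, estimated by [both_weight_ge]. Here [N - (k - #|B|).-1] equals
    [k - #|init_e :\: B| + d]. *)
Let f B := tw B * ((k - #|init_e :\: B| + d)%:R * b ^+ k - (a ^+ k - b ^+ k) * (k - #|B|).-1%:R).

Let only_tail_bound : N%:R * (a ^+ k * b - a * b ^+ k) * only_tail F x e l
  <= a * \sum_(B in traces) f B.
Proof.
have E1 := balance k1 unif int shift x0 opt xF' em ml.
have E2 := asym_weight k1 n2k unif int shift maxF sym x0 w0 opt xF' em ml e0.
have E3 := both_weight_ge k1 n2k unif int shift maxF sym x0 w0 opt xF' em ml e0.
rewrite -/a -/b -/N -/traces -/tw in E1 E2 E3.
have -> : a * \sum_(B in traces) f B
    = b ^+ k * (N%:R * weight x (asym_sets F e l))
      - (a ^+ k - b ^+ k) * \sum_(B in traces) a * tw B * (k - #|B|).-1%:R.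
  rewrite E2 !mulr_sumr -sumrB; apply: eq_bigr => B BB.
  have [B1 B2 B3] := sizes BB.
  have -> : (N - (k - #|B|).-1 = k - #|init_e :\: B| + d)%N.
    by rewrite NE -em /d; nat_lia.
  rewrite /f; ring.
have ab : 0 <= a ^+ k - b ^+ k by rewrite subr_ge0 lerXn2r ?nnegrE // (le_trans b_ge0).
have := ler_wpM2l ab E3.
have := congr1 (fun z => N%:R * z) E1; rewrite /=; lra.
Qed.

Let only_tail_ge0 : 0 <= only_tail F x e l.
Proof. by apply: sumr_ge0 => A _; apply: mon_ge0. Qed.

Let sum_f_ge0 : 0 < b -> 0 <= \sum_(B in traces) f B.
Proof.
move=> b0; have a0 : 0 < a by apply: lt_le_trans ba.
rewrite -(pmulr_rge0 _ a0); apply: le_trans only_tail_bound.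
rewrite mulr_ge0 // mulr_ge0 ?ler0n //.
have E c : c ^+ k = c * c ^+ k.-1 by rewrite -exprS prednK.
have -> : a ^+ k * b - a * b ^+ k = a * b * (a ^+ k.-1 - b ^+ k.-1) by rewrite !E; ring.
by rewrite mulr_ge0 ?subr_ge0 ?lerXn2r ?nnegrE // ?mulr_ge0 // ltW.
Qed.

(** Complementation permutes the traces, so twice the sum of [f] is a sum over complementary pairs.
    Each is negative by [pair_neg], against [sum_f_ge0]. *)
Let contra_generic : 0 < b -> (e < (2 * k).-2)%N -> ~~ [&& e == 2 :> nat, n == 7 & k == 3] -> False.
Proof.
move=> b0 ek exc.
have : \sum_(B in traces) (f B + f (init_e :\: B)) < 0.
  have [B0 BB0] := trace0.
  have neg B : B \in traces -> f B + f (init_e :\: B) < 0.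
    move=> BB; have BB' := compl BB; have [B1 B2 B3] := sizes BB.
    rewrite /f (complK BB); apply: pair_neg => //; try exact: tw_gt0.
    - by nat_lia.
    - by nat_lia.
    - by nat_lia.
    - by rewrite /d; nat_lia.
    - by apply: contra exc; rewrite /d; nat_lia.
    - exact: pullB.
    - by have := pullB BB'; rewrite (complK BB).
  rewrite (bigD1 B0) //=; have H0 := neg _ BB0.
  have : \sum_(B in traces | B != B0) (f B + f (init_e :\: B)) <= 0.
    by apply: sumr_le0 => B /andP[BB _]; apply/ltW/neg.
  lra.
have E : \sum_(B in traces) f (init_e :\: B) = \sum_(B in traces) f B.
  rewrite [RHS](reindex_onto (fun B => init_e :\: B) (fun B => init_e :\: B)) /=; last first.
    by move=> B BB; apply: complK.
  apply: eq_bigl => B; apply/idP/andP => [BB|[BB /eqP <-]]; last exact: compl.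
  by rewrite complK // compl.
by rewrite big_split /= E; have := sum_f_ge0 b0; lra.
Qed.

Let x_ge_a i : i \in init_e -> a <= x i.
Proof. by rewrite in_initial => /ltnW; apply: x_sorted. Qed.

(** The traces are two complementary singletons. Instead of mere nonnegativity of [only_tail], the
    bound [mon x B0 * mon x B1 <= only_tail] is used. *)
Let contra_7_3 : 0 < b -> e = 2%N :> nat -> n = 7%N -> k = 3%N -> False.
Proof.
move=> b0 e2 n7 k3; have [B0 BB0] := trace0; have BB1 := compl BB0.
set B1 := init_e :\: B0 in BB1.
have N4 : N = 4%N by rewrite NE -em e2 n7.
have d1 : d = 1%N by rewrite /d n7 k3.
have card1 B : B \in traces -> #|B| = 1%N.
  by move=> /sizes[]; rewrite e2; nat_lia.
have B01 : B0 != B1.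
  apply/eqP => E; have /cards1P[i Bi] : #|B0| == 1%N by rewrite card1.
  have iB0 : i \in B0 by rewrite Bi inE.
  by have := iB0; rewrite E in_setD iB0.
have tracesE : traces = [set B0; B1].
  apply/setP => B; rewrite in_set2; apply/idP/orP => [BB|[/eqP ->|/eqP ->]] //.
  have /cards1P[i Bi] : #|B| == 1%N by rewrite card1.
  have ie : i \in init_e by apply: (subsetP (asym_trace_sub BB)); rewrite Bi inE.
  have eqB C : C \in traces -> i \in C -> B == C.
    move=> CC iC; rewrite eqEcard !card1 // leqnn andbT Bi sub1set iC //.
  have [iB0|iB0] := boolP (i \in B0); [left | right]; apply: eqB => //.
  by rewrite in_setD iB0.
have twE B : B \in traces -> tw B = b * (4 * mon x B).
  move=> BB; rewrite /tw /trace_weight (card1 _ BB) k3 /= -/N -/b N4 expr1 bin1; ring.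
have mon1 B : B \in traces -> 0 < mon x B /\ a <= mon x B.
  move=> BB; have /cards1P[i Bi] : #|B| == 1%N by rewrite card1.
  have ai : a <= x i.
    by apply/x_ge_a/(subsetP (asym_trace_sub BB)); rewrite Bi inE.
  rewrite Bi /mon big_set1; split=> //.
  by apply: lt_le_trans ai; apply: lt_le_trans ba.
have [X0 aX] := mon1 _ BB0; have [Y0 aY] := mon1 _ BB1.
have a0 : 0 < a by apply: lt_le_trans ba.
have sumE (g : {set 'I_n} -> R) : \sum_(B in traces) g B = g B0 + g B1.
  by rewrite tracesE big_setU1 ?inE ?big_set1.
have E1 := balance k1 unif int shift x0 opt xF' em ml.
have E2 := asym_weight k1 n2k unif int shift maxF sym x0 w0 opt xF' em ml e0.
have E3 := both_weight_ge k1 n2k unif int shift maxF sym x0 w0 opt xF' em ml e0.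
rewrite -/a -/b -/N -/traces -/tw !sumE !twE // !card1 // k3 N4 /= in E1 E2 E3.
have I1 := pullB BB0; have I2 := pullB BB1; rewrite complK // in I2.
rewrite -/B1 !twE // !card1 // k3 d1 -[(3 - 1 + 1)%N]/3%N -[(3 - 1)%N]/2%N in I1 I2.
rewrite -[(4 - 1)%N]/3%N in E2.
apply: (@pair_neg_7_3 _ a b (mon x B0) (mon x B1) (both_weight F x e l) (only_tail F x e l)) => //.
- by rewrite -(ler_pM2l b0); lra.
- by rewrite -(ler_pM2l b0); lra.
- by lra.
- have B0e := asym_trace_sub BB0.
  have eB0 : e \notin B0 by apply/negP => /(subsetP B0e); rewrite in_initial ltnn.
  have lB0 : l \notin e |: B0.
    apply/negP; rewrite in_setU1 => /orP[/eqP le|/(subsetP B0e)].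
      by move: ml; rewrite -em le ltnn.
    by rewrite in_initial ltnNge el.
  have /cards1P[j B1j] : #|B1| == 1%N by rewrite card1.
  have [jB0 je] : j \notin B0 /\ (j < e)%N.
    have : j \in B1 by rewrite B1j inE.
    by rewrite in_setD in_initial => /andP[].
  (* Shifting [e] to the point [j] of [B1] turns this member into one that contains [l] but not [e],
     and whose other two points form [B0] and [B1]. *)
  have FA : l |: (e |: B0) \in F.
    apply: (asym_trace_in unif sym em BB0); first by rewrite !cardsU1 lB0 eB0 card1 // k3.
    apply/setP => i; rewrite !inE; have [->|il] := eqVneq i l.
      rewrite -in_setU1 (negPf lB0) /= ltnNge ml //.
    rewrite /=; have [->|ie] := eqVneq i e; first by rewrite -em ltnSn.
    rewrite /=; have [iB|//] := boolP (i \in B0).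
    by have := subsetP B0e _ iB; rewrite in_initial -em => /ltnW.
  have jA : j \notin l |: (e |: B0).
    rewrite !inE !negb_or jB0 andbT; apply/andP; split.
      by apply: contraTneq je => ->; rewrite -leqNgt.
    by apply: contraTneq je => ->; rewrite ltnn.
  have eA : e \in l |: (e |: B0) by rewrite !inE eqxx orbT.
  have := shift FA je eA jA; set A := j |: _ => FA'.
  have el' : e != l by apply: contraNneq lB0 => ->; rewrite setU11.
  have lA : l \in A.
    by rewrite in_setU1 in_setD1 (eq_sym l e) el' setU11 orbT.
  have eA' : e \notin A.
    by rewrite in_setU1 in_setD1 eqxx orbF; apply: contraTneq je => ->; rewrite ltnn.
  have AE : A :\ l = j |: B0.
    apply/setP => i; rewrite !inE; have [->|il] := eqVneq i l.
      have -> : (l == j) = false by apply/eqP => lj; move: je; rewrite -lj ltnNge el.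
      by move: lB0; rewrite in_setU1 negb_or => /andP[_ /negPf ->].
    rewrite /=; have [->|ie] := eqVneq i e; first by rewrite (negPf eB0) orbF.
    by [].
  rewrite /only_tail (bigD1 A) /=; last by rewrite FA' lA eA'.
  rewrite AE monU1 // B1j {2}/mon big_set1 mulrC lerDl sumr_ge0 // => C _.
  exact: mon_ge0.
- by move: E1; have : 4 * weight x (asym_sets F e l) = 4 * (3 * a * b * (mon x B0 + mon x B1));
    [lra | move=> H; rewrite (mulfI _ H) // pnatr_eq0].
Qed.

(** If [b = 0], then [x] lives on the first [2k - 1] points. If [e = 2k - 2], complementary traces
    have size [k - 1] and [pair_neg] does not apply, but the two instances of [pull] multiply to
    [(n - (2k - 1)) * b <= a]; again [x] is concentrated. Otherwise the traces are paired. *)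
Lemma asymmetric_contra : False.
Proof.
have le_m i : (i < (2 * k).-1)%N || (m <= i)%N.
  by have := e_le; rewrite -em; nat_lia.
have [bE|b0] : b = 0 \/ 0 < b.
  by move: b_ge0; rewrite le_eqVlt eq_sym => /orP[/eqP|]; [left | right].
  apply: (@not_concentrated 0) => // [i ki|i _]; last by rewrite mulr0.
  by rewrite -bE tail_const //; have := e_le; rewrite -em; nat_lia.
have := e_le; rewrite leq_eqVlt => /orP[/eqP eE|ek]; last first.
  have [/and3P[/eqP e2 /eqP n7 /eqP k3]|exc] := boolP [&& e == 2 :> nat, n == 7 & k == 3].
    exact: contra_7_3.
  exact: contra_generic.
have NE' : N = (n - (2 * k).-1)%N by rewrite NE -em eE; congr (n - _)%N; nat_lia.
apply: (@not_concentrated b) => // [i ki|i ki].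
  by rewrite tail_const // -em eE; nat_lia.
have [B BB] := trace0; have BB' := compl BB.
have [B1 B2 B3] := sizes BB.
have u1 : (k - #|B|)%N = 1%N by rewrite eE in B3; clear -B1 B2 B3 k2; nat_lia.
have v1 : (k - #|init_e :\: B|)%N = 1%N by rewrite eE in B3; clear -B1 B2 B3 k2; nat_lia.
have I1 := pullB BB; have I2 := pullB BB'; rewrite complK // in I2.
have dN : (1 + d = n - (2 * k).-1)%N by rewrite /d; nat_lia.
rewrite u1 v1 dN mulr1 in I1 I2.
have t0 := tw_gt0 b0 BB; have t1 := tw_gt0 b0 BB'.
apply: (@le_trans _ _ a); last first.
  by apply: x_sorted; rewrite eE; nat_lia.
rewrite -(@ler_pXn2r _ 2) ?nnegrE ?mulr_ge0 ?ler0n //; last exact: le_trans ba.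
rewrite -(ler_pM2r (mulr_gt0 t0 t1)).
have : b * (n - (2 * k).-1)%:R * tw B * (b * (n - (2 * k).-1)%:R * tw (init_e :\: B))
  <= a * tw (init_e :\: B) * (a * tw B).
  have q0 t : 0 < t -> 0 <= b * (n - (2 * k).-1)%:R * t.
    by move=> /ltW tge0; do 2 apply: mulr_ge0 => //; apply: ler0n.
  by apply: ler_pM => //; apply: q0.
congr (_ <= _); ring.
Qed.

End Asymmetric.

(** [asymmetric_contra] leaves only [e = 0], that is [m = 1]; then all members share the point 0 by
    [trace_intersecting]. *)
Theorem shifted_maximal_star : F = star i0.
Proof.
have [m sym] := symmetric_threshold shift.
have m0 := symmetric_from_gt0 k0 n2k unif int sym maxF.
move/(_ m0) => [e [l [em ml asym]]].
have [e0|e0] := posnP e; last by case: (asymmetric_contra sym em ml e0 asym).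
have ei0 : e = i0 by apply: val_inj.
have [A] := set0Pn _ asym; rewrite in_set => /and4P[FA eA _ _].
have Fi0 B : B \in F -> i0 \in B.
  move=> FB; have := trace_intersecting k0 n2k unif int shift sym FA FB.
  move=> /set0Pn[i]; rewrite in_setI in_setI in_initial -em e0 ltnS leqn0.
  move=> /andP[/andP[_ iB] /eqP i0'].
  by have <- : i = i0 by apply: val_inj.
apply/setP => B; rewrite inE; apply/idP/andP => [FB|[/eqP Bk iB]].
  by rewrite unif // eqxx Fi0.
by apply: maxF => // C FC; apply/set0Pn; exists i0; rewrite inE iB Fi0.
Qed.

End Core.

(** * Shifting *)

Section Shift.
Variables (n k : nat).
Implicit Types (A B : {set 'I_n}) (F : {set {set 'I_n}}) (i j : 'I_n).

Definition movable F i j A := [&& j \in A, i \notin A & i |: (A :\ j) \notin F].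
Definition shift_set F i j A := if movable F i j A then i |: (A :\ j) else A.
Definition shift_family F i j := [set shift_set F i j A | A in F].

Lemma shift_set_inj F i j : {in F &, injective (shift_set F i j)}.
Proof.
move=> A B FA FB; rewrite /shift_set.
case: ifPn => [/and3P[jA iA nA]|_]; case: ifPn => [/and3P[jB iB nB]|_] //.
- by move=> E; rewrite -(swapK jA iA) E swapK.
- by move=> E; rewrite E FB in nA.
- by move=> E; rewrite -E FA in nB.
Qed.

Lemma shift_family_uniform F i j : uniform k F -> uniform k (shift_family F i j).
Proof.
move=> unif _ /imsetP[A FA ->]; rewrite /shift_set.
by case: ifP => [/and3P[jA iA _]|_]; rewrite ?cards_swap // unif.
Qed.

(** The critical case is a moved [A] against an unmoved [B] containing [j] but not [i]: then
    [i |: (B :\ j)] is a member and meets [A] in a point other than [i] and [j]. *)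
Lemma shift_family_intersecting F i j : intersecting F -> intersecting (shift_family F i j).
Proof.
move=> int; suff main A B : A \in F -> B \in F -> movable F i j A ->
    shift_set F i j A :&: shift_set F i j B != set0.
  move=> _ _ /imsetP[A FA ->] /imsetP[B FB ->].
  have [mA|mA] := boolP (movable F i j A); first exact: main.
  have [mB|mB] := boolP (movable F i j B); first by rewrite setIC main.
  by rewrite /shift_set (negPf mA) (negPf mB) int.
move=> FA FB mA; rewrite /shift_set mA; case/and3P: mA => jA iA nA.
have iA' : i \in i |: (A :\ j) by rewrite setU11.
have [iB|iB] := boolP (i \in B).
  apply/set0Pn; exists i; rewrite in_setI iA' /=.
  by case: ifP => // _; rewrite setU11.
case: ifPn => [_|]; first by apply/set0Pn; exists i; rewrite in_setI iA' setU11.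
rewrite /movable iB /=; have [jB /=|jB _] := boolP (j \in B).
  rewrite negbK => /(int _ _ FA) /set0Pn[t]; rewrite !inE => /andP[tA /orP[/eqP ti|/andP[tj tB]]].
    by rewrite -ti tA in iA.
  by apply/set0Pn; exists t; rewrite !inE tA tj tB orbT.
have /set0Pn[t] := int _ _ FA FB; rewrite inE => /andP[tA tB].
apply/set0Pn; exists t; rewrite in_setI in_setU1 in_setD1 tA tB !andbT.
by apply/orP; right; apply: contraNneq jB => <-.
Qed.

(** Grows both when a set is shifted to a smaller point and when a nonempty set is added, so one
    induction covers both operations. *)
Definition height F := (\sum_(A in F) \sum_(v in A) (n - v))%N.

Lemma height_shift F i j A : (i < j)%N -> A \in F -> movable F i j A ->
  (height F < height (shift_family F i j))%N.
Proof.
move=> ij FA mA; rewrite /height big_imset /=; last exact: shift_set_inj.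
have swapS B : j \in B -> i \notin B ->
    (\sum_(v in B) (n - v) < \sum_(v in i |: (B :\ j)) (n - v))%N.
  move=> jB iB; rewrite big_setU1 ?in_setD1 ?(negPf iB) ?andbF //= [X in (X < _)%N](big_setD1 j) //=.
  by rewrite ltn_add2r; have := ltn_ord j; nat_lia.
rewrite (bigD1 A) //= [X in (_ < X)%N](bigD1 A) //= -addSn; apply: leq_add.
  by rewrite /shift_set mA; case/and3P: mA => jA iA _; apply: swapS.
apply: leq_sum => B _; rewrite /shift_set; case: ifP => // /and3P[jB iB _].
by apply/ltnW/swapS.
Qed.

Lemma height_le F : (height F <= height setT)%N.
Proof.
by rewrite [X in (_ <= X)%N](big_setID F) /= setTI leq_addr.
Qed.

Lemma height_setU1 F A : A \notin F -> A != set0 -> (height F < height (A |: F))%N.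
Proof.
move=> FA /set0Pn[v vA]; rewrite /height big_setU1 //= -[X in (X < _)%N]add0n ltn_add2r.
by rewrite (big_setD1 v) //= ltn_addr // subn_gt0.
Qed.

End Shift.

(** * Uniqueness: undoing shifts and enlargements *)

Section StarOptimal.
Variables (R : realFieldType) (n k : nat) (x : 'I_n -> R) (w : R) (i0 : 'I_n).
Implicit Types (A B : {set 'I_n}) (F : {set {set 'I_n}}) (i j : 'I_n).
Hypotheses (k1 : (1 < k)%N) (kn : (2 * k < n)%N).
Hypotheses (x0 : forall i, 0 <= x i) (star_dom : dominates k w (star k i0))
  (x1 : power_sum k x = 1) (star_opt : weight x (star k i0) = w).

Let k0 : (0 < k)%N. Proof. exact: ltnW. Qed.

Let exists_star (D : {set 'I_n}) : (k.-1 <= #|D|)%N -> i0 \notin D ->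
  exists2 A : {set 'I_n}, A \subset i0 |: D & A \in star k i0.
Proof.
rewrite -bin_gt0 -cards_draws card_gt0 => /set0Pn[A]; rewrite inE => /andP[AD /eqP Ak] iD.
have iA : i0 \notin A by apply: contra iD => /(subsetP AD).
exists (i0 |: A); first exact: setUS.
by rewrite inE setU11 andbT cardsU1 iA Ak add1n prednK.
Qed.

Let star_opt' : weight x (star k i0) = w * power_sum k x.
Proof. by rewrite x1 mulr1. Qed.

Let w_gt0 : 0 < w.
Proof.
have := star_dom (y := fun=> 1) (fun=> ler01).
rewrite (@weight_star _ _ _ _ (fun=> 1) 1) // expr1n !mul1r /power_sum.
rewrite (eq_bigr (fun=> 1)); last by move=> i _; rewrite expr1n.
rewrite sumr_const card_ord => H.
have C0 : 0 < 'C(n.-1, k.-1)%:R :> R by rewrite ltr0n bin_gt0; nat_lia.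
by have := lt_le_trans C0 H; rewrite pmulr_lgt0 // ltr0n; nat_lia.
Qed.

(** If [x i = 0], the derivative at [i] vanishes by stationarity. Yet in a set of positive weight,
    exchanging a point other than the centre for [i] gives a positive term of it. *)
Lemma star_coord_gt0 i : 0 < x i.
Proof.
rewrite lt_neqAle eq_sym x0 andbT; apply/eqP => xi0.
have [A As xA] : exists2 A, A \in star k i0 & 0 < mon x A.
  apply/exists_inP; apply: contraTT w_gt0; rewrite negb_exists_in => /forall_inP H.
  rewrite -leNgt -star_opt; apply: sumr_le0 => A /H.
  by rewrite -leNgt.
have := stationary i k1 x0 star_dom star_opt'.
rewrite xi0 expr0n gtn_eqF ?mulr0; last by nat_lia.
move: (As); rewrite inE => /andP[/eqP Ak i0A].
have iA : i \notin A by apply/negP => iA; rewrite (mon_eq0 iA xi0) ltxx in xA.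
have xp j : j \in A -> 0 < x j.
  move=> jA; rewrite lt_neqAle eq_sym x0 andbT; apply/eqP => xj.
  by rewrite (mon_eq0 jA xj) ltxx in xA.
have [j jA ji0] : exists2 j, j \in A & j != i0.
  have : (0 < #|A :\ i0|)%N. have := cardsD1 i0 A; rewrite i0A Ak add1n => E.
    by rewrite -ltnS -E; nat_lia.
  by rewrite card_gt0 => /set0Pn[j]; rewrite !inE => /andP[ji0 jA]; exists j.
have ii0 : i != i0 by apply: contraNneq iA => ->.
have Bs : i |: (A :\ j) \in star k i0.
  by rewrite inE cards_swap // Ak eqxx !inE i0A andbT (eq_sym i0 j) ji0 orbT.
apply/eqP; rewrite gt_eqF // (bigD1 (i |: (A :\ j))) /=; last by rewrite Bs setU11.
rewrite ltr_pwDl //; last by apply: sumr_ge0 => B _; apply: mon_ge0.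
rewrite setU1K; last by rewrite in_setD1 (negPf iA) andbF.
by apply: mon_gt0 => t; rewrite in_setD1 => /andP[_ /xp].
Qed.

(** Every star member counted at [j] is also counted at [i0], and some member of positive weight
    avoids [j]; [stationary_mem] turns both sums into powers of coordinates. *)
Lemma star_center_gt j : j != i0 -> x j < x i0.
Proof.
move=> ji0.
have Si := stationary_mem i0 k1 x0 star_dom star_opt'.
have Sj := stationary_mem j k1 x0 star_dom star_opt'.
have wk : 0 < w * k%:R by rewrite mulr_gt0 // ltr0n.
have [A AD As] : exists2 A : {set 'I_n}, A \subset i0 |: ([set: 'I_n] :\ i0 :\ j) & A \in star k i0.
  apply: exists_star; last by rewrite !inE eqxx andbF.
  have E : n = #|[set: 'I_n] :\ i0 :\ j|.+2.
    rewrite -{1}(card_ord n) -cardsT (cardsD1 i0) in_setT (cardsD1 j) in_setD1 ji0 in_setT.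
    by rewrite !add1n.
  by rewrite -ltnS -ltnS -E; nat_lia.
have jA : j \notin A by apply: contra ji0 => /(subsetP AD); rewrite !inE eqxx orbF.
have : w * k%:R * x j ^+ k < w * k%:R * x i0 ^+ k.
  rewrite -Si -Sj [ltRHS](bigID (fun A => j \in A)) /=.
  have -> : \sum_(B in star k i0 | j \in B) mon x B
      = \sum_(B : {set 'I_n} | (B \in star k i0) && (i0 \in B) && (j \in B)) mon x B.
    by apply: eq_bigl => B; rewrite inE -!andbA; case: (i0 \in B).
  rewrite ltrDl (bigD1 A) /=; last first.
    by rewrite As jA andbT; move: As; rewrite inE => /andP[].
  rewrite ltr_pwDl ?mon_gt0 //; first by move=> t _; apply: star_coord_gt0.
  by apply: sumr_ge0 => B _; apply: mon_ge0.
by rewrite ltr_pM2l // ltr_pXn2r ?nnegrE.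
Qed.

Lemma substar_optimal F : F \subset star k i0 -> weight x F = w -> F = star k i0.
Proof.
move=> Fs wF; apply/eqP; rewrite eqEsubset Fs; apply/subsetP => A As.
apply/negPn/negP => FA; have : weight x F < weight x (star k i0); last by rewrite wF star_opt ltxx.
rewrite /weight [ltRHS](big_setID F) /= (setIidPr Fs) ltrDl (bigD1 A) /=; last by rewrite inE FA.
rewrite ltr_pwDl ?mon_gt0 //; first by move=> t _; apply: star_coord_gt0.
by apply: sumr_ge0 => B _; apply: mon_ge0.
Qed.

End StarOptimal.

Section OptimalFamilies.
Variables (R : realFieldType) (n k : nat) (x : 'I_n -> R) (w : R) (i0 : 'I_n).
Implicit Types (A B : {set 'I_n}) (F : {set {set 'I_n}}) (i j : 'I_n).
Hypotheses (k2 : (2 < k)%N) (kn : (2 * k < n)%N) (i00 : i0 = 0%N :> nat).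
Hypotheses (x0 : forall i, 0 <= x i) (x_sorted : forall i j, (i <= j)%N -> x j <= x i)
  (opt : forall G : {set {set 'I_n}}, uniform k G -> intersecting G -> dominates k w G)
  (x1 : power_sum k x = 1).

Let k1 : (1 < k)%N. Proof. exact: ltnW. Qed.
Let k0 : (0 < k)%N. Proof. exact: ltnW. Qed.

Let star_dom : dominates k w (star k i0).
Proof. by apply: opt; [apply: star_uniform | apply: star_intersecting]. Qed.

Let weight_le F : uniform k F -> intersecting F -> weight x F <= w.
Proof. by move=> uF iF; have := opt uF iF x0; rewrite x1 mulr1. Qed.

(** Induction on the height still missing: a family that can be shifted or enlarged yields an
    optimal one of larger height, which is the star by induction. An added set would have positive
    weight, so enlarging is impossible. *)
Theorem optimal_is_star F : uniform k F -> intersecting F -> weight x F = w -> F = star k i0.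
Proof.
have [d] := ubnP (height [set: {set 'I_n}] - height F); elim: d F => // d IH F dF unif int wF.
have [/existsP[i /existsP[j /andP[ij /exists_inP[A FA mA]]]]|nshift] :=
  boolP [exists i : 'I_n, exists j : 'I_n, (i < j)%N && [exists A in F, movable F i j A]].
  pose F' := shift_family F i j.
  have unif' : uniform k F' by apply: shift_family_uniform.
  have int' : intersecting F' by apply: shift_family_intersecting.
  have wE : weight x F' = \sum_(B in F) mon x (shift_set F i j B).
    by rewrite /weight big_imset //; apply: shift_set_inj.
  have le_shift B : B \in F -> mon x B <= mon x (shift_set F i j B).
    rewrite /shift_set; case: ifP => // /and3P[jB iB _] _.
    rewrite monU1 ?in_setD1 ?(negPf iB) ?andbF // (monD1 _ jB) ler_wpM2r ?mon_ge0 //.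
    by apply: x_sorted; apply: ltnW.
  have wF' : weight x F' = w.
    apply/eqP; rewrite eq_le weight_le //= -wF wE; exact: ler_sum.
  have hF := height_shift ij FA mA; have hT := height_le F'.
  have F's : F' = star k i0 by apply: IH => //; rewrite -/F' in hF; nat_lia.
  have star_opt : weight x (star k i0) = w by rewrite -F's.
  (* A shift into the centre would raise the weight strictly, by [star_center_gt]. A shift to
     another point cannot have inserted [i0], so [F] was already inside the star. *)
  have [ii0|ii0] := eqVneq i i0.
    have : weight x F < weight x F'; last by rewrite wF wF' ltxx.
    rewrite wE /weight (bigD1 A) //= [ltRHS](bigD1 A) //=; apply: ltr_leD.
      rewrite /shift_set mA; case/and3P: mA => jA iA _.
      rewrite monU1 ?in_setD1 ?(negPf iA) ?andbF // (monD1 _ jA) ltr_pM2r ?mon_gt0 //.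
        rewrite ii0; apply: (star_center_gt k1 kn x0 star_dom x1 star_opt) => //.
        by apply: contraTneq ij => ->; rewrite ii0 ltnn.
      by move=> t _; apply: (star_coord_gt0 k1 kn x0 star_dom x1 star_opt).
    by apply: ler_sum => B /andP[/le_shift].
  apply: (substar_optimal k1 kn x0 star_dom x1 star_opt) => //; apply/subsetP => B FB.
  have : shift_set F i j B \in star k i0 by rewrite -F's imset_f.
  rewrite inE => /andP[_ iS]; rewrite inE (unif _ FB) eqxx /=; move: iS.
  by rewrite /shift_set; case: ifP => // _; rewrite in_setU1 in_setD1 eq_sym (negPf ii0) => /andP[].
have shift : shifted F.
  move=> A i j FA ij jA iA; apply/negPn/negP => nA; move/negP: nshift; apply.
  apply/existsP; exists i; apply/existsP; exists j; rewrite ij.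
  by apply/exists_inP; exists A => //; apply/and3P.
have [/existsP[A /and3P[/eqP Ak FA /forall_inP AF]]|nmax] := boolP [exists A : {set 'I_n},
    [&& #|A| == k, A \notin F & [forall B in F, A :&: B != set0]]].
  pose F' := A |: F.
  have A0 : A != set0 by rewrite -card_gt0 Ak.
  have unif' : uniform k F' by move=> B; rewrite in_setU1 => /orP[/eqP ->|/unif].
  have int' : intersecting F'.
    move=> B C; rewrite !in_setU1 => /orP[/eqP ->|FB] /orP[/eqP ->|FC].
    - by rewrite setIid.
    - exact: AF.
    - by rewrite setIC AF.
    - exact: int.
  have wE : weight x F' = mon x A + weight x F by rewrite /weight big_setU1.
  have wF' : weight x F' = w.
    by apply/eqP; rewrite eq_le weight_le //= wE wF lerDr mon_ge0.
  have hF := height_setU1 FA A0; have hT := height_le F'.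
  have F's : F' = star k i0 by apply: IH => //; rewrite -/F' in hF; nat_lia.
  have star_opt : weight x (star k i0) = w by rewrite -F's.
  have : 0 < mon x A by apply: mon_gt0 => t _; apply: (star_coord_gt0 k1 kn x0 star_dom x1 star_opt).
  by move: wE; rewrite wF wF' => E; rewrite -(ltrD2r w) add0r -E ltxx.
have maxF : maximal k F.
  move=> A Ak AF; apply/negPn/negP => FA; move/negP: nmax; apply.
  by apply/existsP; exists A; rewrite Ak eqxx FA; apply/forall_inP.
rewrite (shifted_maximal_star k2 kn unif int shift maxF x0 x_sorted opt x1 wF).
by congr (star k _); apply: val_inj.
Qed.

End OptimalFamilies.

(** * Relabelling the ground set *)

Section Permutations.
Variables (n : nat).
Implicit Types (s t : {perm 'I_n}) (X A : {set 'I_n}) (F : {set {set 'I_n}}) (i : 'I_n).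

Lemma imset_perm_inj s : injective (fun A => s @: A).
Proof. by apply: imset_inj; apply: perm_inj. Qed.

Lemma perm_familyM s t F : perm_family s (perm_family t F) = perm_family (t * s) F.
Proof.
rewrite /perm_family -imset_comp; apply: eq_imset => A /=.
by rewrite -imset_comp; apply: eq_imset => i; rewrite /= permM.
Qed.

Lemma perm_family1 F : perm_family 1 F = F.
Proof.
rewrite /perm_family -[RHS]imset_id; apply: eq_imset => A /=.
by rewrite -[RHS]imset_id; apply: eq_imset => i; rewrite perm1.
Qed.

Lemma perm_familyK s F : perm_family s (perm_family s^-1 F) = F.
Proof. by rewrite perm_familyM mulVg perm_family1. Qed.

Lemma perm_family_uniform k s F : uniform k F -> uniform k (perm_family s F).
Proof.
move=> unif _ /imsetP[A FA ->]; rewrite card_imset ?unif //; exact: perm_inj.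
Qed.

Lemma perm_family_intersecting s F : intersecting F -> intersecting (perm_family s F).
Proof.
move=> int _ _ /imsetP[A FA ->] /imsetP[B FB ->].
have /set0Pn[i] := int _ _ FA FB; rewrite inE => /andP[iA iB].
by apply/set0Pn; exists (s i); rewrite inE !imset_f.
Qed.

Lemma perm_family_ksubsets s X k : perm_family s (ksubsets X k) = ksubsets (s @: X) k.
Proof.
apply/setP => A; apply/imsetP/idP => [[B + ->]|].
  rewrite !inE card_imset; last exact: perm_inj.
  by case/andP => BX ->; rewrite andbT imsetS.
rewrite inE => /andP[AX /eqP Ak]; exists (s @^-1: A).
  rewrite inE card_preimset ?Ak ?eqxx ?andbT; last exact: perm_inj.
  apply/subsetP => i; rewrite inE => /(subsetP AX) /imsetP[j jX].
  by move/perm_inj ->.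
apply/setP => i; apply/idP/imsetP => [iA|[j]]; last by rewrite inE => jA ->.
by exists (s^-1%g i); rewrite ?inE permKV.
Qed.

Lemma perm_family_star s k i : perm_family s (star k i) = star k (s i).
Proof.
apply/setP => A; apply/imsetP/idP => [[B + ->]|].
  rewrite !inE card_imset; last exact: perm_inj.
  by case/andP => -> iB; rewrite imset_f.
rewrite inE => /andP[Ak siA]; exists (s @^-1: A).
  by rewrite !inE card_preimset ?Ak //; apply: perm_inj.
apply/setP => j; apply/idP/imsetP => [jA|[t]]; last by rewrite inE => tA ->.
by exists (s^-1%g j); rewrite ?inE permKV.
Qed.

Lemma weight_perm (R : realFieldType) s F (x : 'I_n -> R) :
  weight x (perm_family s F) = weight (x \o s) F.
Proof.
rewrite /weight big_imset /=; last by move=> A B _ _; apply: imset_perm_inj.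
apply: eq_bigr => A _; rewrite /mon big_imset //.
by move=> i j _ _; apply: perm_inj.
Qed.

Lemma power_sum_perm (R : realFieldType) k s (x : 'I_n -> R) :
  power_sum k (x \o s) = power_sum k x.
Proof. by rewrite /power_sum [RHS](reindex_inj (@perm_inj _ s)). Qed.

Lemma sorting_perm (R : realFieldType) (x : 'I_n -> R) :
  exists s : {perm 'I_n}, forall i j : 'I_n, (i <= j)%N -> x (s j) <= x (s i).
Proof.
pose t := [tuple x i | i < n]; pose r : rel R := fun a b => b <= a.
have : perm_eq (sort r t) t by rewrite perm_sort.
case/tuple_permP => s st; exists s => i j ij.
have rt : transitive r by move=> b a c ba cb; apply: le_trans cb ba.
have so : sorted r (sort r t) by apply: sort_sorted => a b; apply: le_total.
have sz : size (sort r t) = n by rewrite size_sort size_tuple.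
have nthE (l : 'I_n) : nth 0 (sort r t) l = x (s l).
  rewrite st (nth_map l) ?size_enum_ord // nth_ord_enum tnth_mktuple.
  by [].
have := sorted_leq_nth rt (fun a => lexx a) 0 so.
by move=> /(_ i j); rewrite !inE !sz !nthE; apply; rewrite ?ltn_ord.
Qed.

(** Sorting the indicator function of [X] decreasingly puts the points of [X] first. *)
Lemma perm_initial m X : #|X| = m -> exists s : {perm 'I_n}, s @: initial n m = X.
Proof.
move=> Xm; have [s hs] := sorting_perm (fun i => ((i \in X) : nat)%:R : rat).
exists s; apply/eqP; rewrite eq_sym eqEcard card_imset; last exact: perm_inj.
rewrite card_initial; last by rewrite -Xm -[leqRHS]card_ord max_card.
rewrite Xm leqnn andbT; apply/subsetP => j jX.
apply/imsetP; exists (s^-1%g j); last by rewrite permKV.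
rewrite in_initial ltnNge; apply/negP => mj.
have : (m.+1 <= #|X|)%N; last by rewrite Xm ltnn.
rewrite -(card_imset _ (@perm_inj _ s^-1%g)).
rewrite -(@card_initial n m.+1); last by apply: leq_ltn_trans mj _.
apply: subset_leq_card; apply/subsetP => i; rewrite in_initial ltnS => im.
apply/imsetP; exists (s i); last by rewrite permK.
have := hs i (s^-1%g j) (leq_trans im mj); rewrite permKV jX.
by case: (s i \in X); rewrite // ler10.
Qed.

End Permutations.

(** * Compactness for the half-size case *)

Section ExcessMinimum.
Import all_classical all_analysis numFieldNormedType.Exports.

Variables (R : realType) (n k : nat).
Hypotheses (k1 : (1 < k)%N) (n2k : n = (2 * k)%N).
Implicit Types x y : 'I_n -> R.

Let k0 : (0 < k)%N. Proof. exact: ltnW. Qed.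

Lemma exists_root (s : R) : 0 < s -> exists2 c : R, 0 < c & c ^+ k = s.
Proof.
move=> s0; exists (s `^ k%:R^-1); first exact: powR_gt0.
rewrite -powR_mulrn ?powR_ge0 // -powRrM mulVf ?pnatr_eq0 -?lt0n // powRr1 //.
exact: ltW.
Qed.

Lemma mon_scale (T : finType) (c : R) (x : T -> R) A : mon (fun i => c * x i) A = c ^+ #|A| * mon x A.
Proof. by rewrite /mon big_split /= prodr_const. Qed.

Lemma power_sum_scale (T : finType) (c : R) (x : T -> R) :
  power_sum k (fun i => c * x i) = c ^+ k * power_sum k x.
Proof. by rewrite /power_sum mulr_sumr; apply: eq_bigr => i _; rewrite exprMn. Qed.

Lemma elsym_scale (T : finType) (D : {set T}) (c : R) (x : T -> R) :
  elsym k D (fun i => c * x i) = c ^+ k * elsym k D x.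
Proof.
by rewrite /elsym mulr_sumr; apply: eq_bigr => A /andP[_ /eqP Ak]; rewrite mon_scale Ak.
Qed.

Lemma excess_scale M (c : R) x : excess k M (fun i => c * x i) = c ^+ k ^+ 2 * excess k M x.
Proof.
have cT : #|[set: 'I_n]%SET| = (k * 2)%N by rewrite cardsT card_ord n2k mulnC.
by rewrite /excess power_sum_scale elsym_scale mon_scale cT exprM; ring.
Qed.

Lemma power_sum_ge0 (T : finType) (x : T -> R) : (forall i, 0 <= x i) -> 0 <= power_sum k x.
Proof. by move=> x0; apply: sumr_ge0 => i _; apply: exprn_ge0. Qed.

Lemma power_sum_eq0 (T : finType) (x : T -> R) :
  (forall i, 0 <= x i) -> power_sum k x = 0 -> forall i, x i = 0.
Proof.
move=> x0 /eqP; rewrite psumr_eq0 => [/allP H i|i _]; last exact: exprn_ge0.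
by have := H i; rewrite mem_index_enum expf_eq0 k0 => /(_ isT) /eqP.
Qed.

Lemma continuous_power_sum :
  continuous (fun v : 'rV[R]_n => power_sum k (fun i => v ord0 i)).
Proof.
apply: (@continuous_big R _ +%R) => [|i _]; first exact: add_continuous.
move=> v; apply: (@continuous_comp _ _ _ (fun M : 'rV[R]_n => M ord0 i) (fun y : R => y ^+ k)).
  exact: coord_continuous.
exact: exprn_continuous.
Qed.

Lemma continuous_mon A : continuous (fun v : 'rV[R]_n => mon (fun i => v ord0 i) A).
Proof.
apply: (@continuous_big R _ *%R) => [|i _]; first exact: mul_continuous.
exact: coord_continuous.
Qed.

Lemma compact_nonneg_sphere : compact (nonneg_sphere (R := R) (n := n) k).
Proof.
pose cube := [set v : 'rV[R]_n | forall i, (`[0, 1]%classic : set R) (v ord0 i)]%classic.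
have cube_compact : compact cube.
  by apply: (@rV_compact R n (fun=> `[0, 1]%classic)) => i; apply: segment_compact.
suff -> : nonneg_sphere (R := R) (n := n) k =
    (cube `&` (fun v : 'rV[R]_n => power_sum k (fun i => v ord0 i)) @^-1` [set 1])%classic.
  apply: compact_closedI => //; apply: preimage_closed; last exact: closed_eq.
  by move=> v _; apply: continuous_power_sum.
apply/seteqP; split=> v [v0 v1]; split=> // i; last by have := v0 i; rewrite /= in_itv => /andP[].
rewrite /= in_itv /= v0 /= -(@expr_le1 _ k) // -v1 (bigD1 i) //= lerDl.
by apply: sumr_ge0 => j _; apply: exprn_ge0.
Qed.

(** [M] is the maximum of [- excess k 0] on the sphere, hence the least value making the form
    nonnegative there and, by homogeneity, everywhere. The form vanishes at the maximizer, and
    [excess_extremal] gives [M = 1]. *)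
Lemma excess_ge0 y : (forall i, 0 <= y i) -> 0 <= excess k 1 y.
Proof.
have cardT : #|'I_n| = (2 * k)%N by rewrite card_ord.
have n0 : (0 < n)%N by rewrite n2k; nat_lia.
pose m := Ordinal n0.
pose g (v : 'rV[R]_n) : R := - excess k 0 (fun i => v ord0 i).
have cg : continuous g.
  have celsym : continuous (fun v : 'rV[R]_n => elsym k [set: 'I_n]%SET (fun i => v ord0 i)).
    apply: (@continuous_big R _ +%R) => [|A _]; first exact: add_continuous.
    exact: continuous_mon.
  have mulc (f h : 'rV[R]_n -> R) : continuous f -> continuous h -> continuous (fun v => f v * h v).
    by move=> cf ch v; apply: (@continuousM _ _ f h v (cf v) (ch v)).
  have addc (f h : 'rV[R]_n -> R) : continuous f -> continuous h -> continuous (fun v => f v + h v).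
    by move=> cf ch v; apply: (@continuousD _ _ _ f h v (cf v) (ch v)).
  have oppc (f : 'rV[R]_n -> R) : continuous f -> continuous (fun v => - f v).
    by move=> cf v; apply: (@continuousN _ _ _ f v (cf v)).
  have cstc (c : R) : continuous (fun _ : 'rV[R]_n => c) by move=> v; apply: cst_continuous.
  apply: (oppc _); apply: (addc _ _); last by apply: (mulc _ _) => //; apply: continuous_mon.
  apply: (addc _ _); last first.
    apply: (oppc _); apply: (mulc _ _); last exact: continuous_power_sum.
    by apply: (mulc _ _).
  apply: (mulc _ _) => //; have := mulc _ _ continuous_power_sum continuous_power_sum.
  by [].
have S0 : (nonneg_sphere (R := R) (n := n) k !=set0)%classic.
  exists (delta_mx ord0 m); split=> [i|]; first by rewrite mxE ler0n.
  rewrite (bigD1 m) //= mxE !eqxx expr1n big1 ?addr0 // => i /negPf ni.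
  by rewrite mxE ni andbF expr0n gtn_eqF.
have [|v + vmax] := EVT_max_rV S0 compact_nonneg_sphere (f := g).
  exact/continuous_subspaceT.
rewrite inE => -[v0 v1]; pose x i := v ord0 i; pose M := g v.
have excM (z : 'I_n -> R) : excess k M z = M * power_sum k z ^+ 2 + excess k 0 z.
  by rewrite /excess mul0r; ring.
have x1 : power_sum k x = 1 by [].
have exc0 : excess k M x = 0 by rewrite excM x1 expr1n mulr1 /M /g; lra.
have exc_sphere (z : 'I_n -> R) : (forall i, 0 <= z i) -> power_sum k z = 1 -> 0 <= excess k M z.
  move=> z0 z1; rewrite excM z1 expr1n mulr1.
  pose u : 'rV[R]_n := \row_(i < n) z i.
  have := vmax u; rewrite inE => /(_ _).
  have -> : g u = - excess k 0 z.
    by rewrite /g (_ : (fun i : 'I_n => u ord0 i) = z) //; apply/funext => i; rewrite mxE.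
  rewrite -/M => H; suff : - excess k 0 z <= M by lra.
  apply: H; split=> [i|]; first by rewrite mxE.
  by rewrite -[RHS]z1; apply: eq_bigr => i _; rewrite mxE.
have exc_ge0 (z : 'I_n -> R) : (forall i, 0 <= z i) -> 0 <= excess k M z.
  move=> z0; have := power_sum_ge0 z0; rewrite le_eqVlt => /orP[/eqP S|S].
    have zE := power_sum_eq0 z0 (esym S).
    rewrite /excess -S (mon_eq0 (finset.in_setT m) (zE m)); lra.
  have [c c0 cS] := exists_root S.
  have -> : z = (fun i => c * (c^-1 * z i)).
    by apply/funext => i; rewrite mulrA mulfV ?mul1r // gt_eqF.
  rewrite excess_scale; apply: mulr_ge0; first by rewrite !exprn_ge0 // ltW.
  apply: exc_sphere => [i|]; first by rewrite mulr_ge0 // invr_ge0 ltW.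
  by rewrite power_sum_scale exprVn cS mulVf // gt_eqF.
(* At the vector with one coordinate 0 and the others 1 the form is [(M - 1) * (2k - 1)^2]. *)
have M1 : 1 <= M.
  pose z (i : 'I_n) : R := if i == m then 0 else 1.
  have z0 i : 0 <= z i by rewrite /z; case: ifP.
  have := exc_ge0 z z0; rewrite /excess (mon_eq0 (finset.in_setT m)) /z ?eqxx // mulr0 addr0 -/z.
  have cm : #|[set~ m]| = (2 * k).-1 by rewrite cardsC1 card_ord n2k.
  have -> : power_sum k z = (2 * k).-1%:R.
    rewrite /power_sum (bigD1 m) //= /z eqxx expr0n gtn_eqF // add0r.
    rewrite (eq_bigr (fun=> 1)); last by move=> i /negPf ->; rewrite expr1n.
    by rewrite sumr_const -cm; congr (_ *+ _); apply: eq_card => i; rewrite !inE.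
  have -> : elsym k [set: 'I_n]%SET z = 'C((2 * k).-1, k)%:R.
    have kS : k = k.-1.+1 by nat_lia.
    rewrite {1}kS (elsym_split _ _ (finset.in_setT m)) {2}/z eqxx mul0r addr0 -kS.
    have -> : ([set: 'I_n] :\ m = [set~ m])%SET by apply/setP => i; rewrite !inE andbT.
    rewrite (@elsym_const _ _ k _ z 1) ?expr1n ?mulr1 ?cm //.
    by move=> i; rewrite !inE /z => /negPf ->.
  have C0 : 'C((2 * k).-1, k)%:R != 0 :> R by rewrite pnatr_eq0 -lt0n bin_gt0; nat_lia.
  have N0 : 0 < (2 * k).-1%:R :> R by rewrite ltr0n; nat_lia.
  rewrite divfK // -expr2 subr_ge0 -{1}[_ ^+ 2]mul1r ler_pM2r // exprn_gt0 //.
have [ME _] := excess_extremal k1 cardT M1 exc_ge0 v0 (eq_ind_r (fun a => 0 < a) ltr01 x1) exc0.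
by move=> y0; rewrite -ME; apply: exc_ge0.
Qed.

End ExcessMinimum.

(** * The spectral radius *)

Section Radius.
Variables (R : realType) (n k : nat).
Hypotheses (n0 : (0 < n)%N) (k1 : (1 < k)%N).
Implicit Types (F G : {set {set 'I_n}}) (x y : 'I_n -> R).

Notation rho F := (spectral_radius R k F).

Let k0 : (0 < k)%N. Proof. exact: ltnW. Qed.
Let k0R : 0 < k%:R :> R. Proof. by rewrite ltr0n. Qed.

Lemma uniformP F : reflect (uniform k F) (F \subset ksubsets [set: 'I_n] k).
Proof.
apply: (iffP subsetP) => [H A /H|H A /H Ak]; rewrite inE.
  by case/andP => _ /eqP.
by rewrite subsetT Ak eqxx.
Qed.

Lemma weight_scale F (c : R) x : uniform k F ->
  weight (fun i => c * x i) F = c ^+ k * weight x F.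
Proof.
move=> unif; rewrite /weight mulr_sumr; apply: eq_bigr => A FA.
by rewrite mon_scale unif.
Qed.

Lemma radius_attained F : exists x,
  [/\ forall i, 0 <= x i, power_sum k x = 1 & k%:R * weight x F = rho F].
Proof.
have [v [v0 v1] [vE _]] := spectral_radius_max R F n0 k0.
by exists (fun i => v ord0 i).
Qed.

Lemma radius_ge F x : (forall i, 0 <= x i) -> power_sum k x = 1 -> k%:R * weight x F <= rho F.
Proof.
move=> x0 x1; have [v _ [_ vmax]] := spectral_radius_max R F n0 k0.
pose u : 'rV[R]_n := \row_(i < n) x i.
have ux i : u ord0 i = x i by rewrite mxE.
have Su : nonneg_sphere k u.
  by split=> [i|]; [rewrite ux | rewrite -[RHS]x1; apply: eq_bigr => i _; rewrite ux].
suff <- : family_poly k F u = k%:R * weight x F by apply: vmax.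
rewrite /family_poly /weight; congr (_ * _); apply: eq_bigr => A _.
by apply: eq_bigr => i _; rewrite ux.
Qed.

Lemma radius_dominates F : uniform k F -> dominates k (rho F / k%:R) F.
Proof.
move=> unif y y0; rewrite mulrAC ler_pdivlMr // mulrC.
have := power_sum_ge0 k y0; rewrite le_eqVlt => /orP[/eqP S|S].
  have yE := power_sum_eq0 k1 y0 (esym S).
  rewrite -S mulr0 /weight big1 ?mulr0 // => A FA.
  have : (0 < #|A|)%N by rewrite unif.
  by rewrite card_gt0 => /set0Pn[i iA]; apply: (mon_eq0 iA (yE i)).
have [c c0 cS] := exists_root k1 S.
have yE : y = (fun i => c * (c^-1 * y i)).
  by apply/boolp.funext => i; rewrite mulrA mulfV ?mul1r // gt_eqF.
rewrite yE weight_scale // power_sum_scale mulrCA.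
have z0 i : 0 <= c^-1 * y i by rewrite mulr_ge0 // invr_ge0 ltW.
have z1 : power_sum k (fun i => c^-1 * y i) = 1.
  by rewrite power_sum_scale exprVn cS mulVf // gt_eqF.
by rewrite z1 mulr1 mulrC ler_pM2r ?exprn_gt0 // radius_ge.
Qed.

Lemma radius_le F w : dominates k w F -> rho F <= k%:R * w.
Proof.
move=> dom; have [x [x0 x1 <-]] := radius_attained F.
by rewrite ler_pM2l //; have := dom x x0; rewrite x1 mulr1.
Qed.

Lemma radius_subset F G : uniform k G -> F \subset G -> rho F <= rho G.
Proof.
move=> unif FG; have [x [x0 x1 <-]] := radius_attained F.
apply: le_trans (radius_ge G x0 x1).
by rewrite ler_pM2l //; apply: weight_subset.
Qed.

Lemma radius_perm s F : uniform k F -> rho (perm_family s F) = rho F.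
Proof.
have le t G : uniform k G -> rho (perm_family t G) <= rho G.
  move=> unif; rewrite -[leRHS](divfK (lt0r_neq0 k0R)) mulrC; apply: radius_le => y y0.
  rewrite weight_perm -(power_sum_perm k t).
  by apply: radius_dominates => // i; apply: y0.
move=> unif; apply/eqP; rewrite eq_le le //=.
have -> : rho F = rho (perm_family s^-1 (perm_family s F)).
  by rewrite perm_familyM mulgV perm_family1.
by apply: le; apply: perm_family_uniform.
Qed.

Variable i0 : 'I_n.
Hypothesis i00 : i0 = 0%N :> nat.

Lemma frankl0E : frankl n k 0 = star k i0.
Proof.
case: n i0 i00 => [[]//|n'] j j0.
rewrite frankl0_star; apply/setP => A; rewrite !inE subsetT /=.
by have -> : j = ord0 by apply: val_inj.
Qed.

Lemma radius_star (i : 'I_n) : rho (star k i) = rho (star k i0).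
Proof.
rewrite -{1}(tpermL i0 i) -perm_family_star radius_perm //; exact: star_uniform.
Qed.

Lemma eq_star F (i : 'I_n) : F = star k i -> eq_up_to_perm F (star k i0).
Proof. by move=> ->; exists (tperm i0 i); rewrite perm_family_star tpermL. Qed.

Lemma eq_ksubsets F (X : {set 'I_n}) m : #|X| = m -> F = ksubsets X k ->
  eq_up_to_perm F (ksubsets (initial n m) k).
Proof.
move=> Xm ->; have [s sX] := perm_initial Xm.
by exists s; rewrite perm_family_ksubsets sX.
Qed.

Lemma ksubsets_uniform (X : {set 'I_n}) : uniform k (ksubsets X k).
Proof. by move=> A; rewrite inE => /andP[_ /eqP]. Qed.

Lemma substar_radius F (i : 'I_n) : (2 * k < n)%N -> F \subset star k i ->
  rho F = rho (star k i) -> F = star k i.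
Proof.
move=> kn Fs E; have [x [x0 x1 xF]] := radius_attained F.
have dom := radius_dominates (@star_uniform n k i).
have wE w : k%:R * w = rho (star k i) -> w = rho (star k i) / k%:R.
  by move=> <-; rewrite mulrAC divff ?mul1r // lt0r_neq0.
have wF : weight x F = rho (star k i) / k%:R by apply: wE; rewrite xF.
have ws : weight x (star k i) = rho (star k i) / k%:R.
  apply/eqP; rewrite eq_le -{2}wF weight_subset // andbT.
  by have := dom x x0; rewrite x1 mulr1.
exact: (substar_optimal k1 kn x0 dom x1 ws Fs wF).
Qed.

(** Among the finitely many families one has maximal radius; it supplies [opt] for
    [optimal_is_star], which also needs a decreasing vector, hence the relabelling by [s]. *)
Lemma max_radius_star F : (2 < k)%N -> (2 * k < n)%N -> uniform k F -> intersecting F ->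
  rho F <= rho (star k i0) /\ (rho F = rho (star k i0) -> exists i, F = star k i).
Proof.
move=> k2 kn unif int.
pose P (G : {set {set 'I_n}}) := (G \subset ksubsets [set: 'I_n] k)
  && [forall A in G, forall B in G, A :&: B != set0].
have PP G : reflect (uniform k G /\ intersecting G) (P G).
  apply: (iffP andP) => [[/uniformP uG /forall_inP iG]|[/uniformP uG iG]]; split=> //.
    by move=> A B GA GB; move/forall_inP: (iG A GA) => /(_ B GB).
  by apply/forall_inP => A GA; apply/forall_inP => B GB; apply: iG.
have PF : P F by apply/PP.
have [M /PP[uM iM] maxM] := arg_maxP (fun G => rho G) PF.
have opt G : uniform k G -> intersecting G -> dominates k (rho M / k%:R) G.
  move=> uG iG y y0; apply: le_trans (radius_dominates uG y0) _.
  rewrite ler_wpM2r ?power_sum_ge0 // ler_wpM2r ?invr_ge0 ?ler0n //.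
  by apply: maxM; apply/PP.
have main G : uniform k G -> intersecting G -> rho G = rho M -> exists i, G = star k i.
  move=> uG iG E; have [x [x0 x1 xG]] := radius_attained G.
  have [s hs] := sorting_perm x.
  exists (s i0); rewrite -perm_family_star -(perm_familyK s G); congr (perm_family s _).
  apply: (@optimal_is_star R n k (x \o s) (rho M / k%:R)) => //.
  - by move=> i; apply: x0.
  - by rewrite power_sum_perm.
  - exact: perm_family_uniform.
  - exact: perm_family_intersecting.
  - rewrite -weight_perm perm_familyK -E -xG.
    by rewrite mulrAC divff ?mul1r // lt0r_neq0.
have [i Mi] := main M uM iM erefl.
have E : rho M = rho (star k i0) by rewrite Mi radius_star.
by rewrite -E; split; [apply: maxM | apply: main].
Qed.

End Radius.

(** * Intersecting graphs *)

Section Graphs.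
Variables (R : realType) (n : nat).
Hypothesis n4 : (3 < n)%N.
Implicit Types (F : {set {set 'I_n}}) (X : {set 'I_n}).

Notation rho F := (spectral_radius R 2 F).

Let n0 : (0 < n)%N. Proof. exact: leq_trans n4. Qed.
Variable i0 : 'I_n.

(** Without a common vertex, an edge [ab], an edge avoiding [a] and an edge avoiding [b] form a
    triangle, and an edge meeting all three sides lies inside it. *)
Lemma intersecting_graph F : uniform 2 F -> intersecting F ->
  (exists i, F \subset star 2 i) \/ exists2 X : {set 'I_n}, #|X| = 3 & F \subset ksubsets X 2.
Proof.
move=> unif int; have [->|[A FA]] := set_0Vmem F.
  by left; exists i0; apply: sub0set.
have /cards2P[a [b [ab Aab]]] : #|A| == 2 by rewrite unif.
have [/existsP[i /forall_inP Fi]|nstar] := boolP [exists i, [forall B in F, i \in B]].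
  by left; exists i; apply/subsetP => B FB; rewrite inE unif // eqxx Fi.
have notin i : exists2 B, B \in F & i \notin B.
  by apply/exists_inP; move/existsPn/(_ i): nstar; rewrite negb_forall_in.
have edge u v (B : {set 'I_n}) : u \in B -> v \in B -> u != v -> B \in F -> B = [set u; v].
  move=> uB vB uv FB; apply/eqP; rewrite eq_sym eqEcard unif // cards2 uv andbT.
  by apply/subsetP => t; rewrite !inE => /orP[/eqP ->|/eqP ->].
have [B FB aB] := notin a; have [C FC bC] := notin b.
have bB : b \in B.
  have /set0Pn[t] := int _ _ FA FB; rewrite Aab !inE => /andP[/orP[/eqP ->|/eqP ->]] //.
  by rewrite (negPf aB).
have aC : a \in C.
  have /set0Pn[t] := int _ _ FA FC; rewrite Aab !inE => /andP[/orP[/eqP ->|/eqP ->]] //.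
  by rewrite (negPf bC).
have /set0Pn[c] := int _ _ FB FC; rewrite inE => /andP[cB cC].
have ca : c != a by apply: contraNneq aB => <-.
have cb : c != b by apply: contraNneq bC => <-.
have BE : B = [set b; c] by apply: edge => //; rewrite eq_sym.
have CE : C = [set a; c] by apply: edge => //; rewrite eq_sym.
right; exists (a |: [set b; c]).
  by rewrite cardsU1 cards2 !inE negb_or ab (eq_sym a) ca (eq_sym b) cb.
apply/subsetP => D FD; rewrite inE unif // eqxx andbT.
have hit (E : {set 'I_n}) : E \in F -> exists2 t, t \in E & t \in D.
  by move=> FE; have /set0Pn[t] := int _ _ FE FD; rewrite inE => /andP[]; exists t.
have [t + tD] := hit _ FA; rewrite Aab => tA.
have [u + uD] := hit _ FB; rewrite BE => uB.
have [v + vD] := hit _ FC; rewrite CE => vC.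
have inX z : z \in [set a; b] \/ z \in [set b; c] \/ z \in [set a; c] ->
    z \in (a |: [set b; c]).
  by rewrite !inE => -[|[]] /orP[] ->; rewrite ?orbT.
have [tu|tu] := eqVneq t u; last first.
  by rewrite (edge t u D) //; apply/subsetP => z; rewrite !in_set2 => /orP[/eqP ->|/eqP ->];
    apply: inX; [left | right; left].
have [tv|tv] := eqVneq t v; last first.
  by rewrite (edge t v D) //; apply/subsetP => z; rewrite !in_set2 => /orP[/eqP ->|/eqP ->];
    apply: inX; [left | right; right].
exfalso; move: tA uB vC; rewrite -tu -tv !in_set2.
by case/orP => /eqP ->;
  rewrite ?(negPf ab) ?(eq_sym a c) ?(eq_sym b c) ?(eq_sym b a) ?(negPf ca) ?(negPf cb) ?(negPf ab).
Qed.

Lemma triangle_bound X F : #|X| = 3 -> F \subset ksubsets X 2 -> rho F <= 2.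
Proof.
move=> X3 FX; rewrite -[leRHS]mulr1; apply: radius_le => // y y0; rewrite mul1r.
apply: le_trans (weight_subset y0 FX) _.
have := elsym_le_power_sum X y0 (isT : (0 < 2)%N); rewrite X3 /=.
have -> : elsym 2 X y = weight y (ksubsets X 2) by apply: eq_bigl => A; rewrite inE.
have : \sum_(i in X) y i ^+ 2 <= power_sum 2 y.
  rewrite /power_sum [leRHS](bigID (mem X)) /= lerDl.
  by apply: sumr_ge0 => i _; apply: exprn_ge0.
rewrite bin1; lra.
Qed.

Lemma triangle_radius X : #|X| = 3 -> rho (ksubsets X 2) = 2.
Proof.
move=> X3; apply/eqP; rewrite eq_le (triangle_bound X3) //=.
pose y i : R := (i \in X)%:R.
have y0 i : 0 <= y i by apply: ler0n.
have := radius_dominates n0 (ltnSn 1) (@ksubsets_uniform n 2 X) y0.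
have -> : weight y (ksubsets X 2) = 3.
  have -> : weight y (ksubsets X 2) = elsym 2 X y by apply: eq_bigl => A; rewrite inE.
  by rewrite (@elsym_const _ _ 2 X y 1) ?X3 ?expr1n ?mulr1 // => i; rewrite /y => ->.
have -> : power_sum 2 y = 3.
  rewrite /power_sum (bigID (mem X)) /= [X in _ + X]big1 ?addr0; last first.
    by move=> i; rewrite /y => /negPf ->; rewrite expr0n.
  rewrite (eq_bigr (fun=> 1)); last by move=> i; rewrite /y => ->; rewrite expr1n.
  by rewrite sumr_const X3.
lra.
Qed.

(** The centre gets weight 2, which is optimal for [n = 5]; the bound equals 2 there and exceeds 2
    for larger [n]. *)
Lemma star2_radius_ge : 4 * n.-1%:R / (n.-1%:R + 4) <= rho (star 2 i0).
Proof.
pose y i : R := if i == i0 then 2 else 1.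
have y0 i : 0 <= y i by rewrite /y; case: ifP.
have := radius_dominates n0 (ltnSn 1) (@star_uniform n 2 i0) y0.
have yi j : j != i0 -> y j = 1 by rewrite /y => /negPf ->.
rewrite (weight_star (isT : (0 < 2)%N) yi) /power_sum (bigD1 i0) //=.
rewrite (eq_bigr (fun=> 1)); last by move=> j /yi ->; rewrite expr1n.
have -> : \sum_(i < n | i != i0) 1 = n.-1%:R :> R.
  rewrite sumr_const; have <- : #|[set~ i0]| = n.-1 by rewrite cardsC1 card_ord.
  by congr (_ *+ _); apply: eq_card => j; rewrite !inE.
have n1 : 0 <= n.-1%:R :> R by apply: ler0n.
rewrite {1 2}/y eqxx expr1 bin1 ler_pdivrMr; last by lra.
lra.
Qed.

Lemma star2_radius_5 : n = 5 -> rho (star 2 i0) = 2.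
Proof.
move=> n5; apply/eqP; rewrite eq_le; apply/andP; split; last first.
  by apply: le_trans star2_radius_ge; rewrite n5 /= ler_pdivlMr; lra.
rewrite -[leRHS]mulr1; apply: radius_le => // y y0; rewrite mul1r.
have starE : star 2 i0 = ([set [set i0; j] | j in [set~ i0]]).
  apply/setP => A; rewrite inE; apply/andP/imsetP => [[A2 iA]|[j ji ->]]; last first.
    by move: ji; rewrite !inE cards2 eq_sym eqxx => ->.
  have /cards1P[j Aj] : #|(A :\ i0)| == 1%N.
    by move: A2; rewrite (cardsD1 i0) iA.
  have : j \in (A :\ i0) by rewrite Aj in_set1.
  rewrite in_setD1 => /andP[ji _]; exists j; first by rewrite !inE.
  by rewrite -(setD1K iA) Aj.
rewrite starE /weight big_imset /=; last first.
  move=> i j; rewrite !inE => ii ji /setP /(_ j).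
  by rewrite !in_set2 eqxx orbT (negPf ji) => /eqP ->.
have -> : power_sum 2 y = y i0 ^+ 2 + \sum_(j in [set~ i0]) y j ^+ 2.
  rewrite /power_sum (bigD1 i0) //=; congr (_ + _); apply: eq_bigl => j.
  by rewrite !inE.
(* The square at the centre is shared equally among the four edges, each bounded by
   [y i0 * y j <= y i0 ^+ 2 / 4 + y j ^+ 2]. *)
have -> : y i0 ^+ 2 = \sum_(j in [set~ i0]) y i0 ^+ 2 / 4.
  by rewrite sumr_const cardsC1 card_ord n5 /= -mulr_natl; field.
rewrite -big_split /=; apply: ler_sum => j; rewrite !inE eq_sym => ij.
rewrite /mon big_setU1 ?in_set1 // big_set1.
by have := sqr_ge0 (y i0 / 2 - y j); rewrite /=; lra.
Qed.

End Graphs.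

(** * The radius on 2k points *)

Section HalfRadius.
Variables (R : realType) (n k : nat).
Hypotheses (k1 : (1 < k)%N) (n2k : n = (2 * k)%N).
Implicit Types F : {set {set 'I_n}}.

Notation rho F := (spectral_radius R k F).

Let n0 : (0 < n)%N. Proof. by rewrite n2k; nat_lia. Qed.
Let k0 : (0 < k)%N. Proof. exact: ltnW. Qed.
Let k0R : 0 < k%:R :> R. Proof. by rewrite ltr0n. Qed.

Let cardT : #|'I_n| = (2 * k)%N. Proof. by rewrite card_ord. Qed.

Let bin_max : R := 'C((2 * k).-2, k.-1)%:R.

Lemma half_radius_le F : uniform k F -> intersecting F -> rho F <= bin_max.
Proof.
move=> unif int; have [x [x0 x1 <-]] := radius_attained R n0 k1 F.
have x1' : 0 < power_sum k x by rewrite x1.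
have := half_bound k1 cardT (excess_ge0 k1 n2k) unif int x0 x1'.
by rewrite x1 mulr1.
Qed.

Lemma half_radius_eq F : uniform k F -> intersecting F -> rho F = bin_max ->
  exists m, F = ksubsets [set~ m] k.
Proof.
move=> unif int E; have [x [x0 x1 xF]] := radius_attained R n0 k1 F.
have x1' : 0 < power_sum k x by rewrite x1.
have [|m ->] := half_bound_eq k1 cardT (excess_ge0 k1 n2k) unif int x0 x1'.
  by rewrite x1 mulr1 xF.
exists m; apply/setP => A; rewrite !inE andbC; congr (_ && _).
by rewrite subsetC sub1set inE.
Qed.

Lemma ksubsets_intersecting (X : {set 'I_n}) : (#|X| < 2 * k)%N -> intersecting (ksubsets X k).
Proof.
move=> Xk A B; rewrite !inE => /andP[AX /eqP Ak] /andP[BX /eqP Bk].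
apply: contraTneq Xk => AB; rewrite -leqNgt.
have : (#|A :|: B| <= #|X|)%N by rewrite subset_leq_card // subUset AX.
by rewrite cardsU AB cards0 Ak Bk; nat_lia.
Qed.

Lemma half_radius_initial : rho (ksubsets (initial n (2 * k).-1) k) = bin_max.
Proof.
set X := initial n (2 * k).-1.
have cX : #|X| = (2 * k).-1 by rewrite card_initial // n2k leq_pred.
apply/eqP; rewrite eq_le; apply/andP; split.
  by apply: half_radius_le; [apply: ksubsets_uniform | apply: ksubsets_intersecting; rewrite cX; nat_lia].
pose y i : R := (i \in X)%:R.
have y0 i : 0 <= y i by apply: ler0n.
have := radius_dominates n0 k1 (@ksubsets_uniform n k X) y0.
have -> : weight y (ksubsets X k) = 'C((2 * k).-1, k)%:R.
  have -> : weight y (ksubsets X k) = elsym k X y by apply: eq_bigl => A; rewrite inE.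
  by rewrite (@elsym_const _ _ k X y 1) ?cX ?expr1n ?mulr1 // => i; rewrite /y => ->.
have -> : power_sum k y = (2 * k).-1%:R.
  rewrite /power_sum (bigID (mem X)) /= [X in _ + X]big1 ?addr0; last first.
    by move=> i; rewrite /y => /negPf ->; rewrite expr0n gtn_eqF.
  rewrite (eq_bigr (fun=> 1)); last by move=> i; rewrite /y => ->; rewrite expr1n.
  by rewrite sumr_const cX.
rewrite mulrAC ler_pdivlMr // -natrM mulnC central_bin natrM mulrC ler_pM2r //.
by rewrite ltr0n; nat_lia.
Qed.

End HalfRadius.

Theorem theorem1p3 (R : realType) (n k : nat) :
  (2 <= k)%N -> (2 * k <= n)%N ->
  ((2 * k + 1 <= n)%N ->
     (forall F : {set {set 'I_n}},
        F \subset ksubsets [set: 'I_n] k -> intersecting F ->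
        spectral_radius R k F <= spectral_radius R k (frankl n k 0))
     /\ ((n, k) <> (5, 2)%N ->
         forall F : {set {set 'I_n}},
           F \subset ksubsets [set: 'I_n] k -> intersecting F ->
           (spectral_radius R k F = spectral_radius R k (frankl n k 0)
            <-> eq_up_to_perm F (frankl n k 0)))
     /\ ((n, k) = (5, 2)%N ->
         forall F : {set {set 'I_n}},
           F \subset ksubsets [set: 'I_n] k -> intersecting F ->
           (spectral_radius R k F = spectral_radius R k (frankl n k 0)
            <-> eq_up_to_perm F (frankl n k 0)
                \/ eq_up_to_perm F (ksubsets (initial n 3) 2))))
  /\ (n = (2 * k)%N ->
      spectral_radius R k (frankl n k (k - 1)) = 'C(2 * k - 2, k - 1)%:R
      /\ forall F : {set {set 'I_n}},
           F \subset ksubsets [set: 'I_n] k -> intersecting F ->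
           spectral_radius R k F <= 'C(2 * k - 2, k - 1)%:R
           /\ (spectral_radius R k F = 'C(2 * k - 2, k - 1)%:R
               <-> eq_up_to_perm F (ksubsets (initial n (2 * k - 1)) k))).
Proof.
move=> k1 kn; have n0 : (0 < n)%N by nat_lia.
pose i0 := Ordinal n0.
have frE : frankl n k 0 = star k i0 by apply: frankl0E.
have toperm (F G : {set {set 'I_n}}) : uniform k G -> eq_up_to_perm F G ->
    spectral_radius R k F = spectral_radius R k G.
  by move=> uG [s ->]; apply: radius_perm.
split; last first.
  move=> n2k; have kk : (2 * k - 1 = (2 * k).-1)%N by rewrite subn1.
  have hI := half_radius_initial R k1 n2k.
  rewrite frankl_max; last exact: ltnW.
  rewrite subn2 !subn1; split=> // F /uniformP unif int.
  split; first exact: half_radius_le.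
  split=> [/(half_radius_eq k1 n2k unif int)[m ->]|].
    by apply: (eq_ksubsets (X := [set~ m])) => //; rewrite cardsC1 card_ord n2k.
  by rewrite -hI; apply: toperm; apply: ksubsets_uniform.
rewrite addn1 => kn'; rewrite !frE.
have star_conv (F : {set {set 'I_n}}) : eq_up_to_perm F (star k i0) ->
    spectral_radius R k F = spectral_radius R k (star k i0).
  by apply: toperm; apply: star_uniform.
have [k2|k2] := ltnP 2 k.
  have maxs (F : {set {set 'I_n}}) (unif : uniform k F) int :=
    max_radius_star R n0 k1 (erefl : i0 = 0 :> nat) k2 kn' unif int.
  split=> [F /uniformP unif int|]; first by have [] := maxs F unif int.
  split=> [_ F /uniformP unif int|[_ kE]]; last by rewrite kE in k2.
  split=> [/(proj2 (maxs F unif int))[i]|]; last exact: star_conv.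
  exact: eq_star.
have {k2} kE : k = 2%N by apply/eqP; rewrite eqn_leq k2.
subst k.
have n4 : (3 < n)%N by exact: ltnW.
have [graph tri] := (intersecting_graph i0, triangle_bound R n4).
have ge2 : 2 <= spectral_radius R 2 (star 2 i0).
  apply: le_trans (star2_radius_ge R n4 i0).
  have : 4 <= n.-1%:R :> R by rewrite ler_nat; nat_lia.
  by move=> n1; rewrite ler_pdivlMr; lra.
have sub (F : {set {set 'I_n}}) i : F \subset star 2 i -> spectral_radius R 2 F <= spectral_radius R 2 (star 2 i0).
  by move=> Fi; rewrite -(radius_star R n0 k1 i0 i); apply: radius_subset => //; apply: star_uniform.
have sub_eq (F : {set {set 'I_n}}) i : F \subset star 2 i -> spectral_radius R 2 F = spectral_radius R 2 (star 2 i0) ->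
    F = star 2 i.
  by rewrite -(radius_star R n0 k1 i0 i); apply: substar_radius.
split=> [F /uniformP unif int|].
  have [[i /sub]//|[X X3 /(tri _ _ X3) le2]] := graph F unif int; exact: le_trans ge2.
split=> [n5 F /uniformP unif int|[n5] F /uniformP unif int].
  split=> [E|]; last exact: star_conv.
  have [[i /sub_eq/(_ E)]|[X X3 /(tri _ _ X3)]] := graph F unif int; first exact: eq_star.
  (* Here [n >= 6], so the star has radius above 2 and no family inside a triangle reaches it. *)
  rewrite E leNgt => /negP[]; apply: lt_le_trans (star2_radius_ge R n4 i0).
  have : 5 <= n.-1%:R :> R.
    by rewrite ler_nat; have : n <> 5 by [move=> n5'; apply: n5; rewrite n5']; nat_lia.
  by move=> n1; rewrite ltr_pdivlMr; lra.
have E2 := star2_radius_5 R n4 i0 n5; split; last first.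
  case=> [/star_conv//|[s ->]]; rewrite E2 perm_family_ksubsets; apply: triangle_radius => //.
  by rewrite card_imset ?card_initial //; [apply: ltnW | apply: perm_inj].
move=> E; have [[i /sub_eq/(_ E) Fi]|[X X3 FX]] := graph F unif int.
  by left; apply: eq_star Fi.
have [F_eq|] := eqVneq F (ksubsets X 2); first by right; apply: eq_ksubsets X3 F_eq.
rewrite eqEsubset FX => /subsetPn[A]; rewrite inE => /andP[AX /eqP A2] FA.
(* A proper subfamily of the triangle misses an edge [A] and so lies in the star at the opposite
   vertex [c]. By optimality it would be that full star, which has an edge leaving [X]. *)
have [c cX cA] : exists2 c, c \in X & c \notin A.
  by apply/subsetPn/negP => /subset_leq_card; rewrite X3 A2.
have Fc : F \subset star 2 c.
  apply/subsetP => B FB; have := subsetP FX B FB; rewrite !inE => /andP[BX /eqP B2].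
  rewrite B2 eqxx /=; apply: contraR FA => cB.
  suff -> : A = B by [].
  have Xc : #|X :\ c| = 2 by have := cardsD1 c X; rewrite X3 cX => -[].
  have AXc : A = X :\ c by apply/eqP; rewrite eqEcard subsetD1 AX cA Xc A2.
  by rewrite AXc; apply/esym/eqP; rewrite eqEcard subsetD1 BX cB Xc B2.
have [d _ dX] : exists2 d, d \in [set: 'I_n] & d \notin X.
  by apply/subsetPn/negP => /subset_leq_card; rewrite X3 cardsT card_ord n5.
have : [set c; d] \in F.
  rewrite (sub_eq F c Fc E) !inE cards2 eqxx.
  by have -> : c != d by apply: contraNneq dX => <-.
by move/(subsetP FX); rewrite !inE subUset !sub1set (negPf dX) andbF.
Qed.
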